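(* There is an explicit genus-preserving one-to-one correspondence between (a) hyperelliptic graphs up to isomorphism, (b) BY trees up to isomorphism, (c) cluster pictures up to equivalence. Explicitly, $G\mapsto\underline{T}(G)$ and $T\mapsto\underline{G}(T)$ induce mutually inverse genus-preserving bijections between (a) and (b), and sending a cluster picture $\Sigma$ to the core of the open BY tree $\underline{T}(\Sigma)$ induces a genus-preserving bijection from (c) to (b).
   Context: **Graphs.** Graphs are finite topological graphs with a chosen vertex set; loops and multiple edges are allowed, a loop counts twice in the degree. Isomorphisms of graphs are homotopy classes of homeomorphisms preserving vertices and edges (equivalently, incidence-preserving bijections of vertices and half-edges). An open edge is a half-open edge with only one endpoint in the graph (it ''goes off to $\infty$''); it counts in degrees. **Hyperelliptic graphs.** A (closed) hyperelliptic graph is a connected graph $G$ with a genus function $g:V(G)\to\mathbb{Z}_{\ge0}$ and a graph isomorphism $\iota:G\to G$, $\iota^2=1$, such that (1) vertices of non-zero genus are $\iota$-invariant; (2) genus $0$ vertices have degree $\ge3$; (3) $2g(v)+2\ge\#\{\iota\text{-invariant edges at }v\}$ for every vertex $v$; (4) the topological quotient $G/\langle\iota\rangle$ is a tree. An edge is $\iota$-invariant if $\iota$ fixes it pointwise, and $\iota$-anti-invariant if $\iota$ maps it to itself reversing its direction. Two exceptions violating (2) are also declared hyperelliptic graphs: a single genus $0$ vertex without edges, and the circle with two $\iota$-fixed genus $0$ vertices and two edges swapped by $\iota$. The genus is $g(G)=\mathrm{rk}\,H_1(G,\mathbb{Z})+\sum_v g(v)$. Isomorphisms preserve vertices, edges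 and genera and commute with $\iota$. **BY trees.** A (closed) BY tree is a finite tree $T$ with $g:V(T)\to\mathbb{Z}_{\ge0}$ and a colouring of vertices and edges blue/yellow such that (1) yellow vertices have genus $0$, degree $\ge3$ and only yellow edges; (2) blue vertices of genus $0$ have at least one yellow edge; (3) $2g(v)+2\ge\#\{\text{blue edges at }v\}$ for every vertex. An open BY tree is a finite tree with a unique open edge satisfying the same conditions. Genus $0$ exceptions to (2): a single blue genus $0$ vertex without edges is a BY tree, and a single blue genus $0$ vertex with a blue open edge is an open BY tree. $T_b\subset T$ is the closed blue part, $T_y=T\setminus T_b$. The genus is $g(T)=\mathrm{rk}\,H_1(T,T_b)+\sum_v g(v)$. Isomorphic means: homeomorphic preserving vertices, edges, genera and colours. A closed BY subtree $T'$ of $T$ is a closed BY tree that as a space is a closed union of vertices and edges of $T$, whose vertices are the vertices of $T$ in $T'$ except those of genus $0$ that in $T'$ have degree $2$ with both edges of the same colour as the vertex (these become interior points of edges), with genera as in $T$ (the one-vertex genus $0$ exception is admitted as a subtree only if $g(T)=0$). The core $\tilde T$ of an open BY tree is its unique maximal closed BY subtree. **Cluster pictures.** A cluster picture is a finite set $X$ with a collection $\Sigma$ of non-empty subsets (clusters) such that $X$ and every singleton are clusters, and any two clusters are disjoint or nested. It has genus $g$ if $|X|\in\{2g+1,2g+2\}$. Isomorphisms are bijections $X\to X'$ taking $\Sigma$ to $\Sigma'$. $\mathfrak{s}'<\mathfrak{s}$ (''$\mathfrak{s}'$ is a child of $\mathfrak{s}$'') means $\mathfrak{s}'$ is a maximal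 cluster strictly contained in $\mathfrak{s}$. A cluster is proper if $|\mathfrak{s}|>1$ or $|\mathfrak{s}|=|X|=1$; odd/even according to its size; a proper cluster is übereven if it has no odd children (if $|X|=1$, $X$ is regarded as non-übereven of genus $0$). A non-übereven proper cluster has genus $g(\mathfrak{s})=g$ if it has $2g+1$ or $2g+2$ odd children; übereven clusters have genus $0$. Two cluster pictures are equivalent if one is isomorphic to a picture obtained from the other by finitely many moves $(X,\Sigma)\to(X',\Sigma')$ ($g$ being the genus): (i) $X'=X$, $\Sigma'=\Sigma\cup\{X\setminus\mathfrak{s}\}$ for some $\mathfrak{s}<X$, $|X|=2g+2$; (ii) $X'=X$, $\Sigma'=\Sigma\setminus\{\mathfrak{s}\}$ for some $\mathfrak{s}<X$ with $|\mathfrak{s}|\ge2$, when $X$ has exactly two children and $|X|=2g+2$; (iii) $X'=X\sqcup\{r\}$, $\Sigma'=\Sigma\cup\{X',\{r\}\}$, when $|X|=2g+1$; (iv) $X=X'\sqcup\{r\}$, $\Sigma=\Sigma'\cup\{X,\{r\}\}$, when $|X|=2g+2$ (inverse of (iii)). **$\underline{T}(G)$.** $T=G/\langle\iota\rangle$; points with one preimage are blue, those with two preimages yellow. Each $\iota$-invariant vertex gives a blue vertex of the same genus, each swapped pair of vertices a yellow vertex of genus $0$, each $\iota$-invariant edge a blue edge, each swapped pair of edges a yellow edge, and each $\iota$-anti-invariant edge from $v$ to $\iota(v)$ (possibly a loop) a yellow edge from the image of $v$ to an extra blue genus $0$ leaf (image of the midpoint). **$\underline{G}(T)$.** Glue two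 copies $T^\pm$ of $T$ along $T_b$; $\iota$ swaps the copies. The vertices are the preimages of the vertices of $T$ that are not genus $0$ leaves (genus $0$, degree $1$): a blue vertex has one preimage, of the same genus; a yellow one has two, of genus $0$. (So the edge from a genus $0$ leaf to $w$ yields an $\iota$-anti-invariant edge joining the preimages of $w$.) Exceptions: if $T$ consists of two genus $0$ leaves joined by a yellow edge, both preimages of leaves are vertices (the exceptional circle); if $T$ is a single vertex, its preimage is a vertex. **$\underline{T}(\Sigma)$.** The open BY tree with one vertex $v_{\mathfrak{s}}$ for every proper cluster $\mathfrak{s}$, yellow if $\mathfrak{s}$ is übereven and blue otherwise, of genus $g(\mathfrak{s})$; for each $\mathfrak{s}'<\mathfrak{s}$ with $\mathfrak{s}'$ proper, an edge $v_{\mathfrak{s}'}v_{\mathfrak{s}}$, yellow if $\mathfrak{s}'$ is even and blue otherwise; and an open edge at $v_X$, yellow if $X$ is even and blue otherwise. *)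

(* Defs.v *)
From mathcomp Require Import all_boot all_algebra.
From Stdlib Require Import Relation_Operators.

Set Implicit Arguments.
Unset Strict Implicit.
Unset Printing Implicit Defensive.

(* A graph is given by its vertices and its half-edges ("darts"): [src h] is the
   vertex at which [h] starts and [opp h] is the other half of the same edge.
   An edge is an orbit of [opp]; a fixed point of [opp] is an open edge.
   A loop contributes two darts at its vertex. *)
Record graph := Graph {
  vert : finType;
  dart : finType;
  src : dart -> vert;
  opp : dart -> dart;
  oppK : involutive opp
}.

Definition closed_graph (G : graph) : Prop := forall h : dart G, opp h != h.

Definition degree (G : graph) (v : vert G) : nat := #|[set h | src h == v]|.

Definition adj (G : graph) : rel (vert G) :=
  fun u v => [exists h : dart G, (src h == u) && (src (opp h) == v)].

Definition connected (G : graph) : Prop :=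
  inhabited (vert G) /\ forall u v : vert G, connect (@adj G) u v.

Definition next_dart (G : graph) : rel (dart G) :=
  fun h k => [&& opp h != h, src k == src (opp h) & k != opp h].

(* A loop is a circuit of length 1, two parallel edges form a circuit of
   length 2. *)
Definition circuit (G : graph) (c : seq (dart G)) : bool :=
  [&& c != [::], cycle (@next_dart G) c & uniq (map (@src G) c)].

Definition is_tree (G : graph) : Prop :=
  connected G /\ forall c : seq (dart G), ~~ circuit c.

Section RelativeBetti.
Variables (G : graph) (A : pred (vert G)) (B : pred (dart G)).

(* Closed edges outside [B], each represented by one of its two darts. *)
Definition rel_edge : finType :=
  {h : dart G | (enum_rank h < enum_rank (opp h)) && ~~ B h}.

Definition rel_vert : finType := {v : vert G | ~~ A v}.

Definition rel_boundary : 'M[rat]_(#|rel_edge|, #|rel_vert|) :=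
  (\matrix_(i, j)
     ((src (opp (val (enum_val i))) == val (enum_val j))%:R
      - (src (val (enum_val i)) == val (enum_val j))%:R))%R.

(* rk H_1(G, S; Z) for the subgraph S with vertices [A] and edges [B]: the rank
   of the kernel of the relative cellular boundary map C_1(G, S) -> C_0(G, S)
   (acting on row vectors). Open edges are contracted to their endpoint, which
   does not change the homotopy type of the pair. *)
Definition rel_betti : nat := \rank (kermx rel_boundary).

End RelativeBetti.

Definition betti (G : graph) : nat := @rel_betti G pred0 pred0.

Record igraph := IGraph {
  ig :> graph;
  igenus : vert ig -> nat;
  iV : vert ig -> vert ig;
  iD : dart ig -> dart ig;
  iVK : involutive iV;
  iDK : involutive iD;
  src_iD : forall h, src (iD h) = iV (src h);
  opp_iD : forall h, opp (iD h) = iD (opp h)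
}.

Definition invariant (G : igraph) (h : dart G) : bool := iD h == h.

Definition anti_invariant (G : igraph) (h : dart G) : bool :=
  (iD h == opp h) && (iD h != h).

Section Orbits.
Variables (A : finType) (f : A -> A) (fK : involutive f).

(* The orbits of [f], encoded by their canonical representatives. *)
Definition orb : finType := {x : A | froots f x}.

Definition to_orb (x : A) : orb :=
  Sub (froot f x) (roots_root (fconnect_sym (inv_inj fK)) x).

Lemma val_to_orb x : (val (to_orb x) = x) \/ (val (to_orb x) = f x).
Proof.
rewrite /to_orb SubK.
have : fconnect f x (froot f x) by exact: connect_root.
move=> /iter_findex <-.
elim: (findex _ _ _) => [|n [] /= ->]; [by left|by right|by left; rewrite fK].
Qed.

Lemma to_orb_f x : to_orb (f x) = to_orb x.
Proof.
apply/val_inj; rewrite !SubK; apply/esym/eqP.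
by rewrite (root_connect (fconnect_sym (inv_inj fK))) fconnect1.
Qed.

Lemma to_orbK (a : orb) : to_orb (val a) = a.
Proof. by apply/val_inj; rewrite SubK; apply/eqP/(valP a). Qed.

End Orbits.

Arguments to_orb : simpl never.

Section Quotient.
Variable G : igraph.

Local Notation orbV := (orb (@iV G)).
Local Notation orbD := (orb (@iD G)).
Local Notation toV := (to_orb (@iVK G)).
Local Notation toD := (to_orb (@iDK G)).

(* One element for each anti-invariant edge, standing for its midpoint. *)
Definition midpoint : finType := {a : orbD | anti_invariant (val a)}.

(* In the topological quotient an anti-invariant edge is folded at its midpoint:
   it gives a new vertex [inr m], and an edge with halves [inl (val m)] and
   [inr m], the latter starting at the new vertex. *)
Definition quot_src (h : orbD + midpoint) : orbV + midpoint :=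
  match h with
  | inl a => inl (toV (src (val a)))
  | inr m => inr m
  end.

Definition quot_opp (h : orbD + midpoint) : orbD + midpoint :=
  match h with
  | inl a => if insub a is Some m then inr m else inl (toD (opp (val a)))
  | inr m => inl (val m)
  end.

Lemma anti_invariant_opp (h : dart G) :
  anti_invariant (opp h) = anti_invariant h.
Proof.
rewrite /anti_invariant -opp_iD oppK !(inv_eq (@oppK G)) oppK.
by congr (_ && ~~ _).
Qed.

Lemma anti_invariant_iD (h : dart G) :
  anti_invariant (iD h) = anti_invariant h.
Proof.
by rewrite /anti_invariant opp_iD !(inj_eq (inv_inj (@iDK G))).
Qed.

Lemma anti_invariant_toD (h : dart G) :
  anti_invariant (val (toD h)) = anti_invariant h.
Proof. by case: (val_to_orb (@iDK G) h) => ->; rewrite ?anti_invariant_iD. Qed.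

Lemma quot_oppK : involutive quot_opp.
Proof.
case=> [a|m] /=; last by rewrite valK.
case: insubP => [m _ <- //|/= na].
rewrite insubN ?anti_invariant_toD ?anti_invariant_opp //=; congr inl.
case: (val_to_orb (@iDK G) (opp (val a))) => /= ->; rewrite ?opp_iD oppK.
  by rewrite to_orbK.
by rewrite to_orb_f to_orbK.
Qed.

Definition quot_graph : graph :=
  @Graph (orbV + midpoint)%type (orbD + midpoint)%type quot_src quot_opp quot_oppK.

End Quotient.

Definition hyp_condition1 (G : igraph) : Prop :=
  forall v : vert G, igenus v <> 0 -> iV v = v.

Definition hyp_condition2 (G : igraph) : Prop :=
  forall v : vert G, igenus v = 0 -> 3 <= degree v.

(* Darts at [v] count edges at [v]: an invariant loop is excluded by the
   quotient being a tree. *)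
Definition hyp_condition3 (G : igraph) : Prop :=
  forall v : vert G,
    #|[set h : dart G | (src h == v) && invariant h]| <= 2 * igenus v + 2.

Definition exceptional_point (G : igraph) : Prop :=
  [/\ #|vert G| = 1, #|dart G| = 0 & forall v : vert G, igenus v = 0].

Definition exceptional_circle (G : igraph) : Prop :=
  [/\ #|vert G| = 2,
      forall v : vert G, degree v = 2,
      forall v : vert G, igenus v = 0 /\ iV v = v &
      forall h : dart G, iD h != h /\ iD h != opp h].

Definition hyperelliptic (G : igraph) : Prop :=
  [/\ closed_graph G /\ connected G,
      hyp_condition1 G,
      hyp_condition2 G \/ exceptional_point G \/ exceptional_circle G,
      hyp_condition3 G &
      is_tree (quot_graph G)].

Definition hyp_genus (G : igraph) : nat := betti G + \sum_(v : vert G) igenus v.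

Definition hyp_iso (G G' : igraph) : Prop :=
  exists (fV : vert G -> vert G') (fD : dart G -> dart G'),
    [/\ bijective fV /\ bijective fD,
        forall h, src (fD h) = fV (src h) /\ opp (fD h) = fD (opp h),
        forall v, igenus (fV v) = igenus v,
        forall v, iV (fV v) = fV (iV v) &
        forall h, iD (fD h) = fD (iD h)].

(* [vblue] and [eblue] hold for blue, and fail for yellow, vertices and darts.
   [eblue_src] says that the blue part is closed, i.e. that yellow vertices have
   only yellow edges. *)
Record by_graph := BYGraph {
  byg :> graph;
  genus : vert byg -> nat;
  vblue : pred (vert byg);
  eblue : pred (dart byg);
  eblue_opp : forall h, eblue (opp h) = eblue h;
  eblue_src : forall h, eblue h -> vblue (src h)
}.

Definition by_condition1 (T : by_graph) : Prop :=
  forall v : vert T, ~~ vblue v ->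
    [/\ genus v = 0, 3 <= degree v
      & forall h : dart T, src h = v -> ~~ eblue h].

Definition by_condition2 (T : by_graph) : Prop :=
  forall v : vert T, vblue v -> genus v = 0 ->
    exists h : dart T, src h = v /\ ~~ eblue h.

Definition by_condition3 (T : by_graph) : Prop :=
  forall v : vert T,
    #|[set h : dart T | (src h == v) && eblue h]| <= 2 * genus v + 2.

Definition by_point (T : by_graph) : Prop :=
  [/\ #|vert T| = 1, #|dart T| = 0 & forall v : vert T, vblue v /\ genus v = 0].

Definition open_by_point (T : by_graph) : Prop :=
  [/\ #|vert T| = 1, #|dart T| = 1,
      forall v : vert T, vblue v /\ genus v = 0
    & forall h : dart T, opp h = h /\ eblue h].

Definition by_tree (T : by_graph) : Prop :=
  [/\ closed_graph T /\ is_tree T,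
      by_condition1 T,
      by_condition2 T \/ by_point T &
      by_condition3 T].

Definition open_by_tree (T : by_graph) : Prop :=
  [/\ (exists! h : dart T, opp h = h) /\ is_tree T,
      by_condition1 T,
      by_condition2 T \/ open_by_point T &
      by_condition3 T].

Definition by_genus (T : by_graph) : nat :=
  rel_betti (@vblue T) (@eblue T) + \sum_(v : vert T) genus v.

Definition by_iso (T T' : by_graph) : Prop :=
  exists (fV : vert T -> vert T') (fD : dart T -> dart T'),
    [/\ bijective fV /\ bijective fD,
        forall h, src (fD h) = fV (src h) /\ opp (fD h) = fD (opp h),
        forall v, genus (fV v) = genus v,
        forall v, vblue (fV v) = vblue v &
        forall h, eblue (fD h) = eblue h].

Section Subtrees.
Variable T : by_graph.

(* A union of vertices and edges of [T]. *)
Definition part : Type := ({set vert T} * {set dart T})%type.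

Definition part_le (A B : part) : bool := (A.1 \subset B.1) && (A.2 \subset B.2).

(* A compact subspace contains the endpoints of its edges, and no open edge. *)
Definition closed_part (A : part) : Prop :=
  forall h, h \in A.2 -> [/\ src h \in A.1, opp h \in A.2 & opp h != h].

(* The vertices of [T] which become interior points of edges of the part. *)
Definition smoothed (A : part) (v : vert T) : bool :=
  [&& v \in A.1, genus v == 0, #|[set h in A.2 | src h == v]| == 2
    & [forall h in A.2, (src h == v) ==> (eblue h == vblue v)]].

Definition next_smoothed (A : part) : rel (dart T) :=
  fun h k => [&& k \in A.2, smoothed A (src k) & next_dart h k].

(* [T'] is the part [A] with the vertices of [smoothed A] forgotten: its vertices
   and darts are those of [A] at vertices which are not forgotten, and each edge
   of [T'] is a chain of edges of [A] passing through forgotten vertices. *)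
Definition realises (A : part) (T' : by_graph) : Prop :=
  exists (fV : vert T' -> vert T) (fD : dart T' -> dart T),
    [/\ injective fV /\
          forall v, (v \in codom fV) = (v \in A.1) && ~~ smoothed A v,
        injective fD /\
          forall h, (h \in codom fD) = (h \in A.2) && ~~ smoothed A (src h),
        forall h, src (fD h) = fV (src h) /\ eblue (fD h) = eblue h,
        forall v, genus (fV v) = genus v /\ vblue (fV v) = vblue v &
        forall h, exists p : seq (dart T),
          path (next_smoothed A) (fD h) p /\
          opp (last (fD h) p) = fD (opp h)].

Definition by_subtree (A : part) (T' : by_graph) : Prop :=
  [/\ closed_part A, realises A T', by_tree T'
    & by_point T' -> by_genus T = 0].

Definition maximal_by_subtree (A : part) : Prop :=
  (exists T', by_subtree A T') /\
  forall B T', by_subtree B T' -> part_le A B -> B = A.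

(* [T'] is (a model of) the unique maximal closed BY subtree of [T]. *)
Definition is_core (T' : by_graph) : Prop :=
  exists A : part,
    [/\ by_subtree A T', maximal_by_subtree A
      & forall B, maximal_by_subtree B -> B = A].

End Subtrees.

Section QuotientTree.
Variable G : igraph.

Definition quot_genus (v : vert (quot_graph G)) : nat :=
  match v with
  | inl a => if iV (val a) == val a then igenus (val a) else 0
  | inr _ => 0
  end.

Definition quot_vblue (v : vert (quot_graph G)) : bool :=
  match v with
  | inl a => iV (val a) == val a
  | inr _ => true
  end.

Definition quot_eblue (h : dart (quot_graph G)) : bool :=
  match h with
  | inl a => invariant (val a)
  | inr _ => false
  end.

Lemma quot_eblue_opp h : quot_eblue (opp h) = quot_eblue h.
Proof.
case: h => [a|m] /=; rewrite /invariant; last by case/andP: (valP m) => _ /negbTE.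
case: insubP => [m /andP[_ /negbTE ->] _ //|_ /=].
case: (val_to_orb (@iDK G) (opp (val a))) => /= ->; rewrite /invariant.
  by rewrite -opp_iD (inj_eq (inv_inj (@oppK G))).
by rewrite (inj_eq (inv_inj (@iDK G))) -opp_iD (inj_eq (inv_inj (@oppK G))).
Qed.

Lemma quot_eblue_src h : quot_eblue h -> quot_vblue (src h).
Proof.
case: h => [a|m] //= /eqP ia.
have e : iV (src (val a)) = src (val a) by rewrite -src_iD ia.
by case: (val_to_orb (@iVK G) (src (val a))) => /= ->; rewrite !e.
Qed.

Definition tree_of_graph : by_graph :=
  BYGraph quot_genus quot_eblue_opp quot_eblue_src.

End QuotientTree.

Section Double.
Variable T : by_graph.

Definition genus0_leaf (v : vert T) : bool := (genus v == 0) && (degree v == 1).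

Definition exceptional_segment : bool :=
  [&& #|vert T| == 2, [forall v, genus0_leaf v] & [forall h, ~~ @eblue T h]].

Definition kept (v : vert T) : bool := ~~ genus0_leaf v || exceptional_segment.

(* The copy T^+ (resp. T^-) is labelled by [true] (resp. [false]); a cell of the
   blue part only has the label [true]. *)
Definition dbl_vert : finType :=
  {p : vert T * bool | kept p.1 && (vblue p.1 ==> p.2)}.

Definition dbl_dart : finType :=
  {p : dart T * bool | kept (src p.1) && (eblue p.1 ==> p.2)}.

Lemma dbl_src_subproof (h : dbl_dart) :
  kept (src (val h).1) &&
    (vblue (src (val h).1) ==> (vblue (src (val h).1) || (val h).2)).
Proof. by case/andP: (valP h) => -> _; case: vblue. Qed.

Definition dbl_src (h : dbl_dart) : dbl_vert :=
  Sub (src (val h).1, vblue (src (val h).1) || (val h).2) (dbl_src_subproof h).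

(* If [opp h] starts at a suppressed leaf, then the two preimages of [h] are the
   two halves of an anti-invariant edge. *)
Definition dbl_opp_raw (h : dart T * bool) : dart T * bool :=
  if kept (src (opp h.1)) then (opp h.1, h.2) else (h.1, eblue h.1 || ~~ h.2).

Lemma dbl_opp_subproof (h : dbl_dart) :
  kept (src (dbl_opp_raw (val h)).1) &&
    (eblue (dbl_opp_raw (val h)).1 ==> (dbl_opp_raw (val h)).2).
Proof.
case/andP: (valP h) => k b; rewrite /dbl_opp_raw.
case: ifP => k' /=; first by rewrite k' eblue_opp.
by rewrite k; case: eblue.
Qed.

Definition dbl_opp (h : dbl_dart) : dbl_dart :=
  Sub (dbl_opp_raw (val h)) (dbl_opp_subproof h).

Lemma dbl_oppK : involutive dbl_opp.
Proof.
move=> h; apply: val_inj; rewrite !SubK.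
case: h => -[h s] /= /andP[/= k b]; rewrite /dbl_opp_raw /=.
case k': (kept (src (opp h))) => /=; first by rewrite oppK k.
by rewrite k'; congr pair; case: eblue b => //=; rewrite negbK.
Qed.

Definition dbl_graph : graph := @Graph dbl_vert dbl_dart dbl_src dbl_opp dbl_oppK.

Definition dbl_genus (v : dbl_vert) : nat :=
  if vblue (val v).1 then genus (val v).1 else 0.

Lemma dbl_iV_subproof (v : dbl_vert) :
  kept (val v).1 && (vblue (val v).1 ==> (vblue (val v).1 || ~~ (val v).2)).
Proof. by case/andP: (valP v) => -> _; case: vblue. Qed.

Definition dbl_iV (v : dbl_vert) : dbl_vert :=
  Sub ((val v).1, vblue (val v).1 || ~~ (val v).2) (dbl_iV_subproof v).

Lemma dbl_iD_subproof (h : dbl_dart) :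
  kept (src (val h).1) &&
    (eblue (val h).1 ==> (eblue (val h).1 || ~~ (val h).2)).
Proof. by case/andP: (valP h) => -> _; case: eblue. Qed.

Definition dbl_iD (h : dbl_dart) : dbl_dart :=
  Sub ((val h).1, eblue (val h).1 || ~~ (val h).2) (dbl_iD_subproof h).

Lemma dbl_iVK : involutive dbl_iV.
Proof.
move=> v; apply: val_inj; rewrite !SubK.
case: v => -[v s] /= /andP[/= _ b].
by congr pair; case: vblue b => //=; rewrite negbK.
Qed.

Lemma dbl_iDK : involutive dbl_iD.
Proof.
move=> h; apply: val_inj; rewrite !SubK.
case: h => -[h s] /= /andP[/= _ b].
by congr pair; case: eblue b => //=; rewrite negbK.
Qed.

Lemma dbl_src_iD h : dbl_src (dbl_iD h) = dbl_iV (dbl_src h).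
Proof.
apply: val_inj; rewrite !SubK.
case: h => -[h s] /= _; congr pair.
have := @eblue_src T h; case: eblue; first by move=> ->.
by case: vblue.
Qed.

Lemma dbl_opp_iD h : dbl_opp (dbl_iD h) = dbl_iD (dbl_opp h).
Proof.
apply: val_inj; rewrite !SubK.
case: h => -[h s] /= _; rewrite /dbl_opp_raw /=.
by case: ifP => _ //=; rewrite eblue_opp.
Qed.

Definition graph_of_tree : igraph :=
  @IGraph dbl_graph dbl_genus dbl_iV dbl_iD dbl_iVK dbl_iDK dbl_src_iD dbl_opp_iD.

End Double.

Definition is_picture (X : finType) (S : {set {set X}}) : bool :=
  [&& set0 \notin S, setT \in S, [forall x, [set x] \in S]
    & [forall s in S, forall t in S,
         [|| [disjoint s & t], s \subset t | t \subset s]]].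

Record picture := Picture {
  pts : finType;
  clusters : {set {set pts}};
  picP : is_picture clusters
}.

(* The [g] with #|X| \in {2g+1, 2g+2}. *)
Definition card_genus (X : finType) : nat := #|X|.-1./2.

Definition pic_genus (P : picture) : nat := card_genus (pts P).

Definition pic_iso (P Q : picture) : Prop :=
  exists f : pts P -> pts Q,
    bijective f /\ clusters Q = [set f @: (s : {set pts P}) | s in clusters P].

Section Clusters.
Variables (X : finType) (S : {set {set X}}).

Definition child (s' s : {set X}) : bool :=
  [&& s' \in S, s \in S, s' \proper s
    & [forall t in S, ~~ ((s' \proper t) && (t \proper s))]].

Definition children (s : {set X}) : {set {set X}} := [set t | child t s].

Definition odd_children (s : {set X}) : {set {set X}} :=
  [set t in children s | odd #|t|].

Definition proper_cluster (s : {set X}) : bool :=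
  (s \in S) && ((1 < #|s|) || (#|s| == 1) && (#|X| == 1)).

Definition ubereven (s : {set X}) : bool :=
  (#|X| != 1) && (odd_children s == set0).

(* [n.-1./2] is the [g] with n \in {2g+1, 2g+2}; the case n = 0 only occurs for
   ubereven clusters and for #|X| = 1. *)
Definition cluster_genus (s : {set X}) : nat :=
  if ubereven s then 0 else #|odd_children s|.-1./2.

End Clusters.

(* pts P' is the disjoint union of pts P, included by [f], and {r}. *)
Definition add_point (P P' : picture) : Prop :=
  exists (f : pts P -> pts P') (r : pts P'),
    [/\ injective f, forall y, (y \in codom f) = (y != r)
      & clusters P' = [set f @: (s : {set pts P}) | s in clusters P]
                        :|: [set setT; [set r]]].

Inductive move : picture -> picture -> Prop :=
| Move_i (X : finType) (S S' : {set {set X}})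
    (PS : is_picture S) (PS' : is_picture S') (s : {set X}) :
    #|X| = 2 * card_genus X + 2 -> child S s setT ->
    S' = (~: s) |: S ->
    move (Picture PS) (Picture PS')
| Move_ii (X : finType) (S S' : {set {set X}})
    (PS : is_picture S) (PS' : is_picture S') (s : {set X}) :
    #|X| = 2 * card_genus X + 2 -> #|children S setT| = 2 ->
    child S s setT -> 2 <= #|s| ->
    S' = S :\ s ->
    move (Picture PS) (Picture PS')
| Move_iii (P P' : picture) :
    #|pts P| = 2 * pic_genus P + 1 -> add_point P P' -> move P P'
| Move_iv (P P' : picture) :
    #|pts P| = 2 * pic_genus P + 2 -> add_point P' P -> move P P'.

Definition obtained_by_moves (P Q : picture) : Prop :=
  exists R, clos_refl_trans picture move P R /\ pic_iso R Q.

Definition pic_equiv (P Q : picture) : Prop :=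
  obtained_by_moves P Q \/ obtained_by_moves Q P.

Section ClusterFacts.
Variables (X : finType) (S : {set {set X}}) (PS : is_picture S).

Lemma pic_set0 : set0 \notin S.
Proof. by case/and4P: PS. Qed.

Lemma pic_setT : setT \in S.
Proof. by case/and4P: PS. Qed.

Lemma pic_set1 x : [set x] \in S.
Proof. by case/and4P: PS => _ _ /forallP. Qed.

Lemma pic_nested s t :
  s \in S -> t \in S -> [|| [disjoint s & t], s \subset t | t \subset s].
Proof. by case/and4P: PS => _ _ _ /forall_inP h /h/forall_inP; apply. Qed.

Lemma pic_card_gt0 : 0 < #|X|.
Proof.
rewrite lt0n -cardsT cards_eq0; apply/eqP => e.
by have := pic_set0; rewrite -e pic_setT.
Qed.

Lemma proper_setT : proper_cluster S setT.
Proof.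
rewrite /proper_cluster pic_setT cardsT /= andbb orbC eq_sym -leq_eqVlt.
exact: pic_card_gt0.
Qed.

Lemma children_partition s : s \in S -> 1 < #|s| -> partition (children S s) s.
Proof.
move=> sS s1; apply/and3P; split.
- rewrite eqEsubset; apply/andP; split.
    by apply/bigcupsP => t; rewrite inE => /and4P[_ _ /proper_sub].
  apply/subsetP => x xs.
  pose Q (t : {set X}) := [&& t \in S, x \in t & t \proper s].
  have Q1 : Q [set x].
    by rewrite /Q pic_set1 set11 properEcard sub1set xs cards1.
  case: (arg_maxnP (fun t : {set X} => #|t|) Q1) => t /and3P[tS xt ts] tmax.
  apply/bigcupP; exists t => //; rewrite inE /child tS sS ts /=.
  apply/forall_inP => u uS; apply/negP => /andP[tu us].
  have /tmax := (introT and3P (And3 uS (subsetP (proper_sub tu) _ xt) us) : Q u).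
  by apply/negP; rewrite -ltnNge proper_card.
- apply/trivIsetP => t u; rewrite !inE => /and4P[tS _ ts /forall_inP tm].
  case/and4P=> uS _ us /forall_inP um tu.
  case/or3P: (pic_nested tS uS) => // le.
    by have := tm _ uS; rewrite us properEneq tu le.
  by have := um _ tS; rewrite ts properEneq eq_sym tu le.
- by rewrite inE /child (negbTE pic_set0).
Qed.

Lemma odd_not_ubereven s :
  proper_cluster S s -> odd #|s| -> ~~ ubereven S s.
Proof.
move=> /andP[sS s1] os; apply/negP => /andP[X1 /eqP oc].
rewrite (negbTE X1) andbF orbF in s1.
move: os; rewrite (card_partition (children_partition sS s1)).
apply/negP; rewrite (big_morph odd oddD (erefl (odd 0))).
rewrite big1 // => t ts; apply/negbTE/negP => ot.
by have := in_set0 t; rewrite -oc inE ts ot.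
Qed.

Lemma parent_exists s : s \in S -> s != setT -> exists t, child S s t.
Proof.
move=> sS sT.
pose Q (t : {set X}) := (t \in S) && (s \proper t).
have QT : Q setT by rewrite /Q pic_setT properT.
case: (arg_minnP (fun t : {set X} => #|t|) QT) => t /andP[tS st] tmin.
exists t; rewrite /child sS tS st; apply/forall_inP => u uS.
apply/negP => /andP[su ut].
have /tmin : Q u by rewrite /Q uS.
by apply/negP; rewrite -ltnNge proper_card.
Qed.

End ClusterFacts.

Section ClusterTree.
Variable P : picture.

Local Notation X := (pts P).
Local Notation S := (clusters P).

Definition ct_vert : finType := {s : {set X} | proper_cluster S s}.

Definition ct_root : ct_vert := Sub setT (proper_setT (picP P)).

Definition ct_nonroot : finType := {s : ct_vert | s != ct_root}.

Lemma parent_subproof (s : ct_nonroot) :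
  exists t, child S (val (val s)) t.
Proof.
apply: (parent_exists (picP P)); first by case/andP: (valP (val s)).
by apply: contraNneq (valP s) => e; apply/eqP/val_inj.
Qed.

Definition parent_set (s : ct_nonroot) : {set X} := xchoose (parent_subproof s).

Lemma child_parent s : child S (val (val s)) (parent_set s).
Proof. exact: xchooseP. Qed.

Lemma proper_parent s : proper_cluster S (parent_set s).
Proof.
case/and4P: (child_parent s) => _ tS st _; rewrite /proper_cluster tS /=.
case/andP: (valP (val s)) => _ c.
rewrite (leq_ltn_trans _ (proper_card st)) //.
by case/orP: c => [/ltnW//|/andP[/eqP-> _]].
Qed.

Definition ct_parent (s : ct_nonroot) : ct_vert :=
  Sub (parent_set s) (proper_parent s).

(* [inl s] is the dart at v_s pointing to the parent of s, or the open edge if s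
   is the whole set; [inr s] is the dart from the parent of s to v_s. *)
Definition ct_src (h : ct_vert + ct_nonroot) : ct_vert :=
  match h with inl s => s | inr s => ct_parent s end.

Definition ct_opp (h : ct_vert + ct_nonroot) : ct_vert + ct_nonroot :=
  match h with
  | inl s => if insub s is Some s' then inr s' else inl s
  | inr s => inl (val s)
  end.

Lemma ct_oppK : involutive ct_opp.
Proof.
case=> [s|s] /=; last by rewrite valK.
by case: insubP => [s' _ <- //|/= ns]; rewrite insubN.
Qed.

Definition ct_graph : graph :=
  @Graph ct_vert (ct_vert + ct_nonroot)%type ct_src ct_opp ct_oppK.

Definition ct_genus (s : ct_vert) : nat := cluster_genus S (val s).

Definition ct_vblue (s : ct_vert) : bool := ~~ ubereven S (val s).

Definition ct_eblue (h : dart ct_graph) : bool :=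
  match h with inl s => odd #|val s| | inr s => odd #|val (val s)| end.

Lemma ct_eblue_opp h : ct_eblue (opp h) = ct_eblue h.
Proof. by case: h => [s|s] //=; case: insubP => [s' _ <-|]. Qed.

Lemma ct_eblue_src h : ct_eblue h -> ct_vblue (src h).
Proof.
case: h => [s|s] /= os; first exact: odd_not_ubereven (picP P) _ (valP s) os.
rewrite /ct_vblue /= /ubereven negb_and; apply/orP; right.
apply/set0Pn; exists (val (val s)).
by rewrite !inE child_parent os.
Qed.

Definition tree_of_picture : by_graph :=
  @BYGraph ct_graph ct_genus ct_vblue ct_eblue ct_eblue_opp ct_eblue_src.

End ClusterTree.

(* Main.v *)
(** The double cover [G -> G/<iota>] is trivial over the yellow part, because a
    Z/2-valued cocycle on a tree is a coboundary; a choice of sheets identifies [G]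
    with the double of its quotient. Genera are compared by counting cells, the
    Betti numbers involved being Euler characteristics.

    Call a cluster picture reduced if |X| is odd, or |X| <= 2, or X has at least
    three children. The core of its open tree is then the tree without the open
    edge. Otherwise X has exactly two children, and removing one of them by move
    (ii) gives a reduced picture whose closed tree is the core: the root was either
    smoothed or cut off. This yields the invariance of the core under moves.
    Conversely, a reduced picture of even size is determined by its core and by the
    vertex v_X, since genera and colours tell how many points lie directly below
    each vertex, and a move (i) followed by a move (ii) carries the root to a
    neighbouring vertex. Finally, a BY tree with a chosen root is the core of the
    picture whose points are obtained by attaching 2g(v) + 2 - #{blue edges at v}
    points to each blue vertex v. *)
From mathcomp Require Import all_boot ssralg zmodp rat matrix mxalgebra zify.
From Stdlib Require Import Relation_Operators.
Require Import Defs.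

Set Implicit Arguments.
Unset Strict Implicit.
Unset Printing Implicit Defensive.

(** * Trees and rootings *)

(** [is_tree] only forbids circuits, which supports no induction. A depth function ([rooting]) is
    therefore extracted from connectedness and the absence of reduced returning walks, and later
    inductions on trees run along it. The link with cluster pictures is the identity
    [half_size_split]. Summed over all clusters it telescopes to the genus; at a single vertex it
    recovers genus and colour from the sizes of the proper clusters; read backwards it tells how
    many points to attach to a vertex. A core is a part of the open tree together with a model. The
    part determines the model, because a walk through smoothed vertices has only one continuation.
    This is also why re-rooting keeps the tree: after the complement of a child s of X is added,
    deleting either sibling gives two pictures whose closed trees realise the same part of one open
    tree, and the vertex of s in the first is the root of the second. In [pic_equiv] the moves are
    directed and the isomorphism comes after all of them, so moves have to be inverted and
    transported along isomorphisms. *)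

Section ReducedWalks.
Variable T : graph.
Hypotheses (T_closed : closed_graph T) (T_acyclic : forall c : seq (dart T), ~~ circuit c).

(* A shortest returning walk visits distinct vertices, so it is a circuit, unless
   its last edge is the reverse of its first one: then both can be stripped. *)
Lemma reduced_walk_open (h : dart T) p :
  path (@next_dart T) h p -> src (opp (last h p)) != src h.
Proof.
have [n] := ubnP (size p); elim: n => // n IHn in h p *.
rewrite ltnS => sp ph; apply/eqP => e.
have U : uniq (map (@src T) (h :: p)).
  have {e} : size p <= n /\ path (@next_dart T) h p by [].
  elim: {h}p {sp ph} h => [|a q IHq] k //= [sq /andP[ka aq]].
  have {}IHq : uniq (map (@src T) (a :: q)) by apply: IHq; rewrite aq ltnW.
  apply/andP; split; last by [].
  apply/negP; rewrite -/(map _ (a :: q)) => /mapP[b bq eb].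
  have pk : path (@next_dart T) k (a :: q) by rewrite /= ka.
  have {}sq : size (a :: q) <= n by [].
  move: (a :: q) bq pk sq => _ /splitPr[q1 q2]; rewrite cat_path /=.
  case/andP=> kq1 /andP[/and3P[_ /eqP sb _] _].
  rewrite size_cat /= addnS => sq1.
  have := IHn k q1 (leq_ltn_trans (leq_addr _ _) sq1) kq1.
  by rewrite -sb eb eqxx.
case: (altP (h =P opp (last h p))) => eh; last first.
  have := T_acyclic (h :: p); rewrite /circuit U andbT /= rcons_path ph /=.
  by rewrite /next_dart (negPf (T_closed _)) eh e eqxx.
case/lastP: p => [|p l] in ph sp e eh U *.
  by have := T_closed h; rewrite -eh eqxx.
case: p => [|a p] in ph sp e eh U *.
  by move: ph eh; rewrite /= /next_dart => /andP[/and3P[_ _ /negP na] _] eh; case: na; rewrite eh oppK.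
move: ph sp eh e; rewrite last_rcons rcons_cons /= rcons_path size_rcons.
case/andP=> /and3P[_ /eqP sa _] /andP[ap /and3P[_ /eqP sl _]] sp eh _.
have := IHn a p (ltnW sp) ap.
by rewrite -sl sa eh oppK eqxx.
Qed.

Lemma next_dart_opp (h k : dart T) : next_dart h k -> next_dart (opp k) (opp h).
Proof.
case/and3P=> _ /eqP e ne; rewrite /next_dart oppK eq_sym T_closed e eqxx /=.
by rewrite eq_sym.
Qed.

Lemma walk_reverse (h : dart T) p : path (@next_dart T) h p ->
  exists q, [/\ path (@next_dart T) (opp (last h p)) q
              & last (opp (last h p)) q = opp h].
Proof.
elim: p h => [|a p IHp] h /=; first by exists [::].
case/andP=> ha /IHp[q [pq lq]]; exists (rcons q (opp h)).
by rewrite rcons_path pq lq next_dart_opp // last_rcons.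
Qed.

End ReducedWalks.

Section Rooting.

(* A dart climbs if [d] drops along it; [d] need not be the distance to [r]. *)
Definition rooting (T : graph) (r : vert T) (d : vert T -> nat) : Prop :=
  [/\ d r = 0,
      forall v, v != r -> exists h : dart T, src h = v /\ d (src (opp h)) < d v,
      forall h : dart T, d (src h) != d (src (opp h))
    & forall h k : dart T, src h = src k -> d (src (opp h)) < d (src h) ->
        d (src (opp k)) < d (src k) -> h = k].

Lemma depth_exists (T : graph) (r : vert T) : connected T ->
  exists d : vert T -> nat, d r = 0 /\
   forall v, v != r -> exists h : dart T, src h = v /\ d (src (opp h)) < d v.
Proof.
case=> _ Tc.
(* [R n v] means that some walk of exactly [n] edges leads from [r] to [v]. The depth is the least
   such [n]; the last edge of a shortest walk lowers it. *)
pose R := fix R n : pred (vert T) := if n is m.+1 then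
  fun v => [exists u, R m u && adj u v] else pred1 r.
have ex v : exists n, R n v.
  case/connectP: (Tc r v) => p.
  elim/last_ind: p v => [|p u IHp] v /=; first by move=> _ ->; exists 0 => /=.
  rewrite rcons_path last_rcons => /andP[pp au] ->.
  have [n Rn] := IHp _ pp erefl; exists n.+1 => /=.
  by apply/existsP; exists (last r p); rewrite Rn.
exists (fun v => ex_minn (ex v)); split.
  by case: ex_minnP => n _ /(_ 0) /= /(_ (eqxx _)); case: n.
move=> v vr; case: ex_minnP => [[|n]] /=; first by rewrite (negPf vr).
case/existsP=> u /andP[Ru /existsP[h /andP[/eqP hu /eqP hv]]] _.
exists (opp h); rewrite oppK hv; split=> //; rewrite hu.
by case: ex_minnP => m _ /(_ n Ru).
Qed.

(** One climbing dart [pd v] is picked at each vertex other than [r]. If neither half of an edge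
    were picked, the climbs from its two ends, joined through the edge, would form a reduced walk
    from [r] back to [r]. So the picked darts meet every edge, which yields the last two properties
    of a rooting. *)
Lemma rooting_exists (T : graph) (r : vert T) : closed_graph T -> is_tree T ->
  exists d, rooting r d.
Proof.
move=> Tcl [Tco Tac]; have [d [d0 dS]] := depth_exists r Tco.
pose pd (v : vert T) := [pick h : dart T | (src h == v) && (d (src (opp h)) < d v)].
pose U (h : dart T) := pd (src h) == Some h.
have Uup h : U h -> d (src (opp h)) < d (src h).
  rewrite /U /pd; case: pickP => [k /andP[_ lk]|_] //.
 by case/eqP => e; rewrite e in lk *.
have pdP v : v != r -> exists2 h, U h & src h = v.
  move=> /dS[h [sh lh]]; case E: (pd v) => [k|]; last first.
    by move: E; rewrite /pd; case: pickP => // /(_ h); rewrite sh lh eqxx.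
  have sk : src k = v by move: E; rewrite /pd; case: pickP => // x /andP[/eqP sx _] [<-].
  by exists k => //; rewrite /U sk E.
(* Following picked darts never turns back: not along [h], because [opp h] is not picked, and not
   later, because [d] drops along every picked dart. *)
have climb h : ~~ U (opp h) ->
    exists p, path (@next_dart T) h p /\ src (opp (last h p)) = r.
  have [n] := ubnP (d (src (opp h))); elim: n => // n IHn in h *.
  rewrite ltnS => ln nU; case: (eqVneq (src (opp h)) r) => [e|/pdP[k Uk sk]].
    by exists [::].
  have lk := Uup _ Uk.
  have [||p [pp lp]] := IHn k; first by rewrite (leq_trans lk) // sk.
    by apply/negP => /Uup; rewrite oppK ltnNge ltnW.
  exists (k :: p) => /=; split=> //; rewrite pp /next_dart Tcl sk eqxx /= andbT.
  by apply: contraNneq nU => <-.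
have UU h : U h || U (opp h).
  apply/negPn/negP; rewrite negb_or => /andP[nU nU'].
  have [p [pp lp]] := climb h nU'.
  have [|q [pq lq]] := climb (opp h); first by rewrite oppK.
  have [q' [pq' lq']] := walk_reverse Tcl pq; rewrite oppK in lq'.
  have := @reduced_walk_open T Tcl Tac (opp (last (opp h) q)) (q' ++ p).
  by rewrite cat_path pq' last_cat lq' pp lp lq eqxx => /(_ isT).
have upU h : d (src (opp h)) < d (src h) -> U h.
  move=> lh; have := UU h; case: (U h) => //= /Uup; rewrite oppK => lh'.
  by move: (ltn_trans lh lh'); rewrite ltnn.
exists d; split=> // [h|h k e /upU Uh /upU Uk].
  case/orP: (UU h) => /Uup; first by rewrite neq_ltn orbC => ->.
  by rewrite oppK neq_ltn => ->.
by move: Uh Uk; rewrite /U e => /eqP-> /eqP[].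
Qed.

(** At a vertex of maximal depth on a circuit, the outgoing dart and the reverse of the incoming one
    both fail to go deeper, so they coincide and the circuit backtracks. Open darts are exempted
    from the uniqueness condition, so the criterion also serves for trees with an open edge. *)
Lemma rooting_is_tree (T : graph) (r : vert T) (d : vert T -> nat) :
  (forall v, v != r -> exists h : dart T, src h = v /\ d (src (opp h)) < d v) ->
  (forall h k : dart T, opp h != h -> opp k != k -> src h = src k ->
     d (src (opp h)) <= d (src h) -> d (src (opp k)) <= d (src k) -> h = k) ->
  is_tree T.
Proof.
move=> dS du; split.
  split; first by exists; exact: r.
  have adjC : symmetric (@adj T).
    move=> x y; apply/existsP/existsP => -[h /andP[hx hy]];
      by exists (opp h); rewrite oppK hx hy.
  have vr v : connect (@adj T) v r.
    have [n] := ubnP (d v); elim: n => // n IHn in v *; rewrite ltnS => lv.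
    case: (eqVneq v r) => [->//|/dS[h [sh lh]]].
    apply: (connect_trans (connect1 _) (IHn _ (leq_trans lh lv))).
    by apply/existsP; exists h; rewrite sh !eqxx.
  by move=> u v; apply: connect_trans (vr u) _; rewrite (sym_connect_sym adjC).
case=> [//|h0 c]; apply/negP => /and3P[_ cyc _].
have h0c : h0 \in h0 :: c by rewrite inE eqxx.
case: (arg_maxnP (fun h : dart T => d (src h)) h0c) => h hc hmax.
move: cyc hc hmax; set c' := h0 :: c => cyc hc hmax.
have /and3P[nh /eqP sn _] := next_cycle cyc hc.
have /and3P[np /eqP sp /eqP ne] := prev_cycle cyc hc.
apply: ne; apply: du => //.
- by rewrite oppK eq_sym.
- by rewrite -sn; apply: hmax; change (next c' h \in c'); rewrite mem_next.
- by rewrite oppK -sp; apply: hmax; change (prev c' h \in c'); rewrite mem_prev.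
Qed.

Lemma rooting_up_opp (T : graph) (r : vert T) d (h : dart T) : rooting r d ->
  (d (src (opp h)) < d (src h)) = ~~ (d (src h) < d (src (opp h))).
Proof. by case=> _ _ /(_ h) ne _; rewrite -leqNgt ltn_neqAle eq_sym ne. Qed.

(** The potential [t v] is the sum of [c] along the climb from [v] to the root. It is built one
    depth level at a time, and the bound [\max_v d v] makes the last level cover every dart. *)
Lemma tree_coboundary (T : graph) (c : dart T -> bool) :
  closed_graph T -> is_tree T -> (forall h, c (opp h) = c h) ->
  exists t : vert T -> bool, forall h, c h = t (src h) (+) t (src (opp h)).
Proof.
move=> Tcl Tt cC; have [[[r] _] _] := Tt.
have [d rd] := rooting_exists r Tcl Tt; have [d0 dS dne du] := rd.
suff [t tP] : exists t : vert T -> bool, forall h, d (src (opp h)) < d (src h) ->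
    c h = t (src h) (+) t (src (opp h)).
  exists t => h; case: (boolP (d (src (opp h)) < d (src h))) => [/tP //|].
  rewrite (rooting_up_opp _ rd) negbK => lh; rewrite addbC -cC.
  by rewrite tP oppK.
suff [t tP] : exists t : vert T -> bool, forall h, d (src h) <= \max_v d v ->
    d (src (opp h)) < d (src h) -> c h = t (src h) (+) t (src (opp h)).
  by exists t => h; apply: tP; exact: leq_bigmax.
elim: (\max_v d v) => [|n [t tP]].
  by exists xpred0 => h; rewrite leqn0 => /eqP->.
exists (fun v => if d v <= n then t v else
  if [pick h : dart T | (src h == v) && (d (src (opp h)) < d v)] is Some h
  then c h (+) t (src (opp h)) else false) => h lh uh.
have -> : d (src (opp h)) <= n by rewrite -ltnS (leq_trans uh).
case: ifP => [ln|_]; first exact: tP.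
case: pickP => [k /andP[/eqP sk uk]|/(_ h)]; last by rewrite eqxx uh.
have -> : k = h by apply: du => //; rewrite sk.
by rewrite -addbA addbb addbF.
Qed.

(** Each vertex except the root is the source of exactly one climbing dart, and [opp] exchanges
    climbing and descending darts. *)
Lemma tree_dart_count (T : graph) : closed_graph T -> is_tree T ->
  #|dart T| + 2 = 2 * #|vert T|.
Proof.
move=> Tcl Tt; have [[[r] _] _] := Tt.
have [d rd] := rooting_exists r Tcl Tt; have [d0 dS dne du] := rd.
pose U := [set h : dart T | d (src (opp h)) < d (src h)].
have cU : #|U| = #|[set~ r]|.
  rewrite -(card_in_imset (f := @src T) (D := U)); last first.
    by move=> h k; rewrite !inE => uh uk e; apply: du.
  congr #|pred_of_set _|; apply/setP => v; rewrite !inE.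
  apply/imsetP/idP => [[h]|/dS[h [<- uh]]]; last by exists h; rewrite ?inE.
  by rewrite inE => uh ->; apply: contraTneq uh => ->; rewrite d0.
have cU' : #|~: U| = #|U|.
  rewrite -(card_imset _ (inv_inj (@oppK T))); congr #|pred_of_set _|.
  apply/setP => h; rewrite -[h in LHS]oppK (mem_imset _ _ (inv_inj (@oppK T))) !inE.
  by rewrite oppK (rooting_up_opp _ rd).
have := cardsC U; rewrite cU' cU cardsC1.
have : 0 < #|vert T| by apply/card_gt0P; exists r.
lia.
Qed.

(** At a vertex of maximal depth every dart climbs, and at most one dart climbs at a vertex. *)
Lemma tree_degree_le1 (T : graph) : closed_graph T -> is_tree T ->
  exists v : vert T, degree v <= 1.
Proof.
move=> Tcl Tt; have [[[r] _] _] := Tt.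
have [d [d0 dS dne du]] := rooting_exists r Tcl Tt.
have [v _ vmax] := @arg_maxnP _ r xpredT d isT; exists v.
have up x : src x = v -> d (src (opp x)) < d (src x).
  by move=> e; rewrite ltn_neqAle eq_sym dne /= e; exact: vmax.
apply/card_le1_eqP => h k; rewrite !inE => /eqP hv /eqP kv.
by apply: du; rewrite ?up // hv kv.
Qed.

End Rooting.

(** * Isomorphisms of graphs, BY trees and hyperelliptic graphs *)

Section Isos.

Definition graph_iso (T T' : graph) (fV : vert T -> vert T') (fD : dart T -> dart T') :=
  [/\ bijective fV, bijective fD &
      forall h, src (fD h) = fV (src h) /\ opp (fD h) = fD (opp h)].

Lemma graph_iso_tree (T T' : graph) fV fD : @graph_iso T T' fV fD ->
  closed_graph T -> is_tree T -> is_tree T'.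
Proof.
move=> [[gV fVK gVK] [gD fDK gDK] fP] Tcl Tt; have [[[r] _] _] := Tt.
have [d [d0 dS dne du]] := rooting_exists r Tcl Tt.
have srcE h' : gV (src h') = src (gD h') by rewrite -{1}[h']gDK (fP _).1 fVK.
have oppE h' : gD (opp h') = opp (gD h') by rewrite -{1}[h']gDK (fP _).2 fDK.
apply: (@rooting_is_tree _ (fV r) (fun v' => d (gV v'))) => [v' nv'|h k _ _].
  have [|h [sh uh]] := dS (gV v'); first by rewrite -(can_eq fVK) gVK.
  by exists (fD h); rewrite (fP _).1 (fP _).2 (fP _).1 fVK sh gVK.
rewrite !srcE !oppE => e lh lk; apply: (can_inj gDK); apply: du.
- by rewrite -!srcE e.
- by rewrite ltn_neqAle lh eq_sym dne.
- by rewrite ltn_neqAle lk eq_sym dne.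
Qed.

(** The content of [by_iso] with the vertex map kept visible: re-rooting has to follow the image of
    a chosen vertex. *)
Definition iso_map (T T' : by_graph) (fV : vert T -> vert T') : Prop :=
  exists fD : dart T -> dart T',
    [/\ bijective fV /\ bijective fD,
        forall h, src (fD h) = fV (src h) /\ opp (fD h) = fD (opp h),
        forall v, genus (fV v) = genus v,
        forall v, vblue (fV v) = vblue v &
        forall h, eblue (fD h) = eblue h].

Lemma iso_map_id T : @iso_map T T id.
Proof. by exists id; split=> //; split; exists id. Qed.

Lemma iso_map_comp T1 T2 T3 f g : @iso_map T1 T2 f -> @iso_map T2 T3 g -> iso_map (g \o f).
Proof.
case=> fD [[bV bD] fP fg fb fe] [gD [[cV cD] gP gg gb ge]]; exists (gD \o fD).
split=> [|h|v|v|h] /=.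
- by split; apply: bij_comp.
- by rewrite (gP _).1 (fP _).1 (gP _).2 (fP _).2.
- by rewrite gg fg.
- by rewrite gb fb.
- by rewrite ge fe.
Qed.

Lemma iso_map_inv T T' f : @iso_map T T' f ->
  exists g, [/\ iso_map g, cancel f g & cancel g f].
Proof.
case=> fD [[[g fK gK] [gD fDK gDK]] fP fg fb fe]; exists g; split=> //.
exists gD; split.
- by split; [exists f|exists fD].
- move=> h; split; first by rewrite -{2}[h]gDK (fP _).1 fK.
  by rewrite -{2}[h]gDK (fP _).2 fDK.
- by move=> v; rewrite -fg gK.
- by move=> v; rewrite -fb gK.
- by move=> h; rewrite -fe gDK.
Qed.

Lemma by_iso_sym T T' : by_iso T T' -> by_iso T' T.
Proof. by case=> f /iso_map_inv[g [mg _ _]]; exists g. Qed.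

Lemma by_iso_trans T1 T2 T3 : by_iso T1 T2 -> by_iso T2 T3 -> by_iso T1 T3.
Proof. by case=> f mf [g mg]; exists (g \o f); exact: iso_map_comp mf mg. Qed.

Lemma hyp_iso_sym G G' : hyp_iso G G' -> hyp_iso G' G.
Proof.
case=> fV [fD [[[gV fVK gVK] [gD fDK gDK]] fP fg fb fe]].
exists gV, gD; split.
- by split; [exists fV|exists fD].
- move=> h; split; first by rewrite -{2}[h]gDK (fP _).1 fVK.
  by rewrite -{2}[h]gDK (fP _).2 fDK.
- by move=> v; rewrite -fg gVK.
- by move=> v; rewrite -{2}[v]gVK fb fVK.
- by move=> h; rewrite -{2}[h]gDK fe fDK.
Qed.

Lemma hyp_iso_trans G1 G2 G3 : hyp_iso G1 G2 -> hyp_iso G2 G3 -> hyp_iso G1 G3.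
Proof.
case=> fV [fD [[bV bD] fP fg fb fe]] [gV [gD [[cV cD] gP gg gb ge]]].
exists (gV \o fV), (gD \o fD); split=> [|h|v|v|h] /=.
- by split; apply: bij_comp.
- by rewrite (gP _).1 (fP _).1 (gP _).2 (fP _).2.
- by rewrite gg fg.
- by rewrite gb fb.
- by rewrite ge fe.
Qed.

End Isos.
(** * Betti numbers *)

Section Betti.
Import GRing.Theory.
Local Open Scope ring_scope.
Variables (G : graph) (A : pred (vert G)) (B : pred (dart G)).
Hypotheses (G_conn : connected G) (B_opp : forall h, B (opp h) = B h)
  (B_src : forall h, B h -> A (src h)).

Lemma card_rel_edge : (2 * #|rel_edge B| = #|[set h | (opp h != h) && ~~ B h]|)%N.
Proof.
rewrite card_sig.
set P := [pred h | _]; set Q := [set h | _].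
have -> : #|P| = #|[set h in Q | (enum_rank h < enum_rank (opp h))%N]|.
  apply: eq_card => h; rewrite !inE; case: (altP (opp h =P h)) => [->|_] /=.
    by rewrite ltnn.
  by rewrite andbC.
set Q1 := [set h in Q | _].
have e : #|Q1| = #|Q :\: Q1|.
  rewrite -(card_imset _ (inv_inj (@oppK G))); apply: eq_card => h.
  rewrite -[h in LHS]oppK (mem_imset _ _ (inv_inj (@oppK G))) !inE oppK B_opp.
  rewrite [h == _]eq_sym; case: (altP (opp h =P h)) => //= ne; case: (B h) => //=.
  by case: ltngtP => // /val_inj/enum_rank_inj e; rewrite e eqxx in ne.
have := cardsID Q1 Q; rewrite -e (setIidPr _); last by apply/subsetP => h; rewrite inE => /andP[].
by move=> <-; rewrite mul2n addnn.
Qed.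

Lemma card_rel_vert : #|rel_vert A| = #|[set v | ~~ A v]|.
Proof. by rewrite card_sig; apply: eq_card => v; rewrite !inE. Qed.

(* A cochain, given by its values outside [A], extended by zero to [A]. *)
Definition extend (u : 'rV[rat]_#|rel_vert A|) (a : vert G) : rat :=
  \sum_j u 0 j * (a == val (enum_val j))%:R.

Lemma extendE u j : extend u (val (enum_val j)) = u 0 j.
Proof.
rewrite /extend (bigD1 j) //= eqxx mulr1 big1 ?addr0 // => i ij.
by rewrite (inj_eq val_inj) (inj_eq enum_val_inj) eq_sym (negPf ij) mulr0.
Qed.

Lemma extend_A u a : A a -> extend u a = 0.
Proof.
move=> Aa; rewrite /extend big1 // => j _; case: eqP => [e|]; last by rewrite mulr0.
by have := valP (enum_val j); rewrite -e Aa.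
Qed.

Lemma coboundaryE u i : (u *m (rel_boundary A B)^T) 0 i =
  extend u (src (opp (val (enum_val i)))) - extend u (src (val (enum_val i))).
Proof.
rewrite !mxE /extend -sumrB; apply: eq_bigr => j _.
by rewrite !mxE mulrBr.
Qed.

(** Across an edge outside [B] the vanishing coboundary equates the two values; across an edge of
    [B] both ends lie in [A], where the extension is zero. Connectedness does the rest. *)
Lemma cocycle_constant u : u *m (rel_boundary A B)^T = 0 ->
  forall a b, extend u a = extend u b.
Proof.
move=> u0; suff adjc a b : adj a b -> extend u a = extend u b.
  move=> a b; have /connectP[p] := G_conn.2 a b.
  elim: p a => [|c p IHp] a /= => [_ ->//|/andP[/adjc-> /IHp h] /h ->//].
have E (h : dart G) : (enum_rank h < enum_rank (opp h))%N ->
    extend u (src h) = extend u (src (opp h)).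
  move=> lh; case: (boolP (B h)) => [Bh|nB].
    by rewrite !extend_A ?B_src ?B_opp.
  pose i := enum_rank (Sub h (introT andP (conj lh nB)) : rel_edge B).
  have := coboundaryE u i; rewrite u0 mxE enum_rankK /= => /esym/eqP.
  by rewrite subr_eq0 => /eqP.
case/existsP=> h /andP[/eqP<- /eqP<-].
case: (ltngtP (enum_rank h) (enum_rank (opp h))) => [/E //||/val_inj/enum_rank_inj <- //].
by rewrite -{2}(oppK h) => /E; rewrite oppK => ->.
Qed.

(** A constant cochain that vanishes on the non-empty [A] is zero, so the coboundary is injective
    and the boundary map has rank the number of vertices outside [A]. The factors 2 come from
    counting edges by their darts. *)
Lemma rel_betti_formula : (exists v, A v) ->
  (2 * rel_betti A B + 2 * #|[set v | ~~ A v]| = #|[set h | (opp h != h) && ~~ B h]|)%N.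
Proof.
case=> v Av; rewrite -card_rel_edge -card_rel_vert /rel_betti mxrank_ker.
have : row_free (rel_boundary A B)^T.
  apply: inj_row_free => u /cocycle_constant uc; apply/rowP => j.
  by rewrite -extendE (uc _ v) extend_A // mxE.
rewrite /row_free mxrank_tr => /eqP e.
have := rank_leq_row (rel_boundary A B); rewrite e.
by move: #|_| #|_| => m n mn; lia.
Qed.

End Betti.

(** Absolute case: the kernel of the coboundary is now the line of constant cochains, so the rank
    drops by one. *)
Lemma betti_formula (G : graph) : connected G ->
  2 * betti G + 2 * #|vert G| = #|[set h : dart G | opp h != h]| + 2.
Proof.
move=> Gc; have [[v] _] := Gc.
pose A : pred (vert G) := pred0; pose B : pred (dart G) := pred0.
have cE : 2 * #|rel_edge B| = #|[set h : dart G | opp h != h]|.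
  by rewrite card_rel_edge //; apply: eq_card => h; rewrite !inE andbT.
have cV : #|rel_vert A| = #|vert G|.
  by rewrite card_rel_vert; apply: eq_card => h; rewrite !inE.
have rk : \rank (kermx (rel_boundary A B)^T) = 1.
  apply/eqP; rewrite eqn_leq; apply/andP; split.
    have : (kermx (rel_boundary A B)^T <= (const_mx 1%R : 'rV_#|rel_vert A|))%MS.
      apply/rV_subP => u /sub_kermxP /(@cocycle_constant G A B Gc (fun _ => erefl) (fun _ b => b)) uc.
      apply/sub_rVP; exists (extend u v); apply/rowP => j.
      by rewrite !mxE GRing.mulr1 -(uc (val (enum_val j))) extendE.
    by move/mxrankS => h; rewrite (leq_trans h) // rank_leq_row.
  rewrite lt0n mxrank_eq0; apply/negP => /eqP k0.
  pose u : 'rV[rat]_#|rel_vert A| := const_mx 1%R.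
  have eu a : extend u a = 1%R.
    have Aa : ~~ A a by [].
    have -> : a = val (enum_val (enum_rank (Sub a Aa : rel_vert A))) by rewrite enum_rankK.
    by rewrite extendE mxE.
  have : (u <= kermx (rel_boundary A B)^T)%MS.
    by apply/sub_kermxP/rowP => i; rewrite coboundaryE !eu GRing.subrr mxE.
  rewrite k0 submx0 => /eqP/rowP /(_ (enum_rank (Sub v isT : rel_vert A))).
  by rewrite !mxE => /eqP; rewrite GRing.oner_eq0.
rewrite -cE -cV /betti /rel_betti mxrank_ker.
have := rank_leq_col (rel_boundary A B); have := rank_leq_row (rel_boundary A B).
rewrite mxrank_ker mxrank_tr in rk.
move: #|rel_edge B| #|rel_vert A| (\rank _) rk {cE cV} => m n r; lia.
Qed.

Lemma by_genus_formula (T : by_graph) : is_tree T -> (exists v, @vblue T v) ->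
  2 * by_genus T + 2 * #|[set v : vert T | ~~ vblue v]| =
  #|[set h : dart T | (opp h != h) && ~~ eblue h]| + 2 * \sum_(v : vert T) genus v.
Proof.
move=> [Tc _] Tb; rewrite -(rel_betti_formula Tc (@eblue_opp T) (@eblue_src T) Tb).
by rewrite /by_genus; lia.
Qed.

(** A vertex of degree at most 1 cannot be yellow. This supplies the non-empty blue part on which
    the relative Betti formula rests. *)
Lemma by_tree_blue (T : by_graph) : by_tree T -> exists v : vert T, vblue v.
Proof.
case=> -[Tcl Tt] c1 _ _; have [v dv] := tree_degree_le1 Tcl Tt; exists v.
by apply/negPn/negP => /c1[_ d3 _]; move: (leq_trans d3 dv).
Qed.

(** The boundary matrix depends on the enumerations of vertices and darts, so the invariance is read
    off the numbers of cells and not off the matrices. *)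
Lemma by_iso_genus (T T' : by_graph) : by_tree T -> by_tree T' ->
  by_iso T T' -> by_genus T = by_genus T'.
Proof.
move=> Tt Tt' [fV [fD [[bV bD] fP fg fb fe]]].
have := by_genus_formula (proj2 (let: And4 a _ _ _ := Tt in a)) (by_tree_blue Tt).
have := by_genus_formula (proj2 (let: And4 a _ _ _ := Tt' in a)) (by_tree_blue Tt').
have -> : \sum_(v : vert T) genus v = \sum_(v : vert T') genus v.
  rewrite [RHS](reindex fV) /=; last by apply: onW_bij.
  by apply: eq_bigr => v _; rewrite fg.
have -> : #|[set v : vert T | ~~ vblue v]| = #|[set v : vert T' | ~~ vblue v]|.
  rewrite -(card_imset _ (bij_inj bV)); apply: eq_card => v'.
  have [g gK fK] := bV; rewrite -[v']fK mem_imset ?inE ?fb //; exact: bij_inj.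
have -> : #|[set h : dart T | (opp h != h) && ~~ eblue h]| =
    #|[set h : dart T' | (opp h != h) && ~~ eblue h]|.
  rewrite -(card_imset _ (bij_inj bD)); apply: eq_card => h'.
  have [g gK fK] := bD; rewrite -[h']fK mem_imset ?inE ?fe; last exact: bij_inj.
  by rewrite (fP _).2 (bij_eq bD).
lia.
Qed.

Lemma by_point_genus (T : by_graph) : by_point T -> by_genus T = 0.
Proof.
case=> _ D0 Tg; rewrite /by_genus [X in _ + X]big1 => [|v _]; last by case: (Tg v).
rewrite addn0; apply/eqP; rewrite -leqn0 /rel_betti (leq_trans (rank_leq_row _)) //.
by rewrite card_sig (leq_trans (max_card _)) // D0.
Qed.
(** * The quotient of a hyperelliptic graph *)

Lemma inj_surj_bij (A B : finType) (f : A -> B) :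
  injective f -> (forall y, exists x, f x = y) -> bijective f.
Proof.
move=> inj_f surj_f; have ex y : exists x, f x == y.
  by have [x <-] := surj_f y; exists x.
have fK y : f (xchoose (ex y)) = y by apply/eqP/(xchooseP (ex y)).
by exists (fun y => xchoose (ex y)) => [x|//]; apply: inj_f.
Qed.

Section OrbitFacts.
Variables (A : finType) (f : A -> A) (fK : involutive f).

Lemma to_orb_eq x y : (to_orb fK x == to_orb fK y) = (y == x) || (y == f x).
Proof.
apply/eqP/orP => [e|[/eqP->|/eqP->]]; rewrite ?to_orb_f //.
case: (val_to_orb fK y) => ey; case: (val_to_orb fK x) => ex; rewrite -e ex in ey.
- by left; rewrite -ey.
- by right; rewrite -ey.
- by right; rewrite ey fK.
- by left; rewrite -(can_eq fK) ey.
Qed.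

Lemma val_to_orb_invariant (B : Type) (Q : A -> B) x :
  (forall y, Q (f y) = Q y) -> Q (val (to_orb fK x)) = Q x.
Proof. by move=> Qf; case: (val_to_orb fK x) => ->. Qed.

Lemma froots_to_orb x : froots f x = (val (to_orb fK x) == x).
Proof. by rewrite /to_orb SubK. Qed.

(** [f] matches the elements that are not canonical representatives with the representatives of the
    two-element orbits. *)
Lemma card_orb : #|A| = #|orb f| + #|[set a : orb f | f (val a) != val a]|.
Proof.
pose R := [set x | froots f x]; pose R' := [set x in R | f x != x].
have -> : #|orb f| = #|R| by rewrite card_sig; apply: eq_card => x; rewrite !inE.
have -> : #|[set a : orb f | f (val a) != val a]| = #|R'|.
  rewrite -(card_imset _ val_inj); apply: eq_card => x; rewrite !inE.
  apply/imsetP/andP => [[a]|[rx nx]]; first by rewrite inE => ? ->; split=> //; apply: valP.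
  by exists (Sub x rx : orb f); rewrite ?inE SubK.
rewrite -(card_imset R' (inv_inj fK)) -(cardsC R); congr (_ + _).
apply: eq_card => x; rewrite -[x in RHS]fK mem_imset; last exact: inv_inj.
rewrite !inE fK !froots_to_orb to_orb_f.
case: (val_to_orb fK x) => ->; rewrite ?eqxx /=; last by rewrite eq_sym.
by case: eqP.
Qed.

End OrbitFacts.

Section QuotientFacts.
Variable G : igraph.
Local Notation T := (tree_of_graph G).
Local Notation toV := (to_orb (@iVK G)).
Local Notation toD := (to_orb (@iDK G)).
Implicit Types (v : vert G) (h : dart G).

Definition qV v : vert T := inl (toV v).
Definition qD h : dart T := inl (toD h).

Lemma qV_iV v : qV (iV v) = qV v.
Proof. by rewrite /qV to_orb_f. Qed.

Lemma qD_iD h : qD (iD h) = qD h.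
Proof. by rewrite /qD to_orb_f. Qed.

Lemma qV_eq v w : (qV v == qV w) = (w == v) || (w == iV v).
Proof. by rewrite -(to_orb_eq (@iVK G)). Qed.

Lemma qD_eq h k : (qD h == qD k) = (k == h) || (k == iD h).
Proof. by rewrite -(to_orb_eq (@iDK G)). Qed.

Lemma src_qD h : src (qD h) = qV (src h).
Proof.
have -> : src (qD h) = qV (src (val (toD h))) by [].
by case: (val_to_orb (@iDK G) h) => ->; rewrite ?src_iD ?qV_iV.
Qed.

Lemma opp_qD h : ~~ anti_invariant h -> opp (qD h) = qD (opp h).
Proof.
move=> na; have -> : opp (qD h) = qD (opp (val (toD h))).
  by rewrite /= insubN ?anti_invariant_toD.
by case: (val_to_orb (@iDK G) h) => ->; rewrite ?opp_iD ?qD_iD.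
Qed.

Lemma opp_qD_anti h : anti_invariant h ->
  exists2 m : midpoint G, val m = toD h & opp (qD h) = inr m.
Proof.
rewrite -anti_invariant_toD => ah /=.
by case: insubP => [m _ e|]; [exists m|rewrite ah].
Qed.

Lemma invariant_toD h : invariant (val (toD h)) = invariant h.
Proof.
by apply: val_to_orb_invariant => k; rewrite /invariant (inj_eq (inv_inj (@iDK G))).
Qed.

Lemma fixed_toV v : (iV (val (toV v)) == val (toV v)) = (iV v == v).
Proof.
by apply: (val_to_orb_invariant (@iVK G) (Q := fun w => iV w == w)) => k; rewrite (inj_eq (inv_inj (@iVK G))).
Qed.

Lemma val_toV_fixed v : iV v = v -> val (toV v) = v.
Proof. by move=> e; case: (val_to_orb (@iVK G) v) => ->. Qed.

Lemma eblue_qD h : eblue (qD h) = invariant h.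
Proof. exact: invariant_toD. Qed.

Lemma vblue_qV v : vblue (qV v) = (iV v == v).
Proof. exact: fixed_toV. Qed.

Lemma genus_qV v : genus (qV v) = if iV v == v then igenus v else 0.
Proof.
have -> : genus (qV v) = if iV (val (toV v)) == val (toV v)
  then igenus (val (toV v)) else 0 by [].
by rewrite fixed_toV; case: eqP => // /val_toV_fixed ->.
Qed.

Lemma invariant_opp h : invariant (opp h) = invariant h.
Proof. by rewrite /invariant -opp_iD (inj_eq (inv_inj (@oppK G))). Qed.

Lemma invariant_src h : invariant h -> iV (src h) = src h.
Proof. by move/eqP => e; rewrite -src_iD e. Qed.

Lemma anti_not_invariant h : anti_invariant h -> ~~ invariant h.
Proof. by case/andP. Qed.

Lemma qD_ex (h : dart T) : (exists k, h = qD k) \/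
  exists m : midpoint G, h = inr m /\ exists k, val m = toD k /\ anti_invariant k.
Proof.
case: h => [a|m]; first by left; exists (val a); rewrite /qD to_orbK.
by right; exists m; split=> //; exists (val (val m)); rewrite to_orbK (valP m).
Qed.

Lemma qV_ex (v : vert T) : (exists w, v = qV w) \/ exists m : midpoint G, v = inr m.
Proof.
case: v => [a|m]; last by right; exists m.
by left; exists (val a); rewrite /qV to_orbK.
Qed.

End QuotientFacts.

Section TreeOfGraph.
Variable G : igraph.
Hypothesis G_hyp : hyperelliptic G.
Local Notation T := (tree_of_graph G).

(** In both exceptional graphs every vertex is fixed by the involution, so condition (2) is
    available at a moved vertex. *)
Lemma hyp_degree (v : vert G) : igenus v = 0 -> (iV v != v) -> 3 <= degree v.
Proof.
case: G_hyp => _ _ [c2|[[c _ _]|[_ _ c _]]] _ _ g0 nv; first exact: c2.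
  by case/eqP: nv; have /card_le1_eqP := eq_leq c; apply.
by case: (c v) => _ e; rewrite e eqxx in nv.
Qed.

(** An edge could become open in the quotient only if [opp k] lay in the orbit of [k]; then it is
    anti-invariant, and is folded at its midpoint instead. *)
Lemma tree_of_graph_closed : closed_graph T.
Proof.
have [[Gcl _] _ _ _ _] := G_hyp.
move=> h; case: (qD_ex h) => [[k ->]|[m [-> _]] //].
case: (boolP (anti_invariant k)) => [/opp_qD_anti[m _ -> //]|na].
rewrite opp_qD // qD_eq eq_sym -[X in _ || X](inj_eq (inv_inj (@iDK G))) iDK.
rewrite (negPf (Gcl k)) /=; apply: contra na => e; rewrite /anti_invariant e.
by rewrite (eqP e) Gcl.
Qed.

Lemma tree_of_graph_by : by_tree T.
Proof.
have [[Gcl Gco] c1 c2 c3 Tt] := G_hyp.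
split.
- by split; first exact: tree_of_graph_closed.
- move=> v; case: (qV_ex v) => [[w ->]|[m ->] //]; rewrite vblue_qV => nw.
  split; first by rewrite genus_qV (negPf nw).
    have w0 : igenus w = 0 by apply/eqP; case: eqP => // /c1 e; rewrite e eqxx in nw.
    rewrite (leq_trans (hyp_degree w0 nw)) // /degree.
    rewrite -(card_in_imset (f := @qD G) (D := [set h | src h == w])); last first.
      move=> h k; rewrite !inE => /eqP sh /eqP sk /eqP.
      rewrite qD_eq => /orP[/eqP //|/eqP e]; case/eqP: nw.
      by rewrite -{2}sk e src_iD sh.
    apply/subset_leq_card/subsetP => h /imsetP[k]; rewrite !inE => /eqP <- ->.
    by rewrite src_qD.
  move=> h sh; apply/negP => /eblue_src; rewrite sh vblue_qV.
  by rewrite (negPf nw).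
- case: c2 => [c2|[[V1 D0 g0]|[V2 dg g0 nD]]].
  + left=> v; case: (qV_ex v) => [[w ->]|[m ->] //]; last first.
      by move=> _ _; exists (inr m).
    rewrite vblue_qV genus_qV => /eqP bw; rewrite bw eqxx => g0.
    case: (pickP (fun h : dart G => (src h == w) && ~~ invariant h)) => [h|nx].
      by case/andP=> /eqP sh ih; exists (qD h); rewrite eblue_qD src_qD sh.
    (* If every edge at [w] were invariant, condition (3) with genus 0 would bound the degree of [w]
       by 2. *)
    suff : degree w <= 2 by rewrite leqNgt c2.
    have := c3 w; rewrite g0; apply: leq_trans.
    apply/subset_leq_card/subsetP => h; rewrite !inE => sh.
    by have := nx h; rewrite sh /= => /negbFE.
  + right; have noD (h : dart G) : False by have := D0; rewrite (cardD1 h) inE.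
    have m0 (m : midpoint G) : False by apply: (noD (val (val m))).
    split.
    * rewrite card_sum -V1 (card_orb (@iVK G)); congr (_ + _).
      rewrite (eq_card0 (A := midpoint G)) => [|m]; last by case: (m0 m).
      apply/esym/eqP; rewrite cards_eq0; apply/eqP/setP => a; rewrite !inE.
      by apply/negbTE/negPn/eqP; have /card_le1_eqP := eq_leq V1; apply.
    * by apply: eq_card0 => -[a|m]; [case: (noD (val a))|case: (m0 m)].
    * move=> v; case: (qV_ex v) => [[w ->]|[m ->] //].
      rewrite vblue_qV genus_qV.
      have -> : iV w = w by have /card_le1_eqP := eq_leq V1; apply.
      by rewrite eqxx g0.
  + left=> v; case: (qV_ex v) => [[w ->]|[m ->] //]; last first.
      by move=> _ _; exists (inr m).
    move=> _ _; have : 0 < degree w by rewrite dg.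
    case/card_gt0P=> h; rewrite inE => /eqP sh.
    exists (qD h); rewrite eblue_qD src_qD sh; split=> //.
    by case: (nD h).
- move=> v; case: (qV_ex v) => [[w ->]|[m ->]]; last first.
    rewrite (eq_card0 (A := _)) // => h; rewrite !inE.
    by case: (qD_ex h) => [[k ->]|[m' [-> _]]]; rewrite ?src_qD // andbF.
  case: (boolP (iV w == w)) => [/eqP bw|nw]; last first.
    rewrite (eq_card0 (A := _)) // => h; rewrite !inE.
    apply/negP => /andP[/eqP sh /eblue_src]; rewrite sh vblue_qV.
    by rewrite (negPf nw).
  rewrite genus_qV bw eqxx.
  rewrite (leq_trans _ (c3 w)) // (leq_trans _ (leq_imset_card (@qD G) _)) //.
  apply/subset_leq_card/subsetP => h; rewrite inE.
  case: (qD_ex h) => [[k ->]|[m' [-> _]]]; last by rewrite andbF.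
  rewrite src_qD eblue_qD qV_eq => /andP[e ik]; apply: imset_f; rewrite inE ik andbT.
  case/orP: e => /eqP; first by move<-.
  by move=> e; rewrite -bw e iVK.
Qed.

(** By [card_orb] the cells of [G] are the orbits plus the two-element orbits once more. The dart
    count of the tree [T], midpoints included, then removes the contribution of the orbits and
    leaves the relative Euler characteristic over the blue part. The genera agree because moved
    vertices have genus 0. *)
Lemma tree_of_graph_genus : by_genus T = hyp_genus G.
Proof.
have [[Gcl Gco] c1 _ _ Tt] := G_hyp.
have Tcl := tree_of_graph_closed.
have := @by_genus_formula T Tt (by_tree_blue tree_of_graph_by).
have := @tree_dart_count T Tcl Tt; have := betti_formula Gco.
have -> : #|[set h : dart G | opp h != h]| = #|dart G|.
  by rewrite -cardsT; apply: eq_card => h; rewrite !inE Gcl.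
rewrite (card_orb (@iVK G)) (card_orb (@iDK G)) !card_sum /hyp_genus.
have -> : \sum_(v : vert T) genus v = \sum_(v : vert G) igenus v.
  rewrite big_sumType /= [X in _ + X]big1 // addn0.
  rewrite -(big_sub (froots (@iV G)) (fun v => if iV v == v then igenus v else 0)).
  rewrite [RHS](bigID (froots (@iV G))) /= [X in _ = _ + X]big1 ?addn0.
    apply: eq_bigr => v _; case: eqP => // nv; case: (posnP (igenus v)) => // n0.
    by case: nv; apply: c1 => e; rewrite e in n0.
  move=> v; rewrite (froots_to_orb (@iVK G)) => nv; case: (posnP (igenus v)) => // n0.
  move: nv; rewrite val_toV_fixed ?eqxx //; apply: c1 => e.
  by rewrite e in n0.
have -> : #|[set v : vert T | ~~ vblue v]| = #|[set a : orb (@iV G) | iV (val a) != val a]|.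
  rewrite -(card_imset _ (@inl_inj (orb (@iV G)) (midpoint G))).
  apply: eq_card => v; rewrite !inE.
  apply/idP/imsetP => [|[a]]; last by rewrite inE => na ->.
  by case: v => [a|m] //= na; exists a; rewrite ?inE.
have -> : #|[set h : dart T | (opp h != h) && ~~ eblue h]| =
  #|[set a : orb (@iD G) | iD (val a) != val a]| + #|midpoint G|.
  have -> : [set h : dart T | (opp h != h) && ~~ eblue h] =
     inl @: [set a : orb (@iD G) | iD (val a) != val a] :|: [set inr m | m : midpoint G].
    apply/setP => -[a|m]; rewrite !inE Tcl /=.
      rewrite mem_imset; last exact: inl_inj.
      rewrite inE /invariant; case: (_ == _) => //=; apply/esym/imsetP => -[] //.
    by apply/esym/orP; right; apply/imsetP; exists m.
  rewrite cardsU [_ :&: _](_ : _ = set0) ?cards0 ?subn0.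
    by rewrite (card_imset _ inl_inj) (card_imset _ inr_inj).
  by apply/setP => h; rewrite !inE; apply/negP => /andP[/imsetP[a _ ->] /imsetP[]].
lia.
Qed.

End TreeOfGraph.
(** * Sheets of the quotient map *)

Section Sheets.
Variable G : igraph.
Hypotheses (G_closed : closed_graph G) (quot_tree : is_tree (tree_of_graph G))
  (quot_closed : closed_graph (tree_of_graph G)).
Implicit Types (v : vert G) (h : dart G).

(* The double cover of the yellow part is trivial because the quotient is a tree:
   the cocycle comparing the sheets along an edge is a coboundary. *)
Lemma sheet_vert : exists s : vert G -> bool,
  (forall v, iV v != v -> s (iV v) = ~~ s v) /\
  (forall h, ~~ anti_invariant h -> iV (src h) != src h ->
     iV (src (opp h)) != src (opp h) -> s (src (opp h)) = s (src h)).
Proof.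
pose s0 v := val (to_orb (@iVK G) v) == v.
have s0N v : iV v != v -> s0 (iV v) = ~~ s0 v.
  rewrite /s0 to_orb_f; case: (val_to_orb (@iVK G) v) => -> nv; rewrite eqxx.
    by rewrite eq_sym (negPf nv).
  by rewrite nv.
(* [c0] records whether the arbitrary sheets [s0] disagree at the ends of an edge. It is set to
   [false] on folded edges and on edges with a fixed end, where nothing is to be compared, and it is
   invariant under [iD], so it descends to the quotient. *)
pose c0 h := [&& ~~ anti_invariant h, iV (src h) != src h &
  iV (src (opp h)) != src (opp h)] && (s0 (src h) (+) s0 (src (opp h))).
have c0_opp h : c0 (opp h) = c0 h.
  rewrite /c0 anti_invariant_opp oppK addbC; congr andb; congr andb; exact: andbC.
have c0_iD h : c0 (iD h) = c0 h.
  rewrite /c0 anti_invariant_iD opp_iD !src_iD !(inj_eq (inv_inj (@iVK G))).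
  case: (anti_invariant h) => //=.
  case: (boolP (iV (src h) == src h)) => //= n1.
  case: (boolP (iV (src (opp h)) == src (opp h))) => //= n2.
  by rewrite !s0N // addbN addNb negbK.
pose c (k : dart (tree_of_graph G)) : bool := if k is inl a then c0 (val a) else false.
have cE h : c (qD h) = c0 h by exact: (val_to_orb_invariant (@iDK G) (Q := c0)).
have [k|t tP] := @tree_coboundary _ c quot_closed quot_tree.
  case: (qD_ex k) => [[h ->]|[m [-> [h [em ah]]]]].
    case: (boolP (anti_invariant h)) => [ah|na]; last by rewrite opp_qD // !cE.
    by have [m _ ->] := opp_qD_anti ah; rewrite cE /c0 ah.
  have -> : opp (inr m : dart (tree_of_graph G)) = qD h by rewrite /= em.
  by rewrite cE /c0 ah.
exists (fun v => s0 v (+) t (qV v)); split=> [v nv|h na n1 n2].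
  by rewrite qV_iV s0N // addNb.
have := tP (qD h); rewrite cE /c0 na n1 n2 opp_qD // !src_qD /=.
by case: (s0 _) (s0 _) (t _) (t _) => -[] [] [].
Qed.

(** A dart with a moved end takes the sheet of that end. The other moved darts run between fixed
    vertices, and the choice is made by comparing ranks. On an anti-invariant edge [opp] and [iD]
    agree and must flip the label, so single darts are compared; otherwise the minimum over the two
    halves gives both the same label. *)
Lemma sheet_dart (s : vert G -> bool) :
  (forall v, iV v != v -> s (iV v) = ~~ s v) ->
  (forall h, ~~ anti_invariant h -> iV (src h) != src h ->
     iV (src (opp h)) != src (opp h) -> s (src (opp h)) = s (src h)) ->
  exists u : dart G -> bool,
  [/\ forall h, ~~ invariant h -> u (iD h) = ~~ u h,
      forall h, ~~ anti_invariant h -> u (opp h) = u h &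
      forall h, iV (src h) != src h -> u h = s (src h)].
Proof.
move=> sN sO; pose er h := enum_rank h : nat.
have erE h k : (er h == er k) = (h == k).
  by apply/eqP/eqP => [/val_inj/enum_rank_inj|->].
exists (fun h => if iV (src h) != src h then s (src h)
  else if anti_invariant h then er h < er (iD h)
  else if iV (src (opp h)) != src (opp h) then s (src (opp h))
  else minn (er h) (er (opp h)) < minn (er (iD h)) (er (iD (opp h)))); split=> h.
- rewrite /invariant => nh.
  rewrite anti_invariant_iD opp_iD !src_iD !(inj_eq (inv_inj (@iVK G))) !iDK.
  case: ifPn => n1; first exact: sN.
  case: ifPn => ah.
    have := erE h (iD h); rewrite [h == _]eq_sym (negPf nh) => /negbT; lia.
  case: ifPn => n2; first exact: sN.
  have e1 := erE h (iD h); rewrite [h == _]eq_sym (negPf nh) in e1.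
  have e2 : er h != er (iD (opp h)).
    apply: contra ah; rewrite erE /anti_invariant nh andbT => /eqP e.
    by rewrite {1}e iDK.
  have e3 : er (opp h) != er (iD h).
    by apply: contra ah; rewrite erE /anti_invariant nh andbT eq_sym.
  have e4 : er (opp h) != er (iD (opp h)).
    by rewrite erE -opp_iD (inj_eq (inv_inj (@oppK G))) eq_sym.
  move: e1 e2 e3 e4; lia.
- move=> na; rewrite anti_invariant_opp oppK (negPf na).
  case: ifPn => n1; case: ifPn => n2 //; first exact: sO.
  by rewrite minnC [X in _ < X]minnC.
- by move=> ->.
Qed.

End Sheets.

(** Used once for vertices and once for darts: the orbit and the sheet determine [x], because [s]
    separates the two points of a non-trivial orbit, while on blue elements the label is always
    [true]. *)
Lemma double_bij (A B : finType) (f : A -> A) (q : A -> B) (K blue : pred B) (s : A -> bool)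
    (pP : forall x, K (q x) && (blue (q x) ==> (blue (q x) || s x))) :
  (forall x y, (q x == q y) = (y == x) || (y == f x)) -> (forall x, q (f x) = q x) ->
  (forall x, blue (q x) = (f x == x)) -> (forall b, K b -> exists x, b = q x) ->
  (forall x, f x != x -> s (f x) = ~~ s x) ->
  bijective (fun x => Sub (q x, blue (q x) || s x) (pP x) :
    {p : B * bool | K p.1 && (blue p.1 ==> p.2)}).
Proof.
move=> qE qf bE Kq sN; apply: inj_surj_bij => [x y /(congr1 val) e|[[b c] pc]].
  have /eqP : q x = q y := congr1 fst e.
  have es : blue (q x) || s x = blue (q y) || s y := congr1 snd e.
  rewrite qE => /orP[/eqP // |/eqP ey]; case: (eqVneq (f x) x) => [<- //|nx].
  by move: es; rewrite ey qf bE (negPf nx) /= sN //; case: (s x).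
have /andP[kb bc] : K b && (blue b ==> c) := pc; have [x ex] := Kq b kb.
have {}bc : blue (q x) -> c by apply/implyP; rewrite -ex.
case: (boolP (blue (q x) || (s x == c))) => [e|].
  exists x; apply: val_inj; rewrite !SubK ex; congr pair.
  case/orP: e => [bx|/eqP ->]; first by rewrite bx bc.
  by case: (blue (q x)) bc => // ->.
rewrite negb_or bE => /andP[nx sc]; exists (f x).
apply: val_inj; rewrite !SubK ex qf bE (negPf nx) sN //; congr pair.
by case: (s x) c sc {pc bc} => -[].
Qed.

Section GraphOfTreeOfGraph.
Variable G : igraph.
Hypothesis G_hyp : hyperelliptic G.
Local Notation T := (tree_of_graph G).

(** The vertex above a genus 0 leaf is fixed and its darts form a single orbit, so its degree is at
    most 2. Only the exceptional circle allows this, as the exceptional point has no darts. *)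
Lemma leaf_exceptional (v : vert G) : genus0_leaf (qV v : vert T) -> exceptional_circle G.
Proof.
have [[Gcl Gco] c1 c2 c3 Tt] := G_hyp.
case/andP=> /eqP gv /eqP dv.
have bv : iV v == v.
  apply/negPn/negP => nv; have [_ b1 _ _] := tree_of_graph_by G_hyp.
  by have [|_] := b1 (qV v); rewrite ?vblue_qV ?dv.
have /mem_card1[k0 k0P] := eqP (introT eqP dv).
have : k0 \in [set h : dart T | src h == qV v] by rewrite k0P inE.
rewrite inE => sk0; case: (qD_ex k0) => [[k ek]|[m [em _]]]; last by rewrite em in sk0.
case: c2 => [c2|[[V1 D0 g0]|//]]; last by have := D0; rewrite (cardD1 k) inE.
move: gv; rewrite genus_qV bv => /c2; rewrite leqNgt ltnS => /negP[].
apply: (@leq_trans #|[set k; iD k]|); last by rewrite cards2; case: (_ != _).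
rewrite /degree; apply/subset_leq_card/subsetP => h; rewrite !inE => /eqP sh.
have : qD h \in [set h : dart T | src h == qV v] by rewrite inE src_qD sh.
by rewrite k0P inE ek eq_sym qD_eq.
Qed.

Lemma circle_segment : exceptional_circle G -> exceptional_segment T.
Proof.
case=> V2 dg g0 nD; apply/and3P.
have m0 (m : midpoint G) : False.
  by case: (nD (val (val m))) => _; case/andP: (valP m) => ->.
split.
- rewrite card_sum (eq_card0 (A := midpoint G)) => [|m]; last by case: (m0 m).
  rewrite addn0 -V2 (card_orb (@iVK G)) -[X in X == _]addn0 eqn_add2l eq_sym cards_eq0.
  by apply/eqP/setP => a; rewrite !inE; apply/negbTE/negPn/eqP; case: (g0 (val a)).
- apply/forallP => v; case: (qV_ex v) => [[w ->]|[m _]]; last by case: (m0 m).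
  have [gw bw] := g0 w; rewrite /genus0_leaf genus_qV bw eqxx gw eqxx /=.
  have : 0 < degree w by rewrite dg.
  case/card_gt0P => h; rewrite inE => /eqP sh.
  have e : [set h; iD h] = [set h' : dart G | src h' == w].
    apply/eqP; rewrite eqEcard -[#|[set h' | _]|]/(degree w) dg cards2.
    have [nh _] := nD h; rewrite eq_sym nh andbT; apply/subsetP => k; rewrite !inE.
    by case/orP=> /eqP-> //; rewrite ?src_iD sh ?bw.
  rewrite /degree -(cards1 (qD h)); apply/eqP/eq_card => k; rewrite !inE.
  case: (qD_ex k) => [[k' ->]|[m _]]; last by case: (m0 m).
  rewrite src_qD eq_sym qV_eq bw orbb [qD _ == _]eq_sym qD_eq.
  by have := in_set2 k' h (iD h); rewrite e inE.
- apply/forallP => h; case: (qD_ex h) => [[k ->]|[m _]]; last by case: (m0 m).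
  by rewrite eblue_qD; case: (nD k).
Qed.

Lemma kept_qV (v : vert G) : kept (qV v : vert T).
Proof.
rewrite /kept; case: (boolP (genus0_leaf _)) => //= /leaf_exceptional.
exact: circle_segment.
Qed.

(** With [kept_qV], the suppressed leaves are exactly the midpoints. Were the quotient an
    exceptional segment, [G] would be the exceptional circle, which has no anti-invariant dart. *)
Lemma midpoint_not_kept (m : midpoint G) : ~~ @kept T (inr m).
Proof.
have d1 : #|[set h : dart T | src h == inr m :> vert T]| = 1.
  rewrite -(cards1 (inr m : dart T)); apply: eq_card => h; rewrite !inE.
  by case: (qD_ex h) => [[k ->]|[m' [-> _]]]; rewrite ?src_qD.
rewrite /kept negb_or negbK /genus0_leaf /degree d1 eqxx /=.
apply/negP => /and3P[_ /forallP lf _].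
have [k ak] : exists k : dart G, anti_invariant k by exists (val (val m)); exact: valP m.
have /leaf_exceptional[_ _ _ /(_ k) [_]] := lf (qV (src k)).
by case/andP: ak => ->.
Qed.

Lemma graph_of_tree_of_graph : hyp_iso (graph_of_tree T) G.
Proof.
have [[Gcl Gco] c1 c2 c3 Tt] := G_hyp.
have [s [sN sO]] := sheet_vert Tt (tree_of_graph_closed G_hyp).
have [u [uN uO us]] := sheet_dart sN sO.
apply: hyp_iso_sym.
have PV v : kept (qV v : vert T) && (vblue (qV v : vert T) ==> (vblue (qV v : vert T) || s v)).
  by rewrite kept_qV; case: vblue.
have PD h : kept (src (qD h : dart T)) &&
    (eblue (qD h : dart T) ==> (eblue (qD h : dart T) || u h)).
  by rewrite src_qD kept_qV; case: eblue.
pose fV v : dbl_vert T := Sub (qV v, vblue (qV v : vert T) || s v) (PV v).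
pose fD h : dbl_dart T := Sub (qD h, eblue (qD h : dart T) || u h) (PD h).
exists fV, fD; split; first split.
- apply: (@double_bij _ _ _ (@qV G) (@kept T) (@vblue T) s PV (@qV_eq G) (@qV_iV G)) => [v|x kx|v nv]; first exact: vblue_qV.
    case: (qV_ex x) => // -[m ex]; by rewrite ex (negPf (midpoint_not_kept m)) in kx.
  exact: sN.
- apply: (@double_bij _ _ _ (@qD G) (fun h => kept (src h)) (@eblue T) u PD
    (@qD_eq G) (@qD_iD G)) => [h|x kx|h nh]; first exact: eblue_qD.
    case: (qD_ex x) => // -[m [ex _]]; by rewrite ex (negPf (midpoint_not_kept m)) in kx.
  exact: uN.
- move=> h; split; apply: val_inj; rewrite !SubK.
    rewrite src_qD vblue_qV eblue_qD; congr pair.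
    case: (boolP (iV (src h) == src h)) => //= n1; rewrite -us //.
    by case: (boolP (invariant h)) => // /invariant_src/eqP; rewrite (negPf n1).
  rewrite /dbl_opp_raw [fst _]/(qD h : dart T) [snd _]/(eblue (qD h : dart T) || u h).
  (* On a folded edge [opp] acts as [iD], which matches the flip of the label in [dbl_opp_raw]. *)
  case: (boolP (anti_invariant h)) => ah.
    have [m em ->] := opp_qD_anti ah; rewrite (negPf (midpoint_not_kept m)).
    have eo : opp h = iD h by case/andP: ah => /eqP.
    rewrite eo qD_iD !eblue_qD uN ?anti_not_invariant //.
    by rewrite (negPf (anti_not_invariant ah)).
  by rewrite opp_qD // src_qD kept_qV !eblue_qD uO // invariant_opp.
- move=> v; rewrite -[LHS]/(dbl_genus (fV v)) /dbl_genus SubK vblue_qV genus_qV.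
  case: (eqVneq (iV v) v) => // nv; case: (posnP (igenus v)) => // n0.
  by case/eqP: nv; apply: c1 => e; rewrite e in n0.
- move=> v; apply: val_inj; rewrite !SubK qV_iV vblue_qV; congr pair.
  by case: (boolP (iV v == v)) => //= nv; rewrite sN.
- move=> h; apply: val_inj; rewrite !SubK qD_iD eblue_qD; congr pair.
  by case: (boolP (invariant h)) => //= nv; rewrite uN.
Qed.

End GraphOfTreeOfGraph.
(** * The double of a BY tree *)

Section GraphOfTree.
Variable T : by_graph.
Hypothesis T_by : by_tree T.
Local Notation G := (graph_of_tree T).
Implicit Types (v : vert T) (h : dart T).

Let T_closed : closed_graph T. Proof. by case: T_by => -[]. Qed.
Let T_tree : is_tree T. Proof. by case: T_by => -[]. Qed.

Lemma condition2_of_dart h : by_condition2 T.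
Proof.
by case: T_by => _ _ [//|[_ D0 _]]; have := D0; rewrite (cardD1 h) inE.
Qed.

Lemma leaf_dart_unique v h k : genus0_leaf v -> src h = v -> src k = v -> h = k.
Proof.
case/andP=> _ /eqP/eq_leq/card_le1_eqP lv sh sk.
by apply: lv; rewrite inE ?sh ?sk.
Qed.

Lemma leaf_blue v : genus0_leaf v -> vblue v.
Proof.
case/andP=> _ /eqP dv; apply/negPn/negP => nv.
by have [_ c1 _ _] := T_by; have [_] := c1 v nv; rewrite dv.
Qed.

Lemma leaf_dart_yellow h : genus0_leaf (src h) -> ~~ eblue h.
Proof.
move=> lf; have /andP[/eqP g0 _] := lf.
have [k [sk yk]] := condition2_of_dart h (leaf_blue lf) g0.
by rewrite (leaf_dart_unique lf (erefl _) sk).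
Qed.

Lemma not_kept_leaf v : ~~ kept v -> genus0_leaf v.
Proof. by rewrite negb_or negbK => /andP[]. Qed.

(** Two adjacent leaves and their edge form a whole connected component. Hence a suppressed leaf
    always has a kept neighbour. *)
Lemma leaf_leaf_segment h :
  genus0_leaf (src h) -> genus0_leaf (src (opp h)) -> exceptional_segment T.
Proof.
move=> l1 l2; have all2 v : v \in [set src h; src (opp h)].
  have /connectP[p] := T_tree.1.2 (src h) v.
  have : src h \in [set src h; src (opp h)] by rewrite !inE eqxx.
  elim: p {1 3 4}(src h) => [|w p IHp] x /= xP; first by move=> _ ->.
  case/andP=> /existsP[k /andP[/eqP sk /eqP <-]]; apply: IHp.
  move: xP; rewrite !inE => /orP[]/eqP ex; rewrite ex in sk.
    by rewrite (leaf_dart_unique l1 sk (erefl _)) eqxx orbT.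
  by rewrite (leaf_dart_unique l2 sk (erefl _)) oppK eqxx.
have ne : src h != src (opp h).
  apply/negP => /eqP e; have /eqP := leaf_dart_unique l1 (erefl _) (esym e).
  by rewrite eq_sym (negPf (T_closed h)).
have lf v : genus0_leaf v by have := all2 v; rewrite !inE => /orP[]/eqP->.
apply/and3P; split.
- rewrite -cardsT (_ : setT = [set src h; src (opp h)]) ?cards2 ?ne //.
  by apply/setP => v; rewrite all2 inE.
- by apply/forallP.
- by apply/forallP => k; apply: leaf_dart_yellow.
Qed.

Lemma kept_neighbour h : ~~ kept (src h) -> kept (src (opp h)).
Proof.
move=> nk; apply/negPn/negP => nk'; move: (nk).
by rewrite /kept (leaf_leaf_segment (not_kept_leaf nk) (not_kept_leaf nk')) orbT.
Qed.

Lemma not_kept_unique h k : ~~ kept (src h) -> src h = src k -> h = k.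
Proof. by move=> /not_kept_leaf l e; apply: (leaf_dart_unique l). Qed.

(** The label is normalised to [true] on blue vertices, so that [b] ranges over both sheets without
    a side condition and the sheets coincide where they are glued. *)
Definition dblV v b (k : kept v) : vert G :=
  Sub (v, vblue v || b) (introT andP (conj k (introT implyP (fun bv => introT orP (or_introl bv))))).

Definition dblD h b (k : kept (src h)) : dart G :=
  Sub (h, eblue h || b) (introT andP (conj k (introT implyP (fun bv => introT orP (or_introl bv))))).

Lemma dblV_ex (p : vert G) : exists v b k, p = @dblV v b k.
Proof.
case: p => -[v b] p; have /andP[k vb] : kept v && (vblue v ==> b) := p.
exists v, b, k; apply: val_inj; rewrite !SubK; congr pair.
by case: (vblue v) vb => // ->.
Qed.

Lemma dblD_ex (p : dart G) : exists h b k, p = @dblD h b k.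
Proof.
case: p => -[h b] p; have /andP[k hb] : kept (src h) && (eblue h ==> b) := p.
exists h, b, k; apply: val_inj; rewrite !SubK; congr pair.
by case: (eblue h) hb => // ->.
Qed.

Lemma dblV_eq v b k v' b' k' :
  (@dblV v b k == @dblV v' b' k') = (v == v') && (vblue v || (b == b')).
Proof.
rewrite -val_eqE !SubK xpair_eqE; case: eqP => //= ->.
by case: (vblue v').
Qed.

Lemma dblD_eq h b k h' b' k' :
  (@dblD h b k == @dblD h' b' k') = (h == h') && (eblue h || (b == b')).
Proof.
rewrite -val_eqE !SubK xpair_eqE; case: eqP => //= ->.
by case: (eblue h').
Qed.

Lemma iV_dblV v b k : iV (@dblV v b k) = dblV (~~ b) k.
Proof. by apply: val_inj; rewrite !SubK; congr pair; case: (vblue v). Qed.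

Lemma iD_dblD h b k : iD (@dblD h b k) = dblD (~~ b) k.
Proof. by apply: val_inj; rewrite !SubK; congr pair; case: (eblue h). Qed.

Lemma src_dblD h b k : src (@dblD h b k) = dblV b k.
Proof.
apply: val_inj; rewrite !SubK; congr pair.
by have := @eblue_src T h; case: (eblue h) => [-> //|_]; case: (vblue _).
Qed.

Lemma opp_dblD_kept h b k (k' : kept (src (opp h))) : opp (@dblD h b k) = dblD b k'.
Proof.
by apply: val_inj; rewrite !SubK /dbl_opp_raw k' /= eblue_opp.
Qed.

Lemma opp_dblD_leaf h b k : ~~ kept (src (opp h)) -> opp (@dblD h b k) = dblD (~~ b) k.
Proof.
move=> nk; apply: val_inj; rewrite !SubK /dbl_opp_raw (negPf nk) /=.
by congr pair; case: (eblue h).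
Qed.

Lemma invariant_dblD h b k : invariant (@dblD h b k) = eblue h.
Proof. by rewrite /invariant iD_dblD dblD_eq eqxx; case: (eblue h) b => -[]. Qed.

Lemma fixed_dblV v b k : (iV (@dblV v b k) == dblV b k) = vblue v.
Proof. by rewrite iV_dblV dblV_eq eqxx; case: (vblue v) b => -[]. Qed.

Lemma igenus_dblV v b k : igenus (@dblV v b k) = if vblue v then genus v else 0.
Proof. by []. Qed.

Lemma yellow_to_leaf h : ~~ kept (src (opp h)) -> ~~ eblue h.
Proof. by move/not_kept_leaf/leaf_dart_yellow; rewrite eblue_opp. Qed.

Lemma anti_invariant_dblD h b k : anti_invariant (@dblD h b k) = ~~ kept (src (opp h)).
Proof.
rewrite /anti_invariant -/(invariant _) invariant_dblD iD_dblD.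
case: (boolP (kept (src (opp h)))) => [k'|nk].
  by rewrite (opp_dblD_kept _ _ k') dblD_eq eq_sym (negPf (T_closed h)).
by rewrite opp_dblD_leaf // eqxx (yellow_to_leaf nk).
Qed.

Lemma graph_of_tree_closed : closed_graph G.
Proof.
move=> p; have [h [b [k ->]]] := dblD_ex p.
case: (boolP (kept (src (opp h)))) => [k'|nk].
  by rewrite (opp_dblD_kept _ _ k') dblD_eq (negPf (T_closed h)).
rewrite opp_dblD_leaf // dblD_eq eqxx (negPf (yellow_to_leaf nk)).
by case: b.
Qed.

Lemma qV_dblV v b k v' b' k' :
  (qV (@dblV v b k) == qV (@dblV v' b' k')) = (v == v').
Proof.
rewrite qV_eq iV_dblV !dblV_eq eq_sym; case: (v == v') => //=.
by case: (vblue _) b b' => -[] [].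
Qed.

Lemma qD_dblD h b k h' b' k' :
  (qD (@dblD h b k) == qD (@dblD h' b' k')) = (h == h').
Proof.
rewrite qD_eq iD_dblD !dblD_eq eq_sym; case: (h == h') => //=.
by case: (eblue _) b b' => -[] [].
Qed.

(* The midpoint of an anti-invariant edge corresponds to the suppressed leaf. *)
Definition from_quotV (x : vert (tree_of_graph G)) : vert T :=
  match x with
  | inl a => (val (val a)).1
  | inr m => src (opp (val (val (val m))).1)
  end.

Definition from_quotD (x : dart (tree_of_graph G)) : dart T :=
  match x with
  | inl a => (val (val a)).1
  | inr m => opp (val (val (val m))).1
  end.

Lemma from_quotV_qV v b k : from_quotV (qV (@dblV v b k)) = v.
Proof.
rewrite -[LHS]/((val (val (to_orb (@iVK G) (dblV b k)))).1).
by case: (val_to_orb (@iVK G) (dblV b k)) => ->; rewrite ?iV_dblV.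
Qed.

Lemma from_quotD_qD h b k : from_quotD (qD (@dblD h b k)) = h.
Proof.
rewrite -[LHS]/((val (val (to_orb (@iDK G) (dblD b k)))).1).
by case: (val_to_orb (@iDK G) (dblD b k)) => ->; rewrite ?iD_dblD.
Qed.

Lemma mid_ex (m : midpoint G) : exists h b k,
  val m = to_orb (@iDK G) (@dblD h b k) /\ ~~ kept (src (opp h)).
Proof.
have [h [b [k e]]] := dblD_ex (val (val m)); exists h, b, k.
by rewrite -e to_orbK -(anti_invariant_dblD b k) -e; split=> //; exact: valP m.
Qed.

Lemma from_quotD_mid m h b k : val m = to_orb (@iDK G) (@dblD h b k) ->
  from_quotD (inr m) = opp h.
Proof.
move=> e; rewrite -[LHS]/(opp (from_quotD (inl (val m)))) e.
by rewrite -/(qD (dblD b k)) from_quotD_qD.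
Qed.

Lemma tree_of_graph_of_tree : by_iso (tree_of_graph G) T.
Proof.
exists from_quotV, from_quotD; split.
- split; apply: inj_surj_bij.
  + move=> x y.
    case: (qV_ex x) => [[p ->]|[m ->]]; case: (qV_ex y) => [[q ->]|[m' ->]].
    * have [v [b [k ->]]] := dblV_ex p; have [w [b' [k' ->]]] := dblV_ex q.
      by rewrite !from_quotV_qV => e; apply/eqP; rewrite qV_dblV e.
    * have [v [b [k ->]]] := dblV_ex p; have [h [b' [k' [em nk]]]] := mid_ex m'.
      rewrite from_quotV_qV -[RHS]/(src (from_quotD (inr m'))) (from_quotD_mid em) => e.
      by rewrite -e k in nk.
    * have [v [b [k ->]]] := dblV_ex q; have [h [b' [k' [em nk]]]] := mid_ex m.
      rewrite from_quotV_qV -[LHS]/(src (from_quotD (inr m))) (from_quotD_mid em) => e.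
      by rewrite e k in nk.
    * have [h [b [k [em nk]]]] := mid_ex m; have [h' [b' [k' [em' nk']]]] := mid_ex m'.
      rewrite -[LHS]/(src (from_quotD (inr m))) -[RHS]/(src (from_quotD (inr m'))).
      rewrite (from_quotD_mid em) (from_quotD_mid em') => /(not_kept_unique nk).
      move/(inv_inj (@oppK T)) => e; congr inr; apply: val_inj; rewrite em em'.
      have /eqP : qD (dblD b k) == qD (dblD b' k') by rewrite qD_dblD e.
      exact: inl_inj.
  + move=> v; case: (boolP (kept v)) => [k|nk].
      by exists (qV (dblV true k)); rewrite from_quotV_qV.
    (* A suppressed leaf is hit by the midpoint of the folded edge lying over its only edge. *)
    have [h sh] : exists h, src h = v.
      have /andP[_ /eqP dv] := not_kept_leaf nk.
      have : 0 < degree v by rewrite dv.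
      by case/card_gt0P => h; rewrite inE => /eqP; exists h.
    rewrite -sh in nk; have k := kept_neighbour nk.
    have ah : anti_invariant (dblD true k) by rewrite anti_invariant_dblD oppK.
    have [m em _] := opp_qD_anti ah; exists (inr m).
    by rewrite -[LHS]/(src (from_quotD (inr m))) (from_quotD_mid em) oppK.
  + move=> x y.
    case: (qD_ex x) => [[p ->]|[m [-> _]]]; case: (qD_ex y) => [[q ->]|[m' [-> _]]].
    * have [v [b [k ->]]] := dblD_ex p; have [w [b' [k' ->]]] := dblD_ex q.
      by rewrite !from_quotD_qD => e; apply/eqP; rewrite qD_dblD e.
    * have [v [b [k ->]]] := dblD_ex p; have [h [b' [k' [em nk]]]] := mid_ex m'.
      by rewrite from_quotD_qD (from_quotD_mid em) => e; rewrite -e k in nk.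
    * have [v [b [k ->]]] := dblD_ex q; have [h [b' [k' [em nk]]]] := mid_ex m.
      by rewrite from_quotD_qD (from_quotD_mid em) => e; rewrite e k in nk.
    * have [h [b [k [em nk]]]] := mid_ex m; have [h' [b' [k' [em' nk']]]] := mid_ex m'.
      rewrite (from_quotD_mid em) (from_quotD_mid em').
      move/(inv_inj (@oppK T)) => e; congr inr; apply: val_inj; rewrite em em'.
      have /eqP : qD (dblD b k) == qD (dblD b' k') by rewrite qD_dblD e.
      exact: inl_inj.
  + move=> h; case: (boolP (kept (src h))) => [k|nk].
      by exists (qD (dblD true k)); rewrite from_quotD_qD.
    have k := kept_neighbour nk.
    have ah : anti_invariant (dblD true k) by rewrite anti_invariant_dblD oppK.
    have [m em _] := opp_qD_anti ah; exists (inr m).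
    by rewrite (from_quotD_mid em) oppK.
- move=> x; case: (qD_ex x) => [[p ->]|[m [-> _]]]; last first.
    by split=> //; rewrite -[LHS]/(opp (opp (from_quotD (inl (val m))))) oppK.
  have [h [b [k ->]]] := dblD_ex p; rewrite src_qD src_dblD from_quotV_qV from_quotD_qD.
  split=> //; case: (boolP (kept (src (opp h)))) => [k'|nk].
    rewrite opp_qD ?anti_invariant_dblD ?k' // (opp_dblD_kept _ _ k').
    by rewrite from_quotD_qD.
  have ah : anti_invariant (dblD b k) by rewrite anti_invariant_dblD.
  by have [m em ->] := opp_qD_anti ah; rewrite (from_quotD_mid em).
- move=> x; case: (qV_ex x) => [[p ->]|[m ->]].
    have [v [b [k ->]]] := dblV_ex p.
    rewrite from_quotV_qV genus_qV fixed_dblV igenus_dblV; case: (boolP (vblue v)) => // nv.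
    by have [_ c1 _ _] := T_by; have [] := c1 v nv.
  have [h [b [k [em nk]]]] := mid_ex m.
  rewrite -[LHS]/(genus (src (from_quotD (inr m)))) (from_quotD_mid em).
  by have /andP[/eqP] := not_kept_leaf nk.
- move=> x; case: (qV_ex x) => [[p ->]|[m ->]].
    have [v [b [k ->]]] := dblV_ex p.
    by rewrite from_quotV_qV vblue_qV fixed_dblV.
  have [h [b [k [em nk]]]] := mid_ex m.
  rewrite -[LHS]/(vblue (src (from_quotD (inr m)))) (from_quotD_mid em).
  exact/leaf_blue/not_kept_leaf.
- move=> x; case: (qD_ex x) => [[p ->]|[m [-> _]]].
    have [h [b [k ->]]] := dblD_ex p.
    by rewrite from_quotD_qD eblue_qD invariant_dblD.
  have [h [b [k [em nk]]]] := mid_ex m.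
  by rewrite (from_quotD_mid em) eblue_opp (negPf (yellow_to_leaf nk)).
Qed.

Lemma kept_exists : exists v, kept v.
Proof.
have [[[v] _] _] := T_tree; case: (boolP (kept v)) => [k|nk]; first by exists v.
have /andP[_ /eqP dv] := not_kept_leaf nk.
have : 0 < degree v by rewrite dv.
case/card_gt0P => h; rewrite inE => /eqP sh; rewrite -sh in nk.
by exists (src (opp h)); exact: kept_neighbour.
Qed.

Lemma adj_dblV h b (k : kept (src h)) (k' : kept (src (opp h))) :
  adj (dblV b k) (dblV b k').
Proof.
apply/existsP; exists (dblD b k).
by rewrite (opp_dblD_kept _ _ k') !src_dblD !eqxx.
Qed.

Lemma graph_adjC (H : graph) : connect_sym (@adj H).
Proof.
apply: sym_connect_sym => x y; apply/existsP/existsP => -[h /andP[hx hy]];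
  by exists (opp h); rewrite oppK hx hy.
Qed.

(* Below a yellow vertex there is a blue one, where the two sheets meet. *)
Lemma sheets_connected v (k : kept v) : connect (@adj G) (dblV true k) (dblV false k).
Proof.
have [r _] := kept_exists; have [d [d0 dS dne du]] := rooting_exists r T_closed T_tree.
have [n] := ubnP (\max_u d u - d v); elim: n => // n IHn in v k *.
rewrite ltnS => ln; case: (boolP (vblue v)) => bv.
  by rewrite (_ : dblV true k = dblV false k) //; apply/eqP; rewrite dblV_eq eqxx bv.
have [_ c1 _ _] := T_by; have [_ dg _] := c1 v bv.
(* A yellow vertex has at least three darts and at most one of them climbs, so the search for a blue
   vertex can continue away from the root. It ends at the latest at a suppressed leaf, where the
   folded edge itself joins the two sheets. *)
have [h sh lh] : exists2 h, src h = v & d v < d (src (opp h)).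
  case: (pickP (fun h : dart T => (src h == v) && (d v < d (src (opp h))))) => [h|no].
    by case/andP=> /eqP; exists h.
  suff : degree v <= 1 by rewrite leqNgt (ltnW dg).
  apply/card_le1_eqP => x y; rewrite !inE => /eqP sx /eqP sy.
  have up z : src z = v -> d (src (opp z)) < d (src z).
    move=> e; have := no z; rewrite -e eqxx /= => /negbT.
    by rewrite -leqNgt leq_eqVlt eq_sym (negPf (dne z)).
  by apply: du; rewrite ?up ?sx ?sy.
subst v.
case: (boolP (kept (src (opp h)))) => [k'|nk].
  apply: connect_trans (connect1 (adj_dblV true k k')) _.
  apply: (connect_trans (y := dblV false k')).
    apply: IHn; apply: leq_trans ln; rewrite ltn_sub2l //.
    by apply: leq_trans lh _; exact: leq_bigmax.
  by rewrite graph_adjC; apply: connect1; exact: adj_dblV.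
apply: connect1; apply/existsP; exists (dblD true k).
by rewrite opp_dblD_leaf // !src_dblD !eqxx.
Qed.

Lemma graph_of_tree_connected : connected G.
Proof.
have [r kr] := kept_exists; have [d [d0 dS dne du]] := rooting_exists r T_closed T_tree.
suff toR (p : vert G) : connect (@adj G) p (dblV true kr).
  split=> [|p q]; first by exists; exact: (dblV true kr).
  by apply: connect_trans (toR p) _; rewrite graph_adjC.
have [v [b [k ->]]] := dblV_ex p.
have [n] := ubnP (d v); elim: n => // n IHn in v b k *; rewrite ltnS => ln.
case: (eqVneq v r) => [e|vr].
  subst v; rewrite (bool_irrelevance k kr); case: b => //.
  by rewrite graph_adjC sheets_connected.
have [h [sh uh]] := dS v vr; subst v.
case: (boolP (kept (src (opp h)))) => [k'|nk].
  apply: connect_trans (connect1 (adj_dblV b k k')) _; apply: IHn.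
  exact: leq_trans uh ln.
(* The climb never meets a suppressed leaf: it is not the kept root [r], so its only dart would have
   to climb back to the vertex just left. *)
case: (eqVneq (src (opp h)) r) => [e|/dS[h' [sh' uh']]]; first by rewrite e kr in nk.
have e := not_kept_unique nk (esym sh'); rewrite -e oppK in uh'.
by move: (ltn_trans uh uh'); rewrite ltnn.
Qed.

Lemma graph_of_tree_degree v b (k : kept v) : degree v <= degree (dblV b k : vert G).
Proof.
apply: (@leq_trans #|[set (val q).1 | q : dart G in [set q | src q == dblV b k]]|).
  apply/subset_leq_card/subsetP => h; rewrite inE => /eqP sh.
  subst v; apply/imsetP; exists (dblD b k) => //.
  by rewrite inE src_dblD.
exact: leq_imset_card.
Qed.

Lemma graph_of_tree_cond3 : hyp_condition3 G.
Proof.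
have [_ c1 _ c3] := T_by.
move=> p; have [v [b [k ->]]] := dblV_ex p; rewrite igenus_dblV.
case: (boolP (vblue v)) => bv; last first.
  rewrite (eq_card0 (A := _)) // => q; rewrite !inE.
  have [h [b' [k' ->]]] := dblD_ex q; rewrite src_dblD dblV_eq invariant_dblD.
  apply/negP => /andP[/andP[/eqP e _] /eblue_src]; by rewrite e (negPf bv).
rewrite (leq_trans _ (c3 v)) //.
rewrite -(card_in_imset (f := fun q : dart G => (val q).1)); last first.
  move=> q q'; have [h [s [l ->]]] := dblD_ex q; have [h' [s' [l' ->]]] := dblD_ex q'.
  rewrite !inE !invariant_dblD => /andP[_ bh] _ /= e.
  by apply/eqP; rewrite dblD_eq bh andbT; apply/eqP.
apply/subset_leq_card/subsetP => h /imsetP[q]; have [h' [s' [l' ->]]] := dblD_ex q.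
by rewrite !inE src_dblD dblV_eq invariant_dblD => /andP[/andP[sh _] bh] ->; rewrite /= sh.
Qed.

Lemma card_graph_of_tree_blue : (forall v, kept v /\ vblue v) -> #|vert G| = #|vert T|.
Proof.
move=> kb; rewrite -(card_imset (aT := vert G) _ (f := fun p : vert G => (val p).1)).
  rewrite -[RHS]cardsT; apply: eq_card => v; rewrite inE; apply/imsetP.
  by have [k _] := kb v; exists (dblV true k).
move=> p q; have [v [b [k ->]]] := dblV_ex p; have [w [b' [k' ->]]] := dblV_ex q.
by move=> /= e; apply/eqP; rewrite dblV_eq; case: (kb v) => _ ->; rewrite andbT; apply/eqP.
Qed.

Lemma segment_circle : exceptional_segment T -> exceptional_circle G.
Proof.
move=> seg; have /and3P[/eqP V2 /forallP lf /forallP yel] := seg.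
have kept_all v : kept v by rewrite /kept seg orbT.
split.
- rewrite card_graph_of_tree_blue // => v; split=> //; exact: leaf_blue.
- move=> p; have [v [b [k ->]]] := dblV_ex p; have /andP[_ /eqP dv] := lf v.
  have : 0 < degree v by rewrite dv.
  case/card_gt0P => h; rewrite inE => /eqP sh; subst v.
  rewrite (_ : 2 = #|[set dblD true k; dblD false k]|); last first.
    by rewrite cards2 dblD_eq (negPf (yel h)) eqxx.
  apply: eq_card => q; have [h' [b' [k' ->]]] := dblD_ex q.
  rewrite !inE src_dblD !dblV_eq !dblD_eq (leaf_blue (lf _)) (negPf (yel _)) andbT.
  case: (eqVneq h' h) => [->|ne] /=; first by rewrite eqxx; case: b'.
  by apply/eqP => e; move: ne; rewrite (leaf_dart_unique (lf _) e (erefl _)) eqxx.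
- move=> p; have [v [b [k ->]]] := dblV_ex p; have /andP[/eqP g0 _] := lf v.
  by rewrite igenus_dblV (leaf_blue (lf _)) g0; split=> //; apply/eqP; rewrite fixed_dblV leaf_blue.
- move=> q; have [h [b [k ->]]] := dblD_ex q.
  have nh : iD (dblD b k) != dblD b k by rewrite -/(invariant _) invariant_dblD.
  by have := anti_invariant_dblD b k; rewrite /anti_invariant nh andbT kept_all /= => ->.
Qed.

Lemma graph_of_tree_hyp : hyperelliptic G.
Proof.
have [_ c1 c2 c3] := T_by.
split=> //.
- by split; [exact: graph_of_tree_closed|exact: graph_of_tree_connected].
- move=> p; have [v [b [k ->]]] := dblV_ex p; rewrite igenus_dblV.
  by case: (boolP (vblue v)) => // bv _; apply/eqP; rewrite fixed_dblV.
- case: (boolP (exceptional_segment T)) => [/segment_circle|nseg]; first by right; right.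
  case: c2 => [c2|[V1 D0 bp]]; last first.
    right; left; have noD h : False by have := D0; rewrite (cardD1 h) inE.
    split.
    + rewrite card_graph_of_tree_blue // => v; have [bv g0] := bp v; split=> //.
      by rewrite /kept /genus0_leaf g0 /degree (eq_card0 (A := _)) // => h; case: (noD h).
    + by apply: eq_card0 => q; have [h _] := dblD_ex q; case: (noD h).
    + move=> p; have [v [b [k ->]]] := dblV_ex p; rewrite igenus_dblV.
      by case: (bp v) => _ ->; case: ifP.
  left=> p; have [v [b [k ->]]] := dblV_ex p; rewrite igenus_dblV.
  case: (boolP (vblue v)) => [bv g0|nb _]; last first.
    by have [_ dv _] := c1 v nb; apply: leq_trans dv (graph_of_tree_degree _ _).
  have [h [sh yh]] := c2 v bv g0; subst v.
  (* A kept blue vertex of genus 0 has a yellow edge [h], which lifts to two darts, and not being a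
     leaf it has another edge [h']: three darts in all. *)
  have [h' sh' ne] : exists2 h', src h' = src h & h' != h.
    case: (pickP (fun h' => (src h' == src h) && (h' != h))) => [h'|no].
      by case/andP=> /eqP; exists h'.
    have := k; rewrite /kept (negPf nseg) orbF /genus0_leaf g0 /= /degree => /negP[].
    apply/eqP; rewrite -(cards1 h); apply: eq_card => h'; rewrite !inE.
    by have := no h'; case: (h' =P h) => [->|_]; rewrite ?eqxx //= andbT.
  have k' : kept (src h') by rewrite sh'.
  have e3 : #|[set dblD true k'; dblD true k; dblD false k]| = 3.
    by rewrite -setUA cardsU1 cards2 !inE !dblD_eq (negPf ne) (negPf yh) !eqxx.
  rewrite -e3; apply/subset_leq_card/subsetP => q; rewrite !inE -orbA => /or3P[]/eqP->.
  + by rewrite src_dblD dblV_eq sh' eqxx bv.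
  + by rewrite src_dblD dblV_eq eqxx bv.
  + by rewrite src_dblD dblV_eq eqxx bv.
- exact: graph_of_tree_cond3.
- have [fV [fD [[bV bD] fP _ _ _]]] := by_iso_sym tree_of_graph_of_tree.
  exact: (@graph_iso_tree T (tree_of_graph G) fV fD (And3 bV bD fP) T_closed T_tree).
Qed.

(** The quotient of the double is [T] again, so the count made for quotients serves here too. *)
Lemma graph_of_tree_genus : hyp_genus G = by_genus T.
Proof.
have Gh := graph_of_tree_hyp.
rewrite -(tree_of_graph_genus Gh); apply: by_iso_genus tree_of_graph_of_tree => //.
exact: tree_of_graph_by.
Qed.

End GraphOfTree.

(** * Both constructions respect isomorphisms *)

Section Functoriality.

Lemma orb_map_bij (A B : finType) (f : A -> A) (g : B -> B) (fK : involutive f)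
  (gK : involutive g) (F : A -> B) : bijective F -> (forall x, g (F x) = F (f x)) ->
  bijective (fun a : orb f => to_orb gK (F (val a))).
Proof.
move=> bF FE; apply: inj_surj_bij => [a b /eqP|b].
  rewrite to_orb_eq FE !(bij_eq bF) -(to_orb_eq fK) !to_orbK => /eqP //.
have [F' _ FK] := bF; exists (to_orb fK (F' (val b))).
rewrite (val_to_orb_invariant fK (Q := fun x => to_orb gK (F x))) ?FK ?to_orbK //.
by move=> x; rewrite -FE to_orb_f.
Qed.

Lemma tree_of_graph_iso G G' : hyp_iso G G' -> by_iso (tree_of_graph G) (tree_of_graph G').
Proof.
case=> fV [fD [[bV bD] fP fg fi fj]].
have anti h : anti_invariant (fD h) = anti_invariant h.
  by rewrite /anti_invariant fj (fP _).2 !(bij_eq bD).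
pose gV (a : orb (@iV G)) := to_orb (@iVK G') (fV (val a)).
pose gD (a : orb (@iD G)) := to_orb (@iDK G') (fD (val a)).
have gDP (m : midpoint G) : anti_invariant (val (gD (val m))).
  by rewrite /gD anti_invariant_toD anti; exact: valP m.
pose gM (m : midpoint G) : midpoint G' := Sub (gD (val m)) (gDP m).
have gVE v : gV (to_orb (@iVK G) v) = to_orb (@iVK G') (fV v).
  apply: (val_to_orb_invariant (@iVK G) (Q := fun x => to_orb (@iVK G') (fV x))) => x.
  by rewrite -fi to_orb_f.
have gDE v : gD (to_orb (@iDK G) v) = to_orb (@iDK G') (fD v).
  apply: (val_to_orb_invariant (@iDK G) (Q := fun x => to_orb (@iDK G') (fD x))) => x.
  by rewrite -fj to_orb_f.
have bgV : bijective gV := orb_map_bij (@iVK G) (@iVK G') bV fi.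
have bgD : bijective gD := orb_map_bij (@iDK G) (@iDK G') bD fj.
have bgM : bijective gM.
  apply: inj_surj_bij => [m m' /(congr1 val)|m].
    by rewrite !SubK => /(bij_inj bgD)/val_inj.
  have [g _ gK] := bgD.
  have am : anti_invariant (val (g (val m))).
    rewrite -anti -(anti_invariant_toD (fD _)) -/(gD _) gK; exact: valP m.
  by exists (Sub (g (val m)) am); apply: val_inj; rewrite !SubK gK.
pose sumf A A' B B' (f : A -> A') (g : B -> B') (x : A + B) : A' + B' :=
  match x with inl a => inl (f a) | inr b => inr (g b) end.
have sumf_bij A A' B B' (f : A -> A') (g : B -> B') :
    bijective f -> bijective g -> bijective (sumf A A' B B' f g).
  case=> f' fK fK' [g' gK gK']; exists (sumf A' A B' B f' g') => -[] x /=;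
  by rewrite ?fK ?fK' ?gK ?gK'.
exists (sumf _ _ _ _ gV gM), (sumf _ _ _ _ gD gM).
have gVq v : sumf _ _ _ _ gV gM (qV v) = qV (fV v) by rewrite /= gVE.
have gDq v : sumf _ _ _ _ gD gM (qD v) = qD (fD v) by rewrite /= gDE.
split.
- by split; apply: sumf_bij.
- move=> h; case: (qD_ex h) => [[k ->]|[m [-> _]] //].
  rewrite gDq !src_qD (fP _).1 gVq; split=> //.
  case: (boolP (anti_invariant k)) => [ak|na].
    have [m em ->] := opp_qD_anti ak; have := ak; rewrite -anti => /opp_qD_anti[m' em' ->].
    congr inr; apply: val_inj; rewrite em' SubK em gDE //.
  by rewrite !opp_qD ?anti // gDq (fP _).2.
- move=> v; case: (qV_ex v) => [[w ->]|[m ->] //].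
  by rewrite gVq !genus_qV fi (bij_eq bV) fg.
- move=> v; case: (qV_ex v) => [[w ->]|[m ->] //].
  by rewrite gVq !vblue_qV fi (bij_eq bV).
- move=> h; case: (qD_ex h) => [[k ->]|[m [-> _]] //].
  by rewrite gDq !eblue_qD /invariant fj (bij_eq bD).
Qed.

Lemma graph_of_tree_iso T T' : by_iso T T' -> hyp_iso (graph_of_tree T) (graph_of_tree T').
Proof.
case=> fV [fD [[bV bD] fP fg fb fe]].
have dgE v : degree (fV v) = degree v.
  rewrite /degree -(card_imset _ (bij_inj bD)); apply: eq_card => h'.
  have [g _ gK] := bD; rewrite -[h']gK mem_imset ?inE; last exact: bij_inj.
  by rewrite (fP _).1 (bij_eq bV).
have lfE v : genus0_leaf (fV v) = genus0_leaf v by rewrite /genus0_leaf fg dgE.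
have segE : exceptional_segment T' = exceptional_segment T.
  rewrite /exceptional_segment (bij_eq_card bV); congr [&& _, _ & _].
    apply/forallP/forallP => H v; first by rewrite -lfE.
    by have [g _ gK] := bV; rewrite -[v]gK lfE.
  apply/forallP/forallP => H v; first by rewrite -fe.
  by have [g _ gK] := bD; rewrite -[v]gK fe.
have kE v : kept (fV v) = kept v by rewrite /kept lfE segE.
have PV (p : dbl_vert T) : kept (fV (val p).1) && (vblue (fV (val p).1) ==> (val p).2).
  by rewrite kE fb; exact: valP p.
have PD (p : dbl_dart T) : kept (src (fD (val p).1)) && (eblue (fD (val p).1) ==> (val p).2).
  by rewrite (fP _).1 kE fe; exact: valP p.
pose gV p : dbl_vert T' := Sub (fV (val p).1, (val p).2) (PV p).
pose gD p : dbl_dart T' := Sub (fD (val p).1, (val p).2) (PD p).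
exists gV, gD; split.
- split; apply: inj_surj_bij => [p q /(congr1 val) e|p].
  + have e1 : fV (val p).1 = fV (val q).1 := congr1 fst e.
    have e2 : (val p).2 = (val q).2 := congr1 snd e.
    apply: val_inj; rewrite [val p]surjective_pairing [val q]surjective_pairing e2.
    by rewrite (bij_inj bV e1).
  + have [g _ gK] := bV; case: p => -[v b] p.
    have p' : kept (g v) && (vblue (g v) ==> b) by rewrite -kE -fb gK.
    by exists (Sub (g v, b) p'); apply: val_inj; rewrite !SubK /= gK.
  + have e1 : fD (val p).1 = fD (val q).1 := congr1 fst e.
    have e2 : (val p).2 = (val q).2 := congr1 snd e.
    apply: val_inj; rewrite [val p]surjective_pairing [val q]surjective_pairing e2.
    by rewrite (bij_inj bD e1).
  + have [g _ gK] := bD; case: p => -[v b] p.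
    have p' : kept (src (g v)) && (eblue (g v) ==> b).
      by rewrite -kE -fe -(fP _).1 gK.
    by exists (Sub (g v, b) p'); apply: val_inj; rewrite !SubK /= gK.
- move=> p; split; apply: val_inj; rewrite !SubK /= ?(fP _).1 ?fb //.
  rewrite /dbl_opp_raw /= (fP _).2 (fP _).1 kE fe.
  by case: ifP.
- by move=> p; rewrite /= /dbl_genus !SubK /= fb fg.
- by move=> p; apply: val_inj; rewrite !SubK /= fb.
- by move=> p; apply: val_inj; rewrite !SubK /= fe.
Qed.

End Functoriality.
(** * Trees of cluster pictures *)

Section ClusterCombinatorics.
Variables (X : finType) (S : {set {set X}}) (PS : is_picture S).
Implicit Types s t u : {set X}.

(** The clusters strictly containing the non-empty [s] share a point, hence form a chain. So the
    maximality of [s] below [t] amounts to [t] being the least of them, and parents are unique. *)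
Lemma childP s t : reflect
  [/\ s \in S, t \in S, s \proper t & forall u, u \in S -> s \proper u -> t \subset u]
  (child S s t).
Proof.
apply: (iffP and4P) => -[sS tS st mx]; split=> //.
  move=> u uS su; case/or3P: (pic_nested PS tS uS) => // [/pred0P dj|ut].
    have /set0Pn[x xs] : s != set0 by apply: contraNneq (pic_set0 PS) => <-.
    by have := dj x; rewrite /= (subsetP (proper_sub st)) ?(subsetP (proper_sub su)).
  have /forall_inP/(_ u uS) := mx; rewrite su properE ut /= negbK //.
apply/forall_inP => u uS; apply/negP => /andP[su].
by rewrite properE mx // andbF.
Qed.

Lemma child_unique s t t' : child S s t -> child S s t' -> t = t'.
Proof.
move=> /childP[_ tS st mt] /childP[_ tS' st' mt'].
by apply/eqP; rewrite eqEsubset mt ?mt'.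
Qed.

Lemma card_cluster_gt0 s : s \in S -> 0 < #|s|.
Proof.
by move=> sS; rewrite card_gt0; apply: contraTneq sS => ->; exact: pic_set0 PS.
Qed.

(** The children cover [s], so a single child would be all of [s]. *)
Lemma children_gt1 s : s \in S -> 1 < #|s| -> 1 < #|children S s|.
Proof.
move=> sS s1; have /and3P[/eqP cov _ _] := children_partition PS sS s1.
rewrite ltnNge; apply/negP => /card_le1_eqP one.
have [x xs] : exists x, x \in s by apply/set0Pn; rewrite -card_gt0 ltnW.
move: (xs); rewrite -cov => /bigcupP[t tc xt].
have : s \subset t.
  rewrite -cov; apply/bigcupsP => u uc; by rewrite (one u t uc tc).
by move: tc; rewrite inE => /childP[_ _ /proper_subn/negPf->].
Qed.

Lemma card_children_sum s : s \in S -> 1 < #|s| -> #|s| = \sum_(t in children S s) #|t|.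
Proof. by move=> sS s1; rewrite (card_partition (children_partition PS sS s1)). Qed.

End ClusterCombinatorics.

Lemma card_setIdE (T : finType) (A : {set T}) (Q : pred T) :
  #|[set x in A | Q x]| = \sum_(x in A) Q x.
Proof.
rewrite -sum1_card big_mkcond [RHS]big_mkcond /=; apply: eq_bigr => x _.
by rewrite inE; case: (x \in A); case: (Q x).
Qed.

Section PictureTree.
Variable P : picture.
Local Notation X := (pts P).
Local Notation S := (clusters P).
Local Notation V := (ct_vert P).
Local Notation N := (ct_nonroot P).
Implicit Types (s : V) (t : N).

Lemma ct_vert_cluster s : val s \in S.
Proof. by case/andP: (valP s). Qed.

Lemma ct_vert_gt1 s : 1 < #|X| -> 1 < #|val s|.
Proof.
by move=> X1; case/andP: (valP s) => _ /orP[//|/andP[_ /eqP e]]; rewrite e in X1.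
Qed.

Lemma ct_parentP t s : (ct_parent t == s) = child S (val (val t)) (val s).
Proof.
apply/eqP/idP => [<-|c]; first exact: child_parent.
apply: val_inj; exact: (child_unique (picP P) (child_parent t) c).
Qed.

Lemma ct_parent_proper t : val (val t) \proper val (ct_parent t).
Proof. by case/(childP (picP P)): (child_parent t). Qed.

Lemma ct_nonroot_gt1 t : 1 < #|val (val t)|.
Proof.
apply: ct_vert_gt1; rewrite ltn_neqAle eq_sym (pic_card_gt0 (picP P)) andbT.
apply: contraNneq (valP t) => X1; apply/eqP/val_inj/eqP; rewrite eqEcard subsetT.
by rewrite cardsT X1 (card_cluster_gt0 (picP P)) // ct_vert_cluster.
Qed.

Lemma nonroot_of (u : {set X}) : u \in S -> 1 < #|u| -> u != setT ->
  exists t : N, val (val t) = u.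
Proof.
move=> uS u1 uT; have pu : proper_cluster S u by rewrite /proper_cluster uS u1.
have nr : (Sub u pu : V) != ct_root P by rewrite -val_eqE !SubK.
by exists (Sub (Sub u pu) nr); rewrite !SubK.
Qed.

Lemma proper_children_sum s (F : {set X} -> nat) :
  \sum_(u in children S (val s) | 1 < #|u|) F u = \sum_(t | ct_parent t == s) F (val (val t)).
Proof.
pose A := [set t : N | ct_parent t == s].
rewrite (eq_bigl (fun u => u \in [set val (val t) | t in A])) => [|u].
  rewrite big_imset => [|t t' _ _ /val_inj/val_inj //].
  by apply: eq_bigl => t; rewrite inE.
rewrite in_set; apply/andP/imsetP => [[c u1]|[t]].
  have [uS sS us _] := (childP (picP P) _ _ c).
  have [|t e] := nonroot_of uS u1.
    by apply: contraTneq us => ->; rewrite properE subsetT andbF.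
  by exists t; rewrite ?e // in_set ct_parentP e.
by rewrite in_set ct_parentP => ct ->; rewrite ct ct_nonroot_gt1.
Qed.

(** The g for which the size is 2g+1 or 2g+2, applied to every cluster; at the whole set it is
    [pic_genus]. *)
Definition half_size (u : {set X}) : nat := #|u|.-1./2.

Definition even_below s : nat := \sum_(t | ct_parent t == s) ~~ odd #|val (val t)|.
Definition odd_below s : nat := \sum_(t | ct_parent t == s) odd #|val (val t)|.

Lemma card_even_children s : #|[set u in children S (val s) | ~~ odd #|u|]| = even_below s.
Proof.
rewrite /even_below -(proper_children_sum s (fun u => ~~ odd #|u|)) card_setIdE.
rewrite [RHS]big_mkcondr /=; apply: eq_bigr => u; rewrite inE => /and3P[uS _ _].
have := card_cluster_gt0 (picP P) uS.
by case: #|u| => [|[|m]] //=; case: odd.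
Qed.

(** Only an inequality: singletons are odd children but give no vertex of the tree. *)
Lemma card_odd_children s : odd_below s <= #|odd_children S (val s)|.
Proof.
rewrite /odd_below -(proper_children_sum s (fun u => odd #|u|)) card_setIdE.
rewrite big_mkcondr /=; apply: leq_sum => u _.
by case: (1 < #|u|) => //; case: odd.
Qed.

Lemma card_children_split s :
  #|children S (val s)| = #|odd_children S (val s)| + even_below s.
Proof.
rewrite -card_even_children -(cardsID [set u : {set X} | odd #|u|]); congr (_ + _).
  by apply: eq_card => u; rewrite in_setI !in_set.
by apply: eq_card => u; rewrite in_setD !in_set andbC.
Qed.

(** A child of half size h has 2h+1 or 2h+2 points according to parity. A singleton has half size 0,
    so it enters only through the number of odd children. *)
Lemma card_cluster_split s : 1 < #|X| ->
  #|val s| = #|odd_children S (val s)| +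
    2 * \sum_(t | ct_parent t == s) (half_size (val (val t)) + ~~ odd #|val (val t)|).
Proof.
move=> /(ct_vert_gt1 s) s1.
rewrite (card_children_sum (picP P) (ct_vert_cluster s) s1).
rewrite -(proper_children_sum s (fun u => half_size u + ~~ odd #|u|)) big_mkcondr /=.
rewrite /odd_children card_setIdE big_distrr -big_split /=; apply: eq_bigr => u.
rewrite inE => /and3P[uS _ _]; have := card_cluster_gt0 (picP P) uS.
rewrite /half_size; case: (ltnP 1 #|u|); last by case: #|u| => [|[|]].
by move=> u1 _; lia.
Qed.

Lemma ubereven_ct s : 1 < #|X| -> ubereven S (val s) = (#|odd_children S (val s)| == 0).
Proof. by move=> X1; rewrite /ubereven cards_eq0 neq_ltn X1 orbT. Qed.

(** Half of [card_cluster_split]. With 2g+1 or 2g+2 odd children the half size is g plus the sum;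
    with none it is the sum minus one, and the [ubereven] term restores that one. *)
Lemma half_size_split s :
  half_size (val s) + ubereven S (val s) = cluster_genus S (val s) +
   \sum_(t | ct_parent t == s) (half_size (val (val t)) + ~~ odd #|val (val t)|).
Proof.
case: (ltnP 1 #|X|) => [X1|X1].
  have := card_cluster_split s X1; have := ct_vert_gt1 s X1.
  rewrite /cluster_genus ubereven_ct // /half_size; case: eqP => [->|]; lia.
have {}X1 : #|X| = 1 by apply/eqP; rewrite eqn_leq X1 (pic_card_gt0 (picP P)).
have noN t : False.
  by have := leq_trans (ct_nonroot_gt1 t) (max_card _); rewrite X1.
rewrite big1 ?addn0 => [|t]; last by case: (noN t).
have s1 : #|val s| <= 1 by rewrite -X1 max_card.
rewrite /half_size /cluster_genus /ubereven X1 /= (_ : odd_children S (val s) = set0).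
  by rewrite cards0; case: #|val s| s1 => [|[]].
apply/setP => u; rewrite !inE; apply/negP => /andP[/(childP (picP P))[uS _ us _] _].
have := card_cluster_gt0 (picP P) uS; have := proper_card us; lia.
Qed.

Definition ctree_src (h : N + N) : V :=
  match h with inl t => val t | inr t => ct_parent t end.

Definition ctree_opp (h : N + N) : N + N :=
  match h with inl t => inr t | inr t => inl t end.

Lemma ctree_oppK : involutive ctree_opp. Proof. by case. Qed.

Definition ctree_graph : graph := @Graph V (N + N)%type ctree_src ctree_opp ctree_oppK.

Definition ctree_eblue (h : dart ctree_graph) : bool :=
  match h with inl t => odd #|val (val t)| | inr t => odd #|val (val t)| end.

Lemma ctree_eblue_opp h : ctree_eblue (opp h) = ctree_eblue h.
Proof. by case: h. Qed.

Lemma ctree_eblue_src (h : dart ctree_graph) : ctree_eblue h -> ct_vblue (src h).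
Proof.
case: h => t; first exact: (@ct_eblue_src P (inl (val t))).
exact: (@ct_eblue_src P (inr t)).
Qed.

(* [tree_of_picture P] without its open edge. *)
Definition closed_tree : by_graph :=
  @BYGraph ctree_graph (@ct_genus P) (@ct_vblue P) ctree_eblue ctree_eblue_opp ctree_eblue_src.

Lemma card_dart_sum (A B : finType) (Q : pred (A + B)) :
  #|[set h | Q h]| = \sum_a Q (inl a) + \sum_b Q (inr b).
Proof.
rewrite -sum1_card big_mkcond big_sumType /=; congr (_ + _);
by apply: eq_bigr => x _; rewrite inE; case: (Q _).
Qed.

(** The first term is the dart towards the parent, which the root lacks; in [open_tree_darts] the
    open edge supplies it at the root as well. *)
Lemma closed_tree_darts s (R : pred {set X}) :
  #|[set h : dart closed_tree | (src h == s) &&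
     match h with inl t => R (val (val t)) | inr t => R (val (val t)) end]| =
  ((s != ct_root P) && R (val s)) + \sum_(t | ct_parent t == s) R (val (val t)).
Proof.
rewrite card_dart_sum /=; congr (_ + _); last first.
  by rewrite [RHS]big_mkcond; apply: eq_bigr => t _; case: eqP.
case: (boolP (s != ct_root P)) => ns /=; last first.
  rewrite big1 // => t _; case: eqP => // e; case/negP: ns.
  by rewrite -e; exact: valP t.
rewrite (bigD1 (Sub s ns : N)) //= eqxx big1 ?addn0 // => t ne.
by case: eqP => // e; case/eqP: ne; apply: val_inj.
Qed.

Lemma open_tree_darts s (R : pred {set X}) :
  #|[set h : dart (tree_of_picture P) | (src h == s) &&
     match h with inl t => R (val t) | inr t => R (val (val t)) end]| =
  R (val s) + \sum_(t | ct_parent t == s) R (val (val t)).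
Proof.
rewrite card_dart_sum /=; congr (_ + _); last first.
  by rewrite [RHS]big_mkcond; apply: eq_bigr => t _; case: eqP.
by rewrite (bigD1 s) //= eqxx big1 ?addn0 // => t /negPf->.
Qed.

(** Serves as depth function: it drops towards the root, though not by one at each step. *)
Definition codepth (s : V) : nat := #|X| - #|val s|.

Lemma codepth_parent t : codepth (ct_parent t) < codepth (val t).
Proof.
have := proper_card (ct_parent_proper t); have := max_card (val (ct_parent t)).
rewrite /codepth; lia.
Qed.

Lemma closed_tree_is_tree : is_tree closed_tree.
Proof.
apply: (@rooting_is_tree closed_tree (ct_root P) codepth) => [s ns|h k _ _].
  by exists (inl (Sub s ns : N)); split=> //; exact: (codepth_parent (Sub s ns : N)).
case: h => t; last by rewrite /= leqNgt codepth_parent.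
case: k => t'; last by rewrite /= [codepth (val t') <= _]leqNgt codepth_parent.
by move=> /= /val_inj->.
Qed.

Lemma tree_of_picture_opp (s : V) :
  (exists2 t : N, val t = s & opp (inl s : dart (tree_of_picture P)) = inr t) \/
  (s = ct_root P /\ opp (inl s : dart (tree_of_picture P)) = inl s).
Proof.
rewrite /=; case: insubP => [t _ <-|]; first by left; exists t.
by rewrite negbK => /eqP->; right.
Qed.

Lemma tree_of_picture_is_tree : is_tree (tree_of_picture P).
Proof.
apply: (@rooting_is_tree (tree_of_picture P) (ct_root P) codepth) => [s ns|h k nh nk].
  exists (inl s); split=> //; case: (tree_of_picture_opp s) => [[t <- ->]|[e _]].
    exact: codepth_parent.
  by rewrite e eqxx in ns.
case: h nh => s nh; last by rewrite /= leqNgt codepth_parent.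
case: k nk => s' nk; last by rewrite /= [codepth (val s') <= _]leqNgt codepth_parent.
by move=> /= ->.
Qed.

(* The pictures whose open tree has a core with the same vertices. *)
Definition reduced_picture : Prop := ~~ odd #|X| -> 2 < #|X| -> 2 < #|children S setT|.

Lemma ct_root_val : val (ct_root P) = setT. Proof. by []. Qed.

Lemma small_picture_point : #|X| <= 2 -> by_point closed_tree /\
  (#|X| = 1 -> open_by_point (tree_of_picture P)).
Proof.
move=> X2; have X0 := pic_card_gt0 (picP P).
have noN t : False.
  have := proper_card (ct_parent_proper t); have := max_card (val (ct_parent t)).
  by have := ct_nonroot_gt1 t; lia.
have allroot s : s = ct_root P.
  by apply/eqP/negPn/negP => ns; exact: (noN (Sub s ns : N)).
have V1 : #|V| = 1.
  by apply: (@eq_card1 _ (ct_root P)) => s; rewrite !inE (allroot s) eqxx.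
have N0 : #|N| = 0 by apply: eq_card0 => t; case: (noN t).
have vb s : ct_vblue s /\ ct_genus s = 0.
  rewrite /ct_vblue /ct_genus /cluster_genus.
  case: (ltnP 1 #|X|) => [X1|X1].
    have := card_cluster_split s X1; rewrite ubereven_ct // big1 => [|t _]; last by case: (noN t).
    rewrite muln0 addn0 => <-; have := ct_vert_gt1 s X1; have := max_card (val s).
    by case: #|val s| => [|[|[|m]]] //= /leq_trans /(_ X2).
  have {}X1 : #|X| = 1 by lia.
  have e : odd_children S (val s) = set0.
    apply/setP => u; rewrite !inE; apply/negP => /andP[/(childP (picP P))[uS _ us _] _].
    have := card_cluster_gt0 (picP P) uS; have := proper_card us; have := max_card (val s); lia.
  by rewrite /ubereven X1 /= e cards0.
split; first by split=> //=; rewrite card_sum N0.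
move=> X1; split=> //; first by rewrite /= card_sum N0 V1.
case=> [s|t]; last by case: (noN t).
case: (tree_of_picture_opp s) => [[t]|[-> ->]]; first by case: (noN t).
by rewrite [eblue _]/(odd #|setT : {set X}|) cardsT X1.
Qed.

Lemma odd_card_odd_children s : 1 < #|X| -> odd #|val s| = odd #|odd_children S (val s)|.
Proof. by move/(card_cluster_split s) ->; lia. Qed.

Lemma children_split_gt1 s : 1 < #|X| -> 1 < #|odd_children S (val s)| + even_below s.
Proof.
by move=> X1; rewrite -card_children_split (children_gt1 (picP P)) ?ct_vert_cluster ?ct_vert_gt1.
Qed.

Lemma by_tree_point (T : by_graph) : closed_graph T /\ is_tree T -> by_point T -> by_tree T.
Proof.
move=> Tt [V1 D0 bp]; have noD (h : dart T) : False by have := D0; rewrite (cardD1 h) inE.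
split=> //; last by move=> v; rewrite (eq_card0 (A := _)) // => h; case: (noD h).
- by move=> v; case: (bp v) => ->.
- by right.
Qed.

(** Without its open edge the root may lose a yellow edge, and this is where [reduced_picture]
    enters: with |X| even and at least three children, a yellow root keeps degree 3 and a blue root
    of genus 0, having at most two odd children, keeps an even child. If |X| is odd, the root is
    blue and only a blue edge is lost. *)
Lemma closed_tree_by : reduced_picture -> by_tree closed_tree.
Proof.
move=> red; have Tt : closed_graph closed_tree /\ is_tree closed_tree.
  by split; [case|exact: closed_tree_is_tree].
case: (leqP #|X| 2) => [/small_picture_point[bp _]|X2]; first exact: by_tree_point.
have X1 : 1 < #|X| by exact: ltnW.
have redr : ~~ odd #|X| -> 2 < #|odd_children S setT| + even_below (ct_root P).
  by move=> ev; rewrite -(card_children_split (ct_root P)) red.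
split=> //.
- move=> s; rewrite negbK => us; split.
  + by rewrite /= /ct_genus /cluster_genus us.
  + have := closed_tree_darts s (fun u => ~~ odd #|u|).
    move=> e; apply: (@leq_trans #|[set h : dart closed_tree | (src h == s) &&
      match h with inl t => ~~ odd #|val (val t)| | inr t => ~~ odd #|val (val t)| end]|); last first.
      by apply/subset_leq_card/subsetP => h; rewrite !inE => /andP[].
    rewrite e -/(even_below s); have := children_split_gt1 s X1.
    move: us; rewrite ubereven_ct // => /eqP n0; rewrite n0.
    rewrite odd_card_odd_children // n0 andbT.
    case: (eqVneq s (ct_root P)) => [es|_] /=; last by rewrite add1n.
    move=> _; rewrite es in n0; have := redr; rewrite -ct_root_val n0 es; apply.
    by rewrite -cardsT -ct_root_val odd_card_odd_children // n0.
  + by move=> h sh; apply/negP => /eblue_src; rewrite sh /= /ct_vblue us.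
- left=> s bs g0; have nc := children_split_gt1 s X1.
  move: bs g0; rewrite /= /ct_vblue /ct_genus /cluster_genus.
  move=> us; rewrite (negPf us); rewrite ubereven_ct // -lt0n in us; move=> g0.
  have ex t : ct_parent t = s -> ~~ odd #|val (val t)| ->
      exists h : dart closed_tree, src h = s /\ ~~ eblue h by exists (inr t).
  have ev : 0 < even_below s -> exists h : dart closed_tree, src h = s /\ ~~ eblue h.
    rewrite lt0n sum_nat_eq0 negb_forall => /existsP[t]; rewrite negb_imply.
    by case/andP=> /eqP/ex; case: odd => // /(_ isT).
  case: (posnP (even_below s)) => [e0|//].
  case: (eqVneq s (ct_root P)) => [es|ns].
    rewrite es in e0 nc g0 us; have := redr; rewrite -ct_root_val e0.
    rewrite -cardsT -ct_root_val odd_card_odd_children //.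
    by move: g0 us nc; rewrite e0 ct_root_val; lia.
  (* Genus 0 without even children means exactly two odd children; the cluster is then even and the
     edge to its parent is yellow. *)
  exists (inl (Sub s ns : N)); split=> //=; rewrite odd_card_odd_children //; lia.
- move=> s.
  have -> : #|[set h : dart closed_tree | (src h == s) && eblue h]| =
      ((s != ct_root P) && odd #|val s|) + odd_below s.
    by rewrite -(closed_tree_darts s (fun u => odd #|u|)); apply: eq_card => -[] h; rewrite !in_set.
  rewrite [genus s]/(ct_genus s) /ct_genus /cluster_genus ubereven_ct //.
  have := card_odd_children s; rewrite odd_card_odd_children //.
  by case: (s != _) => /=; case: eqP => [->|]; lia.
Qed.

(** The counts of [closed_tree_by], with the open edge standing in for an edge to a parent, so that
    the root behaves like every other vertex. *)
Lemma tree_of_picture_open_by : open_by_tree (tree_of_picture P).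
Proof.
split.
- split; last exact: tree_of_picture_is_tree.
  exists (inl (ct_root P)); split.
    by case: (tree_of_picture_opp (ct_root P)) => [[t e]|[_ //]]; have := valP t; rewrite e eqxx.
  case=> [s|t //]; case: (tree_of_picture_opp s) => [[t _ -> //]|[-> //]].
- move=> s; rewrite negbK => us; split.
  + by rewrite /= /ct_genus /cluster_genus us.
  + have e := open_tree_darts s (fun u => ~~ odd #|u|).
    apply: (@leq_trans #|[set h : dart (tree_of_picture P) | (src h == s) &&
      match h with inl t => ~~ odd #|val t| | inr t => ~~ odd #|val (val t)| end]|); last first.
      by apply/subset_leq_card/subsetP => h; rewrite !inE => /andP[].
    have X1 : 1 < #|X|.
      by rewrite ltn_neqAle eq_sym (pic_card_gt0 (picP P)) andbT; case/andP: us.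
    rewrite e -/(even_below s); have := children_split_gt1 s X1.
    by move: us; rewrite ubereven_ct // => /eqP n0; rewrite n0 odd_card_odd_children // n0.
  + by move=> h sh; apply/negP => /eblue_src; rewrite sh /= /ct_vblue us.
- case: (ltnP 1 #|X|) => [X1|X1]; last first.
    have {}X1 : #|X| = 1 by apply/eqP; rewrite eqn_leq X1 (pic_card_gt0 (picP P)).
    by right; apply: (small_picture_point _).2; rewrite X1.
  left=> s bs g0; have nc := children_split_gt1 s X1.
  move: bs g0; rewrite /= /ct_vblue /ct_genus /cluster_genus.
  move=> us; rewrite (negPf us); rewrite ubereven_ct // -lt0n in us; move=> g0.
  case: (posnP (even_below s)) => [e0|].
    exists (inl s); split=> //=; rewrite odd_card_odd_children //; lia.
  rewrite lt0n sum_nat_eq0 negb_forall => /existsP[t]; rewrite negb_imply.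
  by case/andP=> /eqP e o; exists (inr t); split=> //=; case: odd o.
- move=> s.
  have -> : #|[set h : dart (tree_of_picture P) | (src h == s) && eblue h]| =
      odd #|val s| + odd_below s.
    by rewrite -(open_tree_darts s (fun u => odd #|u|)); apply: eq_card => -[] h; rewrite !in_set.
  rewrite [genus s]/(ct_genus s).
  case: (ltnP 1 #|X|) => [X1|X1]; last first.
    have {}X1 : #|X| = 1 by apply/eqP; rewrite eqn_leq X1 (pic_card_gt0 (picP P)).
    rewrite /odd_below big1 ?addn0 => [|t]; first by case: odd; lia.
    by have := leq_trans (ct_nonroot_gt1 t) (max_card _); rewrite X1.
  rewrite /ct_genus /cluster_genus ubereven_ct //.
  have := card_odd_children s; rewrite odd_card_odd_children //.
  by case: eqP => [->|]; lia.
Qed.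

End PictureTree.
(** * Genus and realisations *)

Section PictureGenus.
Variable P : picture.
Local Notation X := (pts P).
Local Notation S := (clusters P).
Local Notation V := (ct_vert P).
Local Notation N := (ct_nonroot P).

Lemma sum_nonroot (F : V -> nat) : \sum_s F s = F (ct_root P) + \sum_(t : N) F (val t).
Proof.
rewrite (bigD1 (ct_root P)) //=; congr (_ + _).
exact: (big_sub (fun s => s != ct_root P) F).
Qed.

(** Summing [half_size_split] over all clusters, the half size of each cluster other than X occurs
    once on either side, so only that of X survives. *)
Lemma picture_genus_count :
  pic_genus P + #|[set s : V | ~~ ct_vblue s]| =
  \sum_(s : V) ct_genus s + \sum_(t : N) ~~ odd #|val (val t)|.
Proof.
have tele : \sum_(s : V) (half_size (val s) + ubereven S (val s)) = \sum_(s : V) (ct_genus s +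
   \sum_(t | ct_parent t == s) (half_size (val (val t)) + ~~ odd #|val (val t)|)).
  by apply: eq_bigr => s _; exact: half_size_split.
have ex (F : N -> nat) : \sum_(s : V) \sum_(t | ct_parent t == s) F t = \sum_t F t.
  by rewrite [RHS](partition_big (@ct_parent P) xpredT).
move: tele; rewrite !big_split /= ex.
rewrite sum_nonroot big_split /= [half_size setT](_ : _ = pic_genus P); last first.
  by rewrite /half_size cardsT.
have -> : \sum_(s : V) ubereven S (val s) = #|[set s : V | ~~ ct_vblue s]|.
  by rewrite -sum1_card [RHS]big_mkcond; apply: eq_bigr => s _; rewrite inE negbK; case: ubereven.
rewrite addnAC [X in _ = X -> _]addnCA [X in _ = X -> _]addnC; exact: addIn.
Qed.

(** An [ubereven] cluster has even children, which are smaller vertices; so a vertex of minimal size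
    is blue. *)
Lemma ct_blue_exists : exists s : V, ct_vblue s.
Proof.
have [s _ smin] := @arg_minnP _ (ct_root P) xpredT (fun s : V => #|val s|) isT.
exists s; apply/negP => us; have X1 : 1 < #|X|.
  by rewrite ltn_neqAle eq_sym (pic_card_gt0 (picP P)) andbT; case/andP: us.
have := children_split_gt1 s X1; move: us; rewrite ubereven_ct // => /eqP->.
rewrite add0n ltnNge => /negP[]; rewrite /even_below big1 // => t /eqP e.
have := smin (val t) isT; have := proper_card (ct_parent_proper t); rewrite e.
by rewrite ltnNge => /negP.
Qed.

Lemma closed_tree_genus : by_genus (closed_tree P) = pic_genus P.
Proof.
have := @by_genus_formula (closed_tree P) (closed_tree_is_tree P) ct_blue_exists.
have := picture_genus_count.
have -> : #|[set h : dart (closed_tree P) | (opp h != h) && ~~ eblue h]| =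
    2 * \sum_(t : N) ~~ odd #|val (val t)|.
  by rewrite card_dart_sum mul2n -addnn; congr (_ + _); apply: eq_bigr.
rewrite [\sum_v genus v](_ : _ = \sum_(s : V) ct_genus s) //.
rewrite [#|[set v : vert _ | _]|](_ : _ = #|[set s : V | ~~ ct_vblue s]|) //.
lia.
Qed.

Lemma tree_of_picture_genus : by_genus (tree_of_picture P) = pic_genus P.
Proof.
have := @by_genus_formula (tree_of_picture P) (tree_of_picture_is_tree P) ct_blue_exists.
have := picture_genus_count.
have -> : #|[set h : dart (tree_of_picture P) | (opp h != h) && ~~ eblue h]| =
    2 * \sum_(t : N) ~~ odd #|val (val t)|.
  rewrite card_dart_sum mul2n -addnn; congr (_ + _).
  rewrite sum_nonroot; case: (tree_of_picture_opp (ct_root P)) => [[t e]|[_ ->]].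
    by have := valP t; rewrite e eqxx.
  rewrite eqxx add0n; apply: eq_bigr => t _.
  by case: (tree_of_picture_opp (val t)) => [[t' _ -> //]|[e]]; have := valP t; rewrite e eqxx.
rewrite [\sum_v genus v](_ : _ = \sum_(s : V) ct_genus s) //.
rewrite [#|[set v : vert _ | _]|](_ : _ = #|[set s : V | ~~ ct_vblue s]|) //.
lia.
Qed.

End PictureGenus.

Section Realisations.
Variable T : by_graph.

(** The content of [realises] with both maps kept visible, because the uniqueness statement compares
    them. *)
Definition realisation (A : part T) (T' : by_graph) (fV : vert T' -> vert T)
    (fD : dart T' -> dart T) : Prop :=
  [/\ injective fV /\
        forall v, (v \in codom fV) = (v \in A.1) && ~~ smoothed A v,
      injective fD /\
        forall h, (h \in codom fD) = (h \in A.2) && ~~ smoothed A (src h),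
      forall h, src (fD h) = fV (src h) /\ eblue (fD h) = eblue h,
      forall v, genus (fV v) = genus v /\ vblue (fV v) = vblue v &
      forall h, exists p : seq (dart T),
        path (next_smoothed A) (fD h) p /\
        opp (last (fD h) p) = fD (opp h)].

(** A smoothed vertex has two darts in the part, and one of them reverses the arrival, so the next
    dart is forced; the walk can stop only at a vertex that is not smoothed. *)
Lemma smoothed_walk_unique (A : part T) x p q : closed_part A -> x \in A.2 ->
  path (next_smoothed A) x p -> path (next_smoothed A) x q ->
  ~~ smoothed A (src (opp (last x p))) -> ~~ smoothed A (src (opp (last x q))) ->
  p = q.
Proof.
move=> cA; have stuck y k r : path (next_smoothed A) y (k :: r) ->
    ~~ smoothed A (src (opp y)) -> False.
  by case/andP=> /and3P[_ sk /and3P[_ /eqP <- _]] _; rewrite sk.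
elim: p q x => [|k p IHp] [|k' q] x xA //=.
- by move=> _ pq ns; case: (stuck _ _ _ pq).
- by move=> pp _ _ ns; case: (stuck _ _ _ pp).
case/andP=> /and3P[kA sk /and3P[nx /eqP ek nk]] pp.
case/andP=> /and3P[kA' _ /and3P[_ /eqP ek' nk']] pq np nq.
suff e : k = k' by rewrite -e in pq nq *; congr cons; apply: IHp pp pq np nq.
case/and4P: sk => _ _ /eqP c2 _.
have : [set opp x; k] = [set h in A.2 | src h == src k].
  apply/eqP; rewrite eqEcard c2 cards2 eq_sym nk andbT.
  have [_ oA _] := cA _ xA.
  by apply/subsetP => y; rewrite !inE => /orP[]/eqP->; rewrite ?oA ?kA ?ek eqxx.
move/setP/(_ k'); rewrite !inE kA' ek' ek eqxx (negPf nk') /= => /eqP//.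
Qed.

(** Both models are identified with the same vertices and darts of [T], and [opp] is given by the
    forced walk. That [fV] commutes with the embeddings is what later locates the new root. *)
Lemma realisation_unique (A : part T) T1 T2 f1 g1 f2 g2 : closed_part A ->
  @realisation A T1 f1 g1 -> @realisation A T2 f2 g2 ->
  exists2 fV, @iso_map T1 T2 fV & forall v, f2 (fV v) = f1 v.
Proof.
move=> cA [[iV1 cV1] [iD1 cD1] s1 v1 p1] [[iV2 cV2] [iD2 cD2] s2 v2 p2].
have c12 v : f1 v \in codom f2 by rewrite cV2 -cV1 codom_f.
have c21 v : f2 v \in codom f1 by rewrite cV1 -cV2 codom_f.
have d12 h : g1 h \in codom g2 by rewrite cD2 -cD1 codom_f.
have d21 h : g2 h \in codom g1 by rewrite cD1 -cD2 codom_f.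
pose fV v := iinv (c12 v); pose fD h := iinv (d12 h).
have fVE v : f2 (fV v) = f1 v by exact: f_iinv.
have fDE h : g2 (fD h) = g1 h by exact: f_iinv.
exists fV => //; exists fD; split.
- split; apply: inj_surj_bij => [x y e|y].
  + by apply: iV1; rewrite -!fVE e.
  + by exists (iinv (c21 y)); apply: iV2; rewrite fVE f_iinv.
  + by apply: iD1; rewrite -!fDE e.
  + by exists (iinv (d21 y)); apply: iD2; rewrite fDE f_iinv.
- move=> h; split; first by apply: iV2; rewrite -(s2 _).1 fDE (s1 _).1 fVE.
  apply: iD2; rewrite fDE.
  have [p [pp lp]] := p1 h; have [q [pq lq]] := p2 (fD h).
  have nsm1 k : (g1 k \in A.2) && ~~ smoothed A (src (g1 k)) by rewrite -cD1 codom_f.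
  have nsm2 k : (g2 k \in A.2) && ~~ smoothed A (src (g2 k)) by rewrite -cD2 codom_f.
  rewrite -lq -lp fDE; rewrite fDE in pq lq; congr (opp (last _ _)).
  apply: (smoothed_walk_unique cA _ pq pp).
  + by case/andP: (nsm1 h).
  + by rewrite lq; case/andP: (nsm2 (opp (fD h))).
  + by rewrite lp; case/andP: (nsm1 (opp h)).
- by move=> v; rewrite -(v2 _).1 fVE (v1 _).1.
- by move=> v; rewrite -(v2 _).2 fVE (v1 _).2.
- by move=> h; rewrite -(s2 _).2 fDE (s1 _).2.
Qed.

Lemma by_tree_not_smoothed (T' : by_graph) (v : vert T') : by_tree T' ->
  genus v = 0 -> degree v = 2 -> (forall h, src h = v -> eblue h = vblue v) -> False.
Proof.
case=> _ c1 c2 _ g0 d2 ev; case: (boolP (vblue v)) => bv; last first.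
  by have [_] := c1 v bv; rewrite d2.
case: c2 => [c2|[_ D0 _]]; first by have [h [/ev -> ]] := c2 v bv g0; rewrite bv.
by have := max_card [set h : dart T' | src h == v]; rewrite -/(degree v) d2 D0.
Qed.

(** It suffices to show that the missed vertices are smoothed. A vertex in the image keeps its
    genus, its colour and its edges, and [by_tree_not_smoothed] forbids it to be smoothed. *)
Lemma realisation_intro (A : part T) (T' : by_graph) fV fD : by_tree T' ->
  injective fV -> injective fD ->
  (forall h, src (fD h) = fV (src h) /\ eblue (fD h) = eblue h) ->
  (forall v, genus (fV v) = genus v /\ vblue (fV v) = vblue v) ->
  (forall v, fV v \in A.1) -> (forall h, fD h \in A.2) ->
  (forall v, v \in A.1 -> v \notin codom fV -> smoothed A v) ->
  (forall h, h \in A.2 -> src h \in codom fV -> h \in codom fD) ->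
  (forall h, exists p : seq (dart T),
        path (next_smoothed A) (fD h) p /\ opp (last (fD h) p) = fD (opp h)) ->
  closed_part A -> @realisation A T' fV fD.
Proof.
move=> Tt iV iD sE vE AV AD sm AsD pE cA.
have nsm v : ~~ smoothed A (fV v).
  apply/negP => /and4P[_ /eqP g0 /eqP d2 /forall_inP ev].
  apply: (@by_tree_not_smoothed T' v Tt).
  - by rewrite -(vE v).1.
  - rewrite /degree -(card_imset _ iD) -d2; apply: eq_card => h.
    rewrite [RHS]inE; apply/imsetP/andP => [[k]|[hA /eqP sh]].
      by rewrite inE => /eqP <- ->; rewrite AD (sE _).1.
    have /AsD : h \in A.2 by []; rewrite sh codom_f => /(_ isT) /codomP[k ek].
    by exists k => //; rewrite inE -(inj_eq iV) -(sE _).1 -ek sh.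
  - move=> h sh; rewrite -(sE h).2 -(vE v).2.
    by apply/eqP; have /implyP := ev _ (AD h); apply; rewrite (sE _).1 sh.
split=> //; split=> //.
- move=> v; apply/idP/andP => [/codomP[w ->]|[vA nv]]; first by rewrite AV nsm.
  by apply: contraNT nv; exact: sm.
- move=> h; apply/idP/andP => [/codomP[k ->]|[hA ns]].
    by rewrite AD (sE _).1 nsm.
  apply: AsD => //; apply: contraNT ns; apply: sm.
  by case: (cA h hA).
Qed.

Lemma core_intro (A : part T) (T' : by_graph) : by_subtree A T' ->
  (forall B T'', by_subtree B T'' -> part_le B A) -> is_core T T'.
Proof.
move=> sA mx; have anti B : part_le A B -> part_le B A -> B = A.
  case: A B {sA mx} => A1 A2 [B1 B2] /andP[/= a1 a2] /andP[/= b1 b2].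
  by congr pair; apply/eqP; rewrite eqEsubset ?a1 ?a2 ?b1 ?b2.
have mA : maximal_by_subtree A.
  by split=> [|B T'' sB lB]; [exists T'|apply: anti => //; exact: mx sB].
exists A; split=> // B [[T'' sB] mB]; apply/esym; apply: (mB _ T') => //.
exact: mx sB.
Qed.

Lemma core_unique T1 T2 : is_core T T1 -> is_core T T2 -> by_iso T1 T2.
Proof.
case=> A [[cA [f1 [g1 r1]] _ _] mA uA] [B [[cB [f2 [g2 r2]] _ _] mB _]].
have e := uA B mB; rewrite e in r2.
by have [fV iso _] := realisation_unique cA r1 r2; exists fV.
Qed.

End Realisations.
(** * Cores of trees of cluster pictures *)

Section ReducedCore.
Variable P : picture.
Local Notation T := (tree_of_picture P).

Lemma opp_inl_nonroot (t : ct_nonroot P) : opp (inl (val t) : dart T) = inr t.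
Proof. by rewrite /= valK. Qed.

Lemma opp_inl_root : opp (inl (ct_root P) : dart T) = inl (ct_root P).
Proof.
by case: (tree_of_picture_opp (ct_root P)) => [[t e]|[_ //]]; have := valP t; rewrite e eqxx.
Qed.

Lemma opp_closed_inl (t : ct_nonroot P) : opp (inl t : dart (closed_tree P)) = inr t.
Proof. by []. Qed.

Lemma opp_closed_inr (t : ct_nonroot P) : opp (inr t : dart (closed_tree P)) = inl t.
Proof. by []. Qed.

Definition open_dart_part : part T := (setT, [set h | opp h != h]).

(** No closed part contains the open edge, so the part omitting just that edge is the greatest one,
    and it is already a BY tree with nothing to smooth. *)
Lemma reduced_core : reduced_picture P -> is_core T (closed_tree P).
Proof.
move=> red; have Tt := closed_tree_by red.
pose fD (h : dart (closed_tree P)) : dart T :=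
  match h with inl t => inl (val t) | inr t => inr t end.
have cA : closed_part open_dart_part.
  by move=> h; rewrite !inE oppK => nh; split=> //; rewrite eq_sym.
have fDop h : opp (fD h) = fD (opp h) by case: h => t //; exact: opp_inl_nonroot.
apply: (@core_intro _ open_dart_part); last first.
  move=> B T'' [cB _ _ _]; apply/andP; split; first exact: subsetT.
  by apply/subsetP => h /cB[_ _]; rewrite inE.
split=> //; last first.
  by move/by_point_genus; rewrite closed_tree_genus tree_of_picture_genus.
exists id, fD; apply: realisation_intro => //.
- by move=> [] t [] t' //= [] // => [/val_inj-> | ->].
- by case.
- by move=> h; rewrite !inE fDop; case: h => t.
- by move=> v _ /negP[]; apply/codomP; exists v.
- move=> h; rewrite inE => nh _; apply/codomP.
  case: h nh => [s|t] nh; last by exists (inr t).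
  case: (tree_of_picture_opp s) => [[t <- _]|[_ e]]; first by exists (inl t).
  by rewrite e eqxx in nh.
- by move=> h; exists [::]; rewrite fDop.
Qed.

End ReducedCore.

(** * Pictures of even size in which X has exactly two children *)

Section DegenerateCore.
Variables (X : finType) (S S' : {set {set X}}) (PS : is_picture S) (PS' : is_picture S').
Variable s : {set X}.
Hypotheses (X_even : ~~ odd #|X|) (X_gt2 : 2 < #|X|) (two_children : #|children S setT| = 2)
  (s_child : child S s setT) (s_gt1 : 1 < #|s|) (S'E : S' = S :\ s).
Local Notation P := (Picture PS).
Local Notation P' := (Picture PS').
Local Notation T := (tree_of_picture P).
Implicit Types u : {set X}.

Let X_gt1 : 1 < #|X|. Proof. exact: ltnW. Qed.

Lemma sibling_children : children S setT = [set s; ~: s].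
Proof.
have [c cc ns] : exists2 c, c \in children S setT & c != s.
  have : 0 < #|children S setT :\ s|.
    by have := cardsD1 s (children S setT); rewrite two_children inE s_child; case: #|_|.
  by case/card_gt0P => c; rewrite in_setD1 => /andP[ns cc]; exists c.
have T1 : 1 < #|[set: X]| by rewrite cardsT.
have /and3P[/eqP cov /trivIsetP tri _] := children_partition PS (pic_setT PS) T1.
have e2 : [set s; c] = children S setT.
  apply/eqP; rewrite eqEcard two_children cards2 eq_sym ns andbT.
  by apply/subsetP => x; rewrite in_set2 => /orP[]/eqP-> //; rewrite inE.
rewrite -e2; congr [set s; _]; apply/eqP; rewrite eqEsubset; apply/andP; split.
  by rewrite -disjoints_subset tri // inE.
apply/subsetP => x; rewrite inE => nxs.
have : x \in cover (children S setT) by rewrite cov inE.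
by rewrite -e2 => /bigcupP[y]; rewrite in_set2 => /orP[]/eqP-> //; rewrite (negPf nxs).
Qed.

Lemma sibling_child : child S (~: s) setT.
Proof. by have := set22 s (~: s); rewrite -sibling_children inE. Qed.

Lemma child_top u : child S u setT -> u = s \/ u = ~: s.
Proof.
move=> cu; have : u \in children S setT by rewrite inE.
by rewrite sibling_children in_set2 => /orP[]/eqP; [left|right].
Qed.

Lemma odd_sibling : odd #|~: s| = odd #|s|.
Proof. have := cardsC s; have := X_even; lia. Qed.

Lemma sibling_neq : ~: s != s.
Proof.
apply/eqP => e; have /card_gt0P[x xs] : 0 < #|s| by exact: ltnW.
by move: (xs); rewrite -e inE xs.
Qed.

Lemma mem_removed u : (u \in S') = (u != s) && (u \in S).
Proof. by rewrite S'E in_setD1. Qed.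

Lemma removed_neqT : s != setT.
Proof. by case/(childP PS): s_child => _ _; rewrite properEneq => /andP[]. Qed.

(** Deleting [s] hands its children over to the whole set, beside the sibling; all other parent
    relations persist. *)
Lemma child_removed u v : child S' u v =
  (u != s) && (if v == setT then (u == ~: s) || child S u s else child S u v && (v != s)).
Proof.
have [sS TS sT sm] := childP PS _ _ s_child.
have [cS _ cT cm] := childP PS _ _ sibling_child.
apply/(childP PS')/andP => [[]|[nu]].
  rewrite !mem_removed => /andP[nu uS] /andP[nv vS] uv um; split=> //.
  case: eqP => [vT|/eqP vT].
    have [|p up] := parent_exists PS uS; first by rewrite -vT; case/properP: uv => _ [x xv nx]; apply: contraNneq nx => ->.
    have [_ pS upp _] := childP PS _ _ up.
    case: (eqVneq p s) => [<-|np]; first by rewrite up orbT.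
    have pT : p = setT by apply/eqP; rewrite -subTset -vT um // mem_removed np.
    rewrite pT in up; case: (child_top up) => [e|->]; last by rewrite eqxx.
    by rewrite e eqxx in nu.
  rewrite nv andbT; apply/(childP PS); split=> // w wS uw.
  case: (eqVneq w s) => [ws|nw]; last by rewrite um // mem_removed nw.
  rewrite ws in uw *; case/or3P: (pic_nested PS vS sS) => // [/pred0P dj|sv].
    have /card_gt0P[x xu] := card_cluster_gt0 PS uS.
    by have := dj x; rewrite /= (subsetP (proper_sub uv)) ?(subsetP (proper_sub uw)).
  have : setT \subset v by apply: sm => //; rewrite properEneq sv eq_sym nv.
  by rewrite subTset (negPf vT).
rewrite !mem_removed nu; case: eqP => [->|/eqP vT].
  rewrite TS [_ == s]eq_sym removed_neqT => /orP[/eqP ->|/(childP PS)[uS _ us um]].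
    by split=> // w; rewrite mem_removed => /andP[_ wS]; exact: cm.
  split=> //; first by rewrite properE subsetT; apply: contraTN us => /(subset_trans (subsetT s)); rewrite properE => ->; rewrite andbF.
  move=> w; rewrite mem_removed => /andP[nw wS] uw; apply: sm => //.
  by rewrite properEneq eq_sym nw um.
case/andP=> /(childP PS)[uS vS uv um] nv; rewrite nv uS vS; split=> //.
by move=> w; rewrite mem_removed => /andP[_]; exact: um.
Qed.

Lemma new_root_vert_subproof (v : ct_vert P') :
  proper_cluster S (if val v == setT then s else val v).
Proof.
have [sS _ _ _] := childP PS _ _ s_child.
case: eqP => _; first by rewrite /proper_cluster sS s_gt1.
have := ct_vert_cluster v; rewrite mem_removed => /andP[_ vS].
by rewrite /proper_cluster vS (ct_vert_gt1 v).
Qed.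

(* The root of the tree of [P'] plays the role of the removed child [s]. *)
Definition removedV (v : ct_vert P') : ct_vert P :=
  Sub (if val v == setT then s else val v) (new_root_vert_subproof v).

Lemma val_removedV v : val (removedV v) = if val v == setT then s else val v.
Proof. by rewrite SubK. Qed.

Lemma removedV_nonroot v : removedV v != ct_root P.
Proof.
rewrite -val_eqE val_removedV ct_root_val.
by case: (eqVneq (val v) setT) => // _; exact: removed_neqT.
Qed.

Definition removedN (v : ct_vert P') : ct_nonroot P := Sub (removedV v) (removedV_nonroot v).

Lemma val_removedN v : val (removedN v) = removedV v.
Proof. by rewrite SubK. Qed.

Lemma vert_neq_removed (v : ct_vert P') : val v != s.
Proof. by have := ct_vert_cluster v; rewrite mem_removed => /andP[]. Qed.

Lemma removedV_inj : injective removedV.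
Proof.
move=> v w /(congr1 val); rewrite !val_removedV.
case: eqP => [ev|_]; case: eqP => [ew|_] e; apply: val_inj => //.
- by rewrite /= ev ew.
- by have := vert_neq_removed w; rewrite -e eqxx.
- by have := vert_neq_removed v; rewrite e eqxx.
Qed.

Lemma removedV_root : val (removedV (ct_root P')) = s.
Proof. by rewrite val_removedV ct_root_val eqxx. Qed.

Lemma removedV_codom (v : ct_vert P) : (v \in codom removedV) = (v != ct_root P).
Proof.
apply/codomP/idP => [[w ->]|nv]; first exact: removedV_nonroot.
case: (eqVneq (val v) s) => [vs|ns].
  by exists (ct_root P'); apply: val_inj; rewrite removedV_root.
have pv : proper_cluster S' (val v).
  have vS : val v \in S := ct_vert_cluster v.
  by rewrite /proper_cluster mem_removed ns vS (ct_vert_gt1 v).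
exists (Sub (val v) pv); apply: val_inj; rewrite val_removedV SubK.
by rewrite -[setT]/(val (ct_root P)) val_eqE (negPf nv).
Qed.

Lemma nonroot_neqT (Q : picture) (t : ct_nonroot Q) : val (val t) != setT.
Proof. by rewrite -[setT]/(val (ct_root Q)) val_eqE; exact: valP t. Qed.

Lemma val_removedN_nonroot (t : ct_nonroot P') : val (val (removedN (val t))) = val (val t).
Proof. by rewrite val_removedN val_removedV (negPf (nonroot_neqT t)). Qed.

Lemma parent_removed (t : ct_nonroot P') : val (val t) != ~: s ->
  ct_parent (removedN (val t)) = removedV (ct_parent t).
Proof.
move=> nc; apply/eqP; rewrite ct_parentP val_removedN_nonroot val_removedV.
have : child S' (val (val t)) (val (ct_parent t)) by rewrite -(@ct_parentP P').
rewrite child_removed => /andP[_]; rewrite (negPf nc) /=.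
by case: ifP => // _ /andP[].
Qed.

Lemma parent_sibling (t : ct_nonroot P') : val (val t) = ~: s -> ct_parent t = ct_root P'.
Proof.
by move=> e; apply/eqP; rewrite ct_parentP child_removed e ct_root_val !eqxx sibling_neq.
Qed.

(** The edge of [closed_tree P'] joining the root to the sibling is the chain from [s] through the
    old root to the sibling in [T]. As [removedV] sends the new root to [s], the half at the root
    becomes the upward dart of [s]. *)
Definition removedD (h : dart (closed_tree P')) : dart T :=
  match h with
  | inl t => inl (val (removedN (val t)))
  | inr t => if val (val t) == ~: s then inl (val (removedN (ct_root P')))
             else inr (removedN (val t))
  end.

Lemma removedD_inl t : removedD (inl t) = inl (val (removedN (val t))).
Proof. by []. Qed.

Lemma removedD_inr t : removedD (inr t) =
  if val (val t) == ~: s then inl (val (removedN (ct_root P'))) else inr (removedN (val t)).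
Proof. by []. Qed.

Lemma parent_top (v : ct_vert P') :
  (ct_parent (removedN v) == ct_root P) = (v == ct_root P') || (val v == ~: s).
Proof.
rewrite ct_parentP ct_root_val val_removedN val_removedV -(val_eqE v (ct_root P')) ct_root_val.
case: (eqVneq (val v) setT) => [_|_]; first by rewrite s_child.
apply/idP/eqP => [/child_top[] // e|->]; last exact: sibling_child.
by have := vert_neq_removed v; rewrite e eqxx.
Qed.

Lemma src_removedD h : src (removedD h) = removedV (src h) /\ eblue (removedD h) = eblue h.
Proof.
case: h => t.
  split; first exact: val_removedN.
  by rewrite [LHS]/(odd #|val (val (removedN (val t)))|) val_removedN_nonroot.
rewrite removedD_inr; case: eqP => [e|/eqP ne].
  split; first by rewrite [LHS]val_removedN [src _](parent_sibling e).
  rewrite [LHS]/(odd #|val (val (removedN (ct_root P')))|) val_removedN removedV_root.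
  by rewrite [RHS]/(odd #|val (val t)|) e; exact/esym/odd_sibling.
split; first exact: parent_removed.
by rewrite [LHS]/(odd #|val (val (removedN (val t)))|) val_removedN_nonroot.
Qed.

Lemma odd_children_removed (v : ct_vert P') :
  #|odd_children S' (val v)| =
  #|odd_children S (val (removedV v))| + ((v == ct_root P') && odd #|s|).
Proof.
rewrite val_removedV -(val_eqE v (ct_root P')) ct_root_val.
case: eqP => [->|/eqP vT] /=; last first.
  rewrite addn0; apply: eq_card => u; rewrite !inE child_removed (negPf vT) (vert_neq_removed v) andbT.
  case: (eqVneq u s) => [->|//] /=; apply/esym/negbTE/negP => /andP[c _].
  by case/eqP: vT; exact: (child_unique PS c s_child).
have ncs : ~~ child S (~: s) s.
  apply/negP => c; have := removed_neqT.
  by rewrite (child_unique PS c sibling_child) eqxx.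
rewrite addnC; have -> : odd #|s| = (~: s \in odd_children S' setT) :> nat.
  by rewrite !inE child_removed sibling_neq !eqxx odd_sibling.
rewrite [LHS](cardsD1 (~: s)); congr (_ + _); apply: eq_card => u.
rewrite !inE child_removed eqxx.
case: (eqVneq u (~: s)) => [->|nu] /=; first by rewrite (negPf ncs).
case: (eqVneq u s) => [->|//] /=; rewrite (_ : child S s s = false) //.
by apply/negP => /(childP PS)[_ _]; rewrite properxx.
Qed.

(** Only the root matters. If [s] is odd it has 2g+1 odd children for some g, and the odd sibling
    raises this to 2g+2, which gives the same genus; if [s] is even the number is unchanged. *)
Lemma removedV_genus v : ct_genus (removedV v) = ct_genus v /\
  ct_vblue (removedV v) = ct_vblue v.
Proof.
have os := odd_card_odd_children (removedV v) X_gt1.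
rewrite /ct_genus /ct_vblue /cluster_genus.
rewrite (ubereven_ct (removedV v) X_gt1) (@ubereven_ct P' v X_gt1) odd_children_removed.
case: (eqVneq v (ct_root P')) os => [->|_ _]; last by rewrite andFb addn0.
rewrite andTb removedV_root => ->; rewrite ![clusters P]/=.
move: #|_| => [//|n]; rewrite addSn /=; split=> //; lia.
Qed.

(** The two children have equal parity, so there are two odd children or none. Hence the old root
    has genus 0 and the colour of both its lower edges, as smoothing demands. *)
Lemma root_split : ct_genus (ct_root P) = 0 /\ ct_vblue (ct_root P) = odd #|s|.
Proof.
have n : #|odd_children S setT| = 2 * odd #|s|.
  case: (boolP (odd #|s|)) => os.
    rewrite muln1 -two_children; apply: eq_card => u; rewrite inE sibling_children.
    by rewrite in_set2; case: eqP => [->|_] //=; case: eqP => [->|_] //=; rewrite odd_sibling.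
  apply: eq_card0 => u; rewrite inE sibling_children in_set2.
  by case: eqP => [->|_] /=; rewrite ?(negPf os) //; case: eqP => [->|_] //=; rewrite odd_sibling (negPf os).
rewrite /ct_genus /ct_vblue /cluster_genus (ubereven_ct (ct_root P) X_gt1) ct_root_val n.
by case: odd.
Qed.

(* The degree 2 root is smoothed if both of its children are proper, and is cut
   off if one of them is a point. *)
Definition degenerate_part : part T :=
  ([set v | (v != ct_root P) || (1 < #|~: s|)],
   [set h : dart T | [&& opp h != h, (src h != ct_root P) || (1 < #|~: s|)
     & (src (opp h) != ct_root P) || (1 < #|~: s|)]]).

Lemma degenerate_part_closed : closed_part degenerate_part.
Proof.
move=> h; rewrite !inE => /and3P[nh hs ho]; rewrite oppK hs ho; split=> //.
by rewrite eq_sym nh.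
Qed.

Lemma src_up_nonroot (v : ct_vert P') : src (inl (val (removedN v)) : dart T) != ct_root P.
Proof. by rewrite [src _]val_removedN removedV_nonroot. Qed.

Lemma src_down_root (v : ct_vert P') : (src (inr (removedN v) : dart T) == ct_root P) =
  (v == ct_root P') || (val v == ~: s).
Proof. exact: parent_top. Qed.

Lemma removedD_in h : removedD h \in degenerate_part.2.
Proof.
have c1 (t : ct_nonroot P') : val (val t) = ~: s -> 1 < #|~: s|.
  by move=> e; have := ct_nonroot_gt1 t; rewrite e.
have nr (t : ct_nonroot P') : val t == ct_root P' = false.
  exact: (negPf (valP t)).
case: h => t; rewrite in_set.
  rewrite removedD_inl opp_inl_nonroot src_up_nonroot src_down_root nr !orFb.
  by case: (val (val t) =P ~: s) => [e|_]; rewrite ?(c1 _ e) ?orbT.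
rewrite removedD_inr; case: (val (val t) =P ~: s) => [e|/eqP ne].
  by rewrite opp_inl_nonroot (c1 _ e) !orbT.
rewrite -[opp _]/(inl (val (removedN (val t))) : dart T) src_up_nonroot src_down_root nr.
by rewrite (negPf ne).
Qed.

Lemma nonroot_removedN (t : ct_nonroot P) : exists v, removedN v = t.
Proof.
have : val t \in codom removedV by rewrite removedV_codom; exact: valP t.
by case/codomP => v e; exists v; apply: val_inj; rewrite val_removedN e.
Qed.

Lemma sibling_nonroot : 1 < #|~: s| -> exists t : ct_nonroot P', val (val t) = ~: s.
Proof.
move=> c1; have [cS _ cT _] := childP PS _ _ sibling_child.
apply: (@nonroot_of P') => //; first by rewrite /= mem_removed sibling_neq cS.
by case/andP: cT => _; rewrite -subTset.
Qed.

Lemma root_smoothed : 1 < #|~: s| -> smoothed degenerate_part (ct_root P).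
Proof.
move=> c1.
have [t et] := sibling_nonroot c1; have [g0 b0] := root_split.
have nt : removedN (ct_root P') != removedN (val t).
  apply/eqP => /(congr1 val); rewrite !val_removedN => /removedV_inj e.
  by have := valP t; rewrite -e eqxx.
have E : [set h in degenerate_part.2 | src h == ct_root P] =
    [set inr (removedN (ct_root P')); inr (removedN (val t))].
  apply/setP => h; rewrite in_set2 in_set inE c1 !orbT !andbT.
  case: h => [x|n].
    apply/negP => /andP[nh /eqP e]; move: nh; rewrite [x]e opp_inl_root eqxx //.
  have [w <-] := nonroot_removedN n; rewrite src_down_root -et.
  have inrE (x y : ct_vert P') :
      (inr (removedN x) == inr (removedN y) :> dart T) = (val x == val y).
    apply/eqP/eqP => [e|/val_inj-> //]; congr val; apply: removedV_inj.
    by rewrite -!val_removedN (inr_inj e).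
  by rewrite !inrE.
apply/and4P; split.
- by rewrite inE c1 orbT.
- by rewrite /= g0.
- by rewrite E cards2 (inj_eq (@inr_inj _ _)) nt.
- apply/forall_inP => h hA; apply/implyP => sh.
  have : h \in [set h in degenerate_part.2 | src h == ct_root P] by rewrite in_set hA sh.
  rewrite E in_set2 => /orP[]/eqP->.
    rewrite [eblue _]/(odd #|val (val (removedN (ct_root P')))|) val_removedN removedV_root.
    by rewrite [vblue _]b0.
  rewrite [eblue _]/(odd #|val (val (removedN (val t)))|) val_removedN_nonroot et.
  rewrite [vblue _]b0; exact/eqP/odd_sibling.
Qed.

Lemma top_step (v w : ct_vert P') : v <> w -> 1 < #|~: s| ->
  (v == ct_root P') || (val v == ~: s) -> (w == ct_root P') || (val w == ~: s) ->
  next_smoothed degenerate_part (inl (val (removedN v))) (inr (removedN w)).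
Proof.
move=> nvw c1 tv tw; have pw : src (inr (removedN w) : dart T) = ct_root P.
  by apply/eqP; rewrite src_down_root.
have pv : src (inr (removedN v) : dart T) = ct_root P.
  by apply/eqP; rewrite src_down_root.
apply/and3P; split; first by rewrite in_set c1 !orbT.
  by rewrite pw root_smoothed.
apply/and3P; split; rewrite opp_inl_nonroot // ?pv ?pw //.
apply/eqP => e; apply: nvw; apply: removedV_inj.
by rewrite -!val_removedN (inr_inj e).
Qed.

Lemma degenerate_realisation : by_tree (closed_tree P') ->
  @realisation T degenerate_part (closed_tree P') removedV removedD.
Proof.
move=> Tt; apply: realisation_intro => //.
- exact: removedV_inj.
- have inlE (v w : ct_vert P') : inl (val (removedN v)) = inl (val (removedN w)) :> dart T -> v = w.
    by move=> e; apply: removedV_inj; rewrite -!val_removedN (inl_inj e).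
  have inrE (v w : ct_vert P') : inr (removedN v) = inr (removedN w) :> dart T -> v = w.
    by move=> e; apply: removedV_inj; rewrite -!val_removedN (inr_inj e).
  have nr (t : ct_nonroot P') : ct_root P' <> val t.
    by move=> e; have := valP t; rewrite -e eqxx.
  case=> t [] t'; rewrite ?removedD_inl ?removedD_inr.
  + by move/inlE/val_inj->.
  + by case: (val (val t') =P ~: s) => // _ /inlE/esym/nr.
  + by case: (val (val t) =P ~: s) => // _ /inlE/nr.
  + case: (val (val t) =P ~: s) => [e|_]; case: (val (val t') =P ~: s) => [e'|_] //.
      by move=> _; congr inr; do 2!apply: val_inj; rewrite e e'.
    by move/inrE/val_inj->.
- exact: src_removedD.
- exact: removedV_genus.
- by move=> v; rewrite inE removedV_nonroot.
- exact: removedD_in.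
- move=> v; rewrite inE removedV_codom negbK => /orP[/negPf-> //|c1] /eqP->.
  exact: root_smoothed.
- move=> h; rewrite inE removedV_codom => /and3P[nh hs ho] sr; apply/codomP.
  case: h => [v|n] in nh hs ho sr *.
    have [w ew] : exists w, removedN w = Sub v sr by exact: nonroot_removedN.
    have {ew} ev : v = val (removedN w) by rewrite ew SubK.
    rewrite ev in nh hs ho sr *.
    case: (eqVneq w (ct_root P')) => [ew|nw]; last by exists (inl (Sub w nw)).
    rewrite opp_inl_nonroot /= parent_top ew eqxx /= in ho.
    have [t et] := sibling_nonroot ho; exists (inr t).
    by rewrite /= et eqxx ew.
  have [w ew] := nonroot_removedN n; rewrite -ew in nh hs ho sr *.
  rewrite /= parent_top negb_or in sr; case/andP: sr => nr nc.
  by exists (inr (Sub w nr)); rewrite /= (negPf nc).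
- have nr (t : ct_nonroot P') : ct_root P' <> val t.
    by move=> e; have := valP t; rewrite -e eqxx.
  have c1 (t : ct_nonroot P') : val (val t) = ~: s -> 1 < #|~: s|.
    by move=> e; have := ct_nonroot_gt1 t; rewrite e.
  case=> t.
  + rewrite opp_closed_inl removedD_inl removedD_inr.
    case: (val (val t) =P ~: s) => [et|_].
      (* The walk climbs from the sibling to the smoothed root and continues down to [s]. *)
      exists [:: inr (removedN (ct_root P'))]; split=> //.
      rewrite [path _ _ _]andbT; apply: top_step; rewrite ?et ?eqxx ?orbT //.
        by move/esym; exact: nr.
      exact: c1 et.
    by exists [::]; split=> //; exact: opp_inl_nonroot.
  + rewrite opp_closed_inr removedD_inl removedD_inr.
    case: (val (val t) =P ~: s) => [et|_]; last by exists [::].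
    exists [:: inr (removedN (val t))]; split=> //.
    rewrite [path _ _ _]andbT; apply: top_step; rewrite ?et ?eqxx ?orbT //.
    exact: c1 et.
- exact: degenerate_part_closed.
Qed.

(** After the deletion, X has as children the sibling and the children of [s], of which there are at
    least two. *)
Lemma removed_reduced : reduced_picture P'.
Proof.
move=> _ _; have [sS _ _ _] := childP PS _ _ s_child.
rewrite (cardsD1 (~: s)) inE child_removed sibling_neq !eqxx /= add1n ltnS.
apply: leq_trans (children_gt1 PS sS s_gt1) _; apply/subset_leq_card/subsetP => u.
rewrite !inE child_removed eqxx => c.
have nu : u != ~: s.
  apply/eqP => e; rewrite e in c; have := removed_neqT.
  by rewrite (child_unique PS c sibling_child) eqxx.
have ns : u != s.
  by apply/eqP => e; move: c; rewrite e => /(childP PS)[_ _]; rewrite properxx.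
by rewrite nu ns c orbT.
Qed.

Lemma degenerate_subtree : by_subtree degenerate_part (closed_tree P').
Proof.
have Tt := closed_tree_by removed_reduced.
split=> //.
- exact: degenerate_part_closed.
- by exists removedV, removedD; exact: degenerate_realisation.
- move/by_point_genus; rewrite closed_tree_genus tree_of_picture_genus //.
Qed.

(** If the sibling is a point, then [s] is odd, and besides the open edge the root has only the blue
    edge to [s]. In a subtree it would be a blue vertex of genus 0 without yellow edge, and the
    exceptional point is excluded because the genus is positive. *)
Lemma root_not_in_subtree B T'' : ~~ (1 < #|~: s|) -> @by_subtree T B T'' ->
  ct_root P \notin B.1.
Proof.
move=> c1 [cB [fV [fD [[iV cV] [iD cD] sE vE pE]]] Tt bp]; apply/negP => rB.
have os : odd #|s|.
  have [cS _ _ _] := childP PS _ _ sibling_child.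
  by rewrite -odd_sibling; have := card_cluster_gt0 PS cS; case: #|~: s| c1 => [|[]].
have atroot h : h \in B.2 -> src h = ct_root P -> h = inr (removedN (ct_root P')).
  move=> /cB[_ _ nh]; case: h nh => [v nh e|n _].
    by move: nh; rewrite [v]e opp_inl_root eqxx.
  have [w <-] := nonroot_removedN n => /eqP; rewrite src_down_root => /orP[/eqP->//|/eqP e].
  have := ct_vert_gt1 w X_gt1; rewrite e => h; by case/negP: c1.
have ns : ~~ smoothed B (ct_root P).
  apply/negP => /and4P[_ _ /eqP c2 _]; have : 1 < #|[set h in B.2 | src h == ct_root P]| by rewrite c2.
  rewrite ltnNge => /negP[]; apply/card_le1_eqP => x y; rewrite !in_set.
  by case/andP=> xB /eqP sx /andP[yB /eqP sy]; rewrite (atroot x) // (atroot y).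
have : ct_root P \in codom fV by rewrite cV rB.
case/codomP => w ew; have [g0 b0] := root_split.
case: Tt => _ _ [c2|/bp gT] _; last first.
  move: gT; rewrite tree_of_picture_genus => /eqP; rewrite -leqn0 -[pic_genus _]/(#|X|.-1./2).
  by move: #|X| X_gt2 => [|[|[|m]]].
have [||h [sh yh]] := c2 w.
- by rewrite -(vE w).2 -ew [vblue _]b0.
- by rewrite -(vE w).1 -ew [genus _]g0.
have hB : fD h \in B.2 by have : fD h \in codom fD := codom_f _ _; rewrite cD => /andP[].
have := atroot _ hB; rewrite (sE h).1 sh -ew => /(_ erefl) e.
move: yh; rewrite -(sE h).2 e => /negP[].
by rewrite [eblue _]/(odd #|val (val (removedN (ct_root P')))|) val_removedN removedV_root.
Qed.

Lemma degenerate_core : is_core T (closed_tree P').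
Proof.
apply: core_intro degenerate_subtree _ => B T'' sB.
have rB v : v \in B.1 -> (v != ct_root P) || (1 < #|~: s|).
  move=> vB; case: (boolP (1 < #|~: s|)) => c1; rewrite ?orbT // orbF.
  by apply: contraTneq vB => ->; apply: root_not_in_subtree sB.
have [cB _ _ _] := sB.
apply/andP; split; apply/subsetP => x; rewrite in_set; first exact: rB.
move=> xB; have [sx ox nx] := cB x xB; have [sox _ _] := cB _ ox.
by rewrite nx !rB.
Qed.

End DegenerateCore.
(** * Isomorphisms of cluster pictures *)

Section NonrootMap.
Variables (P Q : picture) (phi : ct_vert P -> ct_vert Q).
Hypotheses (phi_bij : bijective phi) (phi_root : phi (ct_root P) = ct_root Q).

Lemma map_nonroot u : (phi u != ct_root Q) = (u != ct_root P).
Proof. by rewrite -phi_root (bij_eq phi_bij). Qed.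

Definition nonroot_map (t : ct_nonroot P) : ct_nonroot Q :=
  Sub (phi (val t)) (etrans (map_nonroot (val t)) (valP t)).

Lemma nonroot_map_bij : bijective nonroot_map.
Proof.
apply: inj_surj_bij => [t t' /(congr1 val)|t].
  by rewrite !SubK => /(bij_inj phi_bij)/val_inj.
have [g _ gK] := phi_bij.
have nt : g (val t) != ct_root P by rewrite -map_nonroot gK; exact: valP t.
by exists (Sub (g (val t)) nt); apply: val_inj; rewrite !SubK gK.
Qed.

End NonrootMap.

Section OrderIso.
Variables (P Q : picture) (phi : ct_vert P -> ct_vert Q).
(** Parity is compared off the root only: adding a point to a picture of odd size changes the parity
    of the whole set but not its half size, and this case is to be covered. *)
Hypotheses (phi_bij : bijective phi)
  (phi_proper : forall u v, (val (phi u) \proper val (phi v)) = (val u \proper val v))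
  (phi_half : forall u, half_size (val (phi u)) = half_size (val u))
  (phi_odd : forall u, u != ct_root P -> odd #|val (phi u)| = odd #|val u|).

Lemma proper_ct_root (R : picture) (u : ct_vert R) : u != ct_root R -> val u \proper setT.
Proof. by move=> nu; rewrite properT -[setT]/(val (ct_root R)) val_eqE. Qed.

Lemma phi_root : phi (ct_root P) = ct_root Q.
Proof.
apply/eqP/negPn/negP => /proper_ct_root; have [g _ gK] := phi_bij.
by rewrite -[setT]/(val (ct_root Q)) -(gK (ct_root Q)) phi_proper properE subsetT andbF.
Qed.

Local Notation phiN := (nonroot_map phi_bij phi_root).
Local Notation phiN_bij := (nonroot_map_bij phi_bij phi_root).

Lemma ct_parent_min (R : picture) (t : ct_nonroot R) (v : ct_vert R) :
  val (val t) \proper val v -> val (ct_parent t) \subset val v.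
Proof.
by have [_ _ _ mx] := childP (picP R) _ _ (child_parent t) => /mx; apply; exact: ct_vert_cluster.
Qed.

Lemma phi_parent t : ct_parent (phiN t) = phi (ct_parent t).
Proof.
apply/eqP; rewrite ct_parentP; apply/(childP (picP Q)); split.
- exact: ct_vert_cluster.
- exact: ct_vert_cluster.
- by rewrite SubK phi_proper ct_parent_proper.
move=> w wS tw; have w1 : 1 < #|w| := ltn_trans (ct_nonroot_gt1 (phiN t)) (proper_card tw).
have pw : proper_cluster (clusters Q) w by rewrite /proper_cluster wS w1.
have [g _ gK] := phi_bij; have ew : w = val (phi (g (Sub w pw))) by rewrite gK SubK.
rewrite ew SubK phi_proper in tw *.
have := ct_parent_min tw; rewrite subEproper => /predU1P[/val_inj-> //|].
by rewrite -phi_proper => /proper_sub.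
Qed.

(** [half_size_split] fixes the difference between the [ubereven] term and the genus. Since
    [ubereven] clusters have genus 0, this difference determines both. *)
Lemma phi_genus u : ct_genus (phi u) = ct_genus u /\ ct_vblue (phi u) = ct_vblue u.
Proof.
have eS : \sum_(t | ct_parent t == phi u) (half_size (val (val t)) + ~~ odd #|val (val t)|) =
    \sum_(t | ct_parent t == u) (half_size (val (val t)) + ~~ odd #|val (val t)|).
  rewrite (reindex phiN); last exact: onW_bij phiN_bij.
  apply: eq_big => [t|t _]; first by rewrite phi_parent (bij_eq phi_bij).
  by rewrite phi_half phi_odd //; exact: valP t.
have := half_size_split u; have := half_size_split (phi u); rewrite eS.
rewrite phi_half /ct_genus /ct_vblue /cluster_genus.
by case: ubereven; case: ubereven; lia.
Qed.

(* The genus and the colour of a cluster can be read off the sizes of the proper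
   clusters, by [half_size_split]. *)
Lemma closed_tree_order_iso : by_iso (closed_tree P) (closed_tree Q).
Proof.
pose fD (h : dart (closed_tree P)) : dart (closed_tree Q) :=
  match h with inl t => inl (phiN t) | inr t => inr (phiN t) end.
exists phi, fD; split.
- split=> //; have [g gK Kg] := phiN_bij.
  by exists (fun h => match h with inl t => inl (g t) | inr t => inr (g t) end) => -[] t /=;
    rewrite ?gK ?Kg.
- by case=> t; split=> //; exact: phi_parent.
- by move=> u; case: (phi_genus u).
- by move=> u; case: (phi_genus u).
- by case=> t /=; exact: (phi_odd (valP t)).
Qed.

End OrderIso.

Section Image.
Variables (X Y : finType) (f : X -> Y).
Hypothesis f_inj : injective f.
Implicit Types (S : {set {set X}}) (u v : {set X}).

Definition img_clusters S : {set {set Y}} := [set f @: (u : {set X}) | u in S].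

Lemma imset_sub u v : (f @: u \subset f @: v) = (u \subset v).
Proof.
apply/idP/idP => [/subsetP s|]; last exact: imsetS.
by apply/subsetP => x xu; have := s (f x) (imset_f f xu); rewrite mem_imset.
Qed.

Lemma imset_properE u v : (f @: u \proper f @: v) = (u \proper v).
Proof. by rewrite !properE !imset_sub. Qed.

Lemma mem_img u S : (f @: u \in img_clusters S) = (u \in S).
Proof. by rewrite mem_imset //; exact: imset_inj. Qed.

Lemma imset_disjoint u v : [disjoint f @: u & f @: v] = [disjoint u & v].
Proof. by rewrite -!setI_eq0 -imsetI ?imset_eq0 // => x y _ _; exact: f_inj. Qed.

End Image.

Section BijImage.
Variables (X Y : finType) (f : X -> Y).
Hypothesis f_bij : bijective f.
Implicit Types (S : {set {set X}}) (u v : {set X}).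
Let f_inj := bij_inj f_bij.

Lemma imset_setT_bij : f @: setT = setT.
Proof.
by apply/setP => y; rewrite !inE; have [g _ gK] := f_bij; rewrite -(gK y) imset_f.
Qed.

Lemma imset_ex (w : {set Y}) : exists u, w = f @: u.
Proof.
exists (f @^-1: w); apply/setP => y; have [g _ gK] := f_bij.
by rewrite -(gK y) mem_imset // inE.
Qed.

Lemma imset_setC_bij u : f @: (~: u) = ~: (f @: u).
Proof.
apply/setP => y; have [g _ gK] := f_bij.
by rewrite -(gK y) inE !mem_imset // inE.
Qed.

Lemma child_img S u v : child (img_clusters f S) (f @: u) (f @: v) = child S u v.
Proof.
rewrite /child !mem_img // imset_properE //; congr [&& _, _, _ & _].
apply/forall_inP/forall_inP => H w wS; last first.
  by have [w' e] := imset_ex w; rewrite e mem_img // in wS *; rewrite !imset_properE // H.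
by have := H (f @: w); rewrite mem_img // !imset_properE //; apply.
Qed.

Lemma children_img S u : children (img_clusters f S) (f @: u) = img_clusters f (children S u).
Proof.
apply/setP => w; have [w' ->] := imset_ex w.
by rewrite mem_img // !inE child_img.
Qed.

Lemma picture_img S : is_picture S -> is_picture (img_clusters f S).
Proof.
case/and4P=> n0 nT /forallP n1 /forall_inP nn; apply/and4P; split.
- by rewrite -(imset0 f) mem_img.
- by rewrite -imset_setT_bij mem_img.
- by apply/forallP => y; have [g _ gK] := f_bij; rewrite -(gK y) -imset_set1 mem_img.
apply/forall_inP => w wS; apply/forall_inP => w' wS'.
have [u e] := imset_ex w; have [u' e'] := imset_ex w'.
rewrite e e' !mem_img // in wS wS' *; rewrite !imset_sub // imset_disjoint //.
by have /forall_inP := nn u wS; apply.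
Qed.

Lemma card_children_img S u : #|children (img_clusters f S) (f @: u)| = #|children S u|.
Proof. by rewrite children_img card_imset //; exact: imset_inj. Qed.

End BijImage.

Section PicIso.

Lemma pic_iso_refl P : pic_iso P P.
Proof.
exists id; split; first by exists id.
apply/setP => u; apply/idP/imsetP => [uS|[v vS ->]]; last by rewrite imset_id.
by exists u => //; rewrite imset_id.
Qed.

Lemma pic_iso_sym P Q : pic_iso P Q -> pic_iso Q P.
Proof.
case=> f [[g fK gK] e]; exists g; split; first by exists f.
have gf u : g @: (f @: (u : {set pts P})) = u.
  by rewrite -imset_comp (eq_imset (g := id)) ?imset_id.
rewrite e; apply/setP => u; apply/idP/imsetP => [uS|[v /imsetP[w wS ->] ->]].
  by exists (f @: u); rewrite ?gf // imset_f.
by rewrite gf.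
Qed.

Lemma pic_iso_card P Q : pic_iso P Q -> #|pts P| = #|pts Q|.
Proof. by case=> f [/bij_eq_card]. Qed.

Lemma pic_iso_children P Q : pic_iso P Q ->
  #|children (clusters P) setT| = #|children (clusters Q) setT|.
Proof.
by case=> f [bf ->]; rewrite -(imset_setT_bij bf) (card_children_img bf).
Qed.

Lemma pic_iso_reduced P Q : pic_iso P Q -> reduced_picture P -> reduced_picture Q.
Proof.
by move=> e; rewrite /reduced_picture -(pic_iso_card e) -(pic_iso_children e).
Qed.

Lemma pic_iso_closed_tree P Q : pic_iso P Q -> by_iso (closed_tree P) (closed_tree Q).
Proof.
case=> f [bf e]; have fi := bij_inj bf; have eX : #|pts P| = #|pts Q| := bij_eq_card bf.
have pf (u : {set pts P}) : proper_cluster (clusters Q) (f @: u) = proper_cluster (clusters P) u.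
  by rewrite /proper_cluster e (mem_img fi) card_imset // eX.
pose phi (u : ct_vert P) : ct_vert Q := Sub (f @: val u) (etrans (pf (val u)) (valP u)).
apply: (@closed_tree_order_iso _ _ phi).
- apply: inj_surj_bij => [u v /(congr1 val)|v].
    by rewrite !SubK => /(imset_inj fi)/val_inj.
  have [u eu] := imset_ex bf (val v).
  have pu : proper_cluster (clusters P) u by rewrite -pf -eu; exact: valP v.
  by exists (Sub u pu); apply: val_inj; rewrite !SubK eu.
- by move=> u v; rewrite !SubK imset_properE.
- by move=> u; rewrite SubK /half_size card_imset.
- by move=> u _; rewrite SubK card_imset.
Qed.

(** Lets an isomorphism that precedes a move be pushed past it, the position required in
    [obtained_by_moves]. *)
Lemma move_transport P P' Q : move P P' -> pic_iso P Q ->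
  exists Q', move Q Q' /\ pic_iso P' Q'.
Proof.
case=> {P P'} [X S S' PS PS' s cX cs eS|X S S' PS PS' s cX c2 cs s2 eS|P P' cP aP|P P' cP aP].
- case: Q => Y R PR [f [bf eR]]; have fi := bij_inj bf; rewrite /= in f bf eR fi.
  subst R.
  have eX : #|X| = #|Y| := bij_eq_card bf.
  exists (Picture (picture_img bf PS')); split; last by exists f.
  apply: (@Move_i _ _ _ _ _ (f @: s)).
  + by rewrite /card_genus -eX.
  + by rewrite -(imset_setT_bij bf) (child_img bf).
  + by rewrite eS /img_clusters imsetU1 (imset_setC_bij bf).
- case: Q => Y R PR [f [bf eR]]; have fi := bij_inj bf; rewrite /= in f bf eR fi.
  subst R.
  have eX : #|X| = #|Y| := bij_eq_card bf.
  exists (Picture (picture_img bf PS')); split; last by exists f.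
  apply: (@Move_ii _ _ _ _ _ (f @: s)).
  + by rewrite /card_genus -eX.
  + by rewrite -(imset_setT_bij bf) (card_children_img bf).
  + by rewrite -(imset_setT_bij bf) (child_img bf).
  + by rewrite card_imset.
  + apply/setP => w; have [u ->] := imset_ex bf w.
    by rewrite in_setD1 (mem_img fi) (inj_eq (imset_inj fi)) eS in_setD1 (mem_img fi).
- move=> iso; have [g [bg eg]] := pic_iso_sym iso; exists P'; split; last exact: pic_iso_refl.
  apply: Move_iii; first by rewrite /pic_genus /card_genus -(pic_iso_card iso).
  case: aP => f [r [fi fr e]]; exists (f \o g), r; split.
  + exact: inj_comp (bij_inj bg).
  + move=> y; rewrite -fr; apply/codomP/codomP => -[x ->]; first by exists (g x).
    by have [g' _ gK'] := bg; exists (g' x); rewrite /= gK'.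
  + rewrite e eg -imset_comp; congr (_ :|: _); apply: eq_imset => u /=.
    by rewrite -imset_comp.
- move=> iso; have [g [bg eg]] := iso; exists P'; split; last exact: pic_iso_refl.
  apply: Move_iv; first by rewrite /pic_genus /card_genus -(pic_iso_card iso).
  case: aP => f [r [fi fr e]]; exists (g \o f), (g r); split.
  + exact: inj_comp (bij_inj bg) fi.
  + move=> y; have [g' gK gK'] := bg; rewrite -{2}(gK' y) (bij_eq bg) -fr.
    apply/codomP/codomP => -[x ex]; exists x; first by rewrite ex /= gK.
    by rewrite -(gK' y) ex.
  + rewrite eg e imsetU imsetU1 imset_set1 (imset_setT_bij bg) imset_set1; congr (_ :|: _).
    rewrite -imset_comp; apply: eq_imset => u /=.
    by rewrite -imset_comp.
Qed.

End PicIso.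
(** * Invariance of the core under moves *)

Lemma picture_remove (X : finType) (S : {set {set X}}) (s : {set X}) :
  is_picture S -> s != setT -> 1 < #|s| -> is_picture (S :\ s).
Proof.
case/and4P=> n0 nT /forallP n1 /forall_inP nn sT s1; apply/and4P; split.
- by rewrite in_setD1 (negPf n0) andbF.
- by rewrite in_setD1 eq_sym sT.
- by apply/forallP => x; rewrite in_setD1 n1 andbT; apply: contraTneq s1 => <-; rewrite cards1.
apply/forall_inP => u; rewrite in_setD1 => /andP[_ uS].
apply/forall_inP => v; rewrite in_setD1 => /andP[_ vS].
by have /forall_inP := nn u uS; apply.
Qed.

Section AddedSibling.
Variables (X : finType) (S S' : {set {set X}}) (PS : is_picture S) (PS' : is_picture S').
Variable s : {set X}.
Hypotheses (s_child : child S s setT) (S'E : S' = (~: s) |: S) (nS : ~: s \notin S).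

(** A proper addition by move (i) leaves X with just two children, complementary to each other. So
    it produces precisely the situation of move (ii), which undoes it. The complement is not a
    point, since points are clusters already. *)
Lemma added_sibling : [/\ 2 < #|X|, #|children S' setT| = 2, child S' (~: s) setT,
  1 < #|~: s| & S = S' :\ ~: s].
Proof.
have [sS TS sT sm] := childP PS _ _ s_child.
have s0 := card_cluster_gt0 PS sS.
have c1 : 1 < #|~: s|.
  have : #|~: s| != 0.
    by apply: contraTneq sT => /cards0_eq c0; rewrite -(setCK s) c0 setC0 properxx.
  have : #|~: s| != 1 by apply: contraNneq nS => /eqP/cards1P[x ->]; exact: pic_set1.
  by case: #|~: s| => [|[]].
have X2 : 2 < #|X| by have := cardsC s; lia.
have sub_s u : u \in S -> ~: s \subset u -> u = setT.
  move=> uS cu; case/or3P: (pic_nested PS sS uS) => [dj|su|us].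
  - have e : u = ~: s by apply/eqP; rewrite eqEsubset cu -disjoints_subset disjoint_sym dj.
    by case/negP: nS; rewrite -e.
  - by apply/eqP; rewrite -subTset -(setUCr s) subUset su.
  - have : ~: s \subset s := subset_trans cu us.
    move=> cs; have : setT \subset s by rewrite -(setUCr s) subUset subxx.
    by rewrite subTset => /eqP e; rewrite e properxx in sT.
have cc : child S' (~: s) setT.
  apply/(childP PS'); rewrite S'E; split.
  - by rewrite setU11.
  - by rewrite setU1r.
  - by rewrite properT; apply/eqP => /(congr1 (fun u : {set X} => #|~: u|));
      rewrite setCK setCT cards0 => e; rewrite e in s0.
  - move=> u; rewrite in_setU1 => /predU1P[->|uS]; first by rewrite properxx.
    by move/proper_sub/(sub_s u uS) => ->.
have sc : child S' s setT.
  apply/(childP PS'); rewrite S'E; split=> //; try by rewrite setU1r.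
  move=> u; rewrite in_setU1 => /predU1P[->|uS]; last exact: sm.
  move=> /proper_sub; rewrite -disjoints_subset -setI_eq0 setIid => /eqP e.
  by rewrite e cards0 in s0.
split=> //; last by rewrite S'E setU1K.
rewrite (_ : children S' setT = [set s; ~: s]); last first.
  apply/setP => u; rewrite inE in_set2; apply/idP/orP => [cu|[]/eqP-> //].
  have [uS' _ uT um] := childP PS' _ _ cu.
  move: uS'; rewrite S'E in_setU1 => /predU1P[->|uS]; first by right.
  left; case/or3P: (pic_nested PS sS uS) => [dj|su|us].
  - have uc : u \subset ~: s by rewrite -disjoints_subset disjoint_sym.
    have ne : u != ~: s by apply: contraNneq nS => <-.
    have [cS' _ cT _] := childP PS' _ _ cc.
    have := um _ cS'; rewrite properEneq ne uc => /(_ isT).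
    by rewrite subTset => /eqP e; rewrite e properxx in cT.
  - rewrite eqEsubset su andbT; apply: contraTT uT => us.
    by rewrite properE negb_and negbK sm ?orbT // properE su us.
  - rewrite eqEsubset us /=; apply: contraT => su.
    have [sS' _ _ _] := childP PS' _ _ sc.
    have := um _ sS'; rewrite properE us su => /(_ isT).
    by rewrite subTset => /eqP e; rewrite e properxx in sT.
rewrite cards2; have [|//] := eqVneq s (~: s) => e.
by case/negP: nS; rewrite -e.
Qed.

End AddedSibling.

Lemma move_ii_gt2 (X : finType) (S : {set {set X}}) (s : {set X}) :
  is_picture S -> child S s setT -> 1 < #|s| -> 2 < #|X|.
Proof.
move=> PS /(childP PS)[_ _ sT _] s1; have := proper_card sT; rewrite cardsT; lia.
Qed.

Lemma even_of_card (X : finType) : #|X| = 2 * card_genus X + 2 -> ~~ odd #|X|.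
Proof. by lia. Qed.

Lemma card_of_even (X : finType) : 0 < #|X| -> ~~ odd #|X| -> #|X| = 2 * card_genus X + 2.
Proof. by rewrite /card_genus; move: #|X| => n; lia. Qed.

(** * Adding a point to a picture of odd size *)

Section AddPoint.
Variables (P P' : picture) (f : pts P -> pts P') (r : pts P').
Hypotheses (f_inj : injective f) (f_codom : forall y, (y \in codom f) = (y != r))
  (clustersE : clusters P' = [set f @: (s : {set pts P}) | s in clusters P]
                        :|: [set setT; [set r]]).
Local Notation X := (pts P).
Local Notation S := (clusters P).

Lemma card_add_point : #|pts P'| = #|X|.+1.
Proof.
have := card_codom f_inj; rewrite (eq_card (B := [set~ r])) => [<-|y]; last by rewrite inE in_set1 f_codom.
rewrite cardsC1 prednK //; exact: pic_card_gt0 (picP P').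
Qed.

Lemma new_point_notin (u : {set X}) : r \notin f @: u.
Proof. by apply/imsetP => -[x _ e]; have := f_codom r; rewrite e codom_f eqxx. Qed.

Lemma imset_neqT (u : {set X}) : (f @: u == setT) = false.
Proof. by apply/negbTE; apply: contra (new_point_notin u) => /eqP->; rewrite inE. Qed.

(** Two pictures play the role of [SQ]: [P'] itself when X is a point, and otherwise [P'] with the
    image of X deleted. The vertex of X goes to the enlarged set, which has the same half size
    because |X| is odd. *)
Lemma add_point_closed_tree (SQ : {set {set pts P'}}) (PQ : is_picture SQ) : odd #|X| ->
  (forall w, proper_cluster SQ w <->
     w = setT \/ exists u, [/\ proper_cluster S u, u != setT & w = f @: u]) ->
  by_iso (closed_tree P) (closed_tree (Picture PQ)).
Proof.
move=> X_odd SQP.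
have pphi (u : ct_vert P) : proper_cluster SQ (if val u == setT then setT else f @: val u).
  apply/SQP; case: eqP => [_|/eqP nu]; first by left.
  by right; exists (val u); split=> //; exact: valP u.
pose phi (u : ct_vert P) : ct_vert (Picture PQ) := Sub _ (pphi u).
have phiE u : val (phi u) = if val u == setT then setT else f @: val u by rewrite SubK.
apply: (@closed_tree_order_iso _ _ phi).
- apply: inj_surj_bij => [u v /(congr1 val)|v].
    rewrite !phiE => e; apply: val_inj; move: e.
    case: eqP => [eu|_]; case: eqP => [ev|_] e.
    + by rewrite [LHS]eu [RHS]ev.
    + by have := imset_neqT (val v); rewrite -e eqxx.
    + by have := imset_neqT (val u); rewrite e eqxx.
    + exact: (imset_inj f_inj e).
  have /SQP[e|[u [pu nu e]]] := valP v.
    by exists (ct_root P); apply: val_inj; rewrite phiE eqxx e.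
  by exists (Sub u pu); apply: val_inj; rewrite phiE SubK (negPf nu).
- move=> u v; rewrite !phiE.
  case: (eqVneq (val v) setT) => [->|nv]; case: (eqVneq (val u) setT) => [->|nu].
  + by rewrite !properxx.
  + by rewrite !properT nu imset_neqT.
  + by rewrite !properE !subTset imset_neqT (negPf nv).
  + exact: imset_properE.
- move=> u; rewrite phiE /half_size; case: eqP => [->|_]; last by rewrite card_imset.
  rewrite !cardsT card_add_point; move: X_odd; case: #|X| => // n; lia.
- move=> u; rewrite phiE -(val_eqE u (ct_root P)) => /negPf; rewrite ct_root_val => ->.
  by rewrite card_imset.
Qed.

(** From three points on, the enlarged set has the two children X and [[set r]]. Deleting X by move
    (ii) gives a picture whose closed tree is the core, and whose proper clusters are those of [P]
    with X replaced by the enlarged set. *)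
Lemma add_point_core T T' : odd #|X| ->
  is_core (tree_of_picture P) T -> is_core (tree_of_picture P') T' -> by_iso T T'.
Proof.
move=> X_odd cT cT'.
have redP : reduced_picture P by rewrite /reduced_picture X_odd.
have eT : by_iso T (closed_tree P) := core_unique cT (reduced_core redP).
have X0 : 0 < #|X| by exact: pic_card_gt0 (picP P).
have cX' := card_add_point.
have memS' w : w \in clusters P' <-> (exists2 u, u \in S & w = f @: u) \/ w = setT \/ w = [set r].
  rewrite clustersE in_setU in_set2; split.
    by case/orP=> [/imsetP[u uS ->]|/orP[]/eqP->]; [left; exists u|right; left|right; right].
  by case=> [[u uS ->]|[->|->]]; rewrite ?imset_f ?eqxx ?orbT.
case: (ltnP #|X| 3) => X3.
  have X1 : #|X| = 1 by move: X_odd X3 X0; case: #|X| => [|[|[]]].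
  have redP' : reduced_picture P' by rewrite /reduced_picture cX' X1.
  have eT' := core_unique (reduced_core redP') cT'.
  apply: by_iso_trans eT (by_iso_trans _ eT').
  have -> : P' = Picture (picP P') by case: (P').
  apply: add_point_closed_tree => // w; rewrite /proper_cluster cX' X1 /= andbF orbF; split.
    case/andP=> /memS'[[u uS ->]|[->|->]]; last by rewrite cards1.
      by rewrite card_imset // ltnNge -X1 max_card.
    by left.
  case=> [->|[u [/andP[uS _] nu _]]]; first by rewrite cardsT cX' X1 andbT; apply/memS'; right; left.
  case/negP: nu; rewrite eqEcard subsetT cardsT X1; exact: (card_cluster_gt0 (picP P) uS).
have nT : f @: setT != setT by rewrite imset_neqT.
have cT1 : 1 < #|f @: (setT : {set X})| by rewrite card_imset // cardsT ltnW.
have PQ := picture_remove (picP P') nT cT1.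
have TS' : f @: setT \in clusters P'.
  by apply/memS'; left; exists setT => //; exact: pic_setT (picP P).
have c1 : child (clusters P') (f @: setT) setT.
  apply/(childP (picP P')); split=> //; first exact: pic_setT (picP P').
    by rewrite properT.
  move=> w /memS'[[u _ ->]|[->//|->]].
    by rewrite imset_properE // properE subTset subsetT andbC; case: eqP.
  by move/proper_card; rewrite cards1 ltnNge ltnW.
have c2 : child (clusters P') [set r] setT.
  apply/(childP (picP P')); split; try exact: pic_setT (picP P').
  - exact: pic_set1 (picP P') r.
  - by rewrite properEcard subsetT cards1 cardsT cX' ltnS.
  move=> w /memS'[[u _ ->]|[->//|->]]; last by rewrite properxx.
  by move/proper_sub; rewrite sub1set (negPf (new_point_notin u)).
have two : #|children (clusters P') setT| = 2.
  rewrite (_ : children _ _ = [set f @: setT; [set r]]); last first.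
    apply/setP => w; rewrite inE in_set2; apply/idP/orP => [cw|[]/eqP-> //].
    have [/memS'[[u _ e]|[e|->]] _ wT wm] := childP (picP P') _ _ cw; last by right.
      left; rewrite e in wT wm *; case: (eqVneq u setT) => [->//|nu].
      have := wm _ TS'; rewrite imset_properE // properT nu => /(_ isT).
      by rewrite subTset imset_neqT.
    by rewrite e properxx in wT.
  rewrite cards2 (_ : (_ == _) = false) //; apply/eqP => e.
  by have := new_point_notin setT; rewrite e set11.
have eP' : P' = Picture (picP P') by case: (P').
have cQ : is_core (tree_of_picture P') (closed_tree (Picture PQ)).
  rewrite {1}eP'; apply: (@degenerate_core _ _ _ (picP P') PQ (f @: setT)) => //.
    by rewrite cX' /= negbK.
  by rewrite cX' ltnS ltnW.
apply: by_iso_trans eT (by_iso_trans _ (core_unique cQ cT')).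
apply: add_point_closed_tree => // w; rewrite /proper_cluster in_setD1 cX'; split.
  case/andP=> /andP[nw /memS'[[u uS e]|[->|->]]]; [|by left|]; last first.
    by rewrite cards1 /= eqSS; move: X3; case: #|X|.
  rewrite e card_imset // => u1; right; exists u; split=> //.
    rewrite uS /=; case/orP: u1 => [->//|/andP[_]]; by rewrite eqSS; move: X3; case: #|X|.
  by apply: contraNneq nw => eu; rewrite e eu.
case=> [->|[u [/andP[uS u1] nu ->]]].
  rewrite eq_sym imset_neqT cardsT cX' ltnS X0 /= andbT.
  by apply/memS'; right; left.
rewrite (inj_eq (imset_inj f_inj)) nu card_imset //.
have -> : f @: u \in clusters P' by apply/memS'; left; exists u.
by case/orP: u1 => [->//|/andP[_ /eqP e]]; rewrite e in X3.
Qed.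

End AddPoint.

Lemma add_point_card P P' : add_point P P' -> #|pts P'| = #|pts P|.+1.
Proof. by case=> f [r [fi fr e]]; exact: card_add_point fi fr. Qed.

Definition moves := clos_refl_trans picture move.

(** Moves (iii) and (iv) invert each other, and (ii) is undone by (i), which restores the deleted
    set as the complement of its sibling. A move (i) is undone by (ii) or, if the added set was
    present already, by no move at all; hence the reflexive closure in the conclusion. *)
Lemma move_sym P Q : move P Q -> moves Q P.
Proof.
case=> {P Q} [X S S' PS PS' s cX cs eS|X S S' PS PS' s cX c2 cs s2 eS|P P' cP aP|P P' cP aP].
- case: (boolP (~: s \in S)) => [cS|nS].
    have e : S' = S by rewrite eS; apply/setUidPr; rewrite sub1set.
    subst S'; move: PS'; rewrite e => PS'.
    by rewrite (bool_irrelevance PS' PS); exact: rt_refl.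
  have [X2 c2 cc c1 e] := added_sibling PS PS' cs eS nS.
  by apply: rt_step; apply: (Move_ii PS' PS cX c2 cc c1 e).
- apply: rt_step; have ev := even_of_card cX; have X2 := move_ii_gt2 PS cs s2.
  apply: (@Move_i _ _ _ _ _ (~: s) cX).
    rewrite (child_removed PS PS' X2 c2 cs eS) eqxx.
    by rewrite (sibling_neq s2) !eqxx.
  by have [sS _ _ _] := childP PS _ _ cs; rewrite setCK eS setD1K.
- apply/rt_step/Move_iv => //; have := add_point_card aP.
  by move: cP; rewrite /pic_genus /card_genus => -> ->; lia.
- apply/rt_step/Move_iii => //; have := add_point_card aP.
  by move: cP; rewrite /pic_genus /card_genus => ->; lia.
Qed.

Lemma moves_sym P Q : moves P Q -> moves Q P.
Proof.
elim=> [x y|x|x y z _ yx _ zy]; [exact: move_sym|exact: rt_refl|].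
exact: rt_trans zy yx.
Qed.

Lemma core_move_ii (X : finType) (S S' : {set {set X}}) (PS : is_picture S)
    (PS' : is_picture S') (s : {set X}) T T' :
  #|X| = 2 * card_genus X + 2 -> #|children S setT| = 2 -> child S s setT -> 1 < #|s| ->
  S' = S :\ s ->
  is_core (tree_of_picture (Picture PS)) T -> is_core (tree_of_picture (Picture PS')) T' ->
  by_iso T T'.
Proof.
move=> cX c2 cs s1 e cT cT'; have ev := even_of_card cX; have X2 := move_ii_gt2 PS cs s1.
have c' := degenerate_core PS PS' ev X2 c2 cs s1 e.
apply: by_iso_trans (core_unique cT c') _.
exact: core_unique (reduced_core (@removed_reduced _ _ _ PS PS' _ X2 c2 cs s1 e)) cT'.
Qed.

Lemma core_move_i (X : finType) (S S' : {set {set X}}) (PS : is_picture S)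
    (PS' : is_picture S') (s : {set X}) T T' :
  #|X| = 2 * card_genus X + 2 -> child S s setT -> S' = (~: s) |: S ->
  is_core (tree_of_picture (Picture PS)) T -> is_core (tree_of_picture (Picture PS')) T' ->
  by_iso T T'.
Proof.
move=> cX cs eS cT cT'; case: (boolP (~: s \in S)) => [cS|nS].
  have e : S' = S by rewrite eS; apply/setUidPr; rewrite sub1set.
  move: PS' cT'; rewrite e => PS'; rewrite (bool_irrelevance PS' PS).
  exact: core_unique.
have [X2 c2 cc c1 e] := added_sibling PS PS' cs eS nS.
exact: by_iso_sym (core_move_ii cX c2 cc c1 e cT' cT).
Qed.

Lemma core_move P P' T T' : move P P' ->
  is_core (tree_of_picture P) T -> is_core (tree_of_picture P') T' -> by_iso T T'.
Proof.
case=> {P P'} [X S S' PS PS' s cX cs eS|X S S' PS PS' s cX c2 cs s2 eS|P P' cP aP|P P' cP aP].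
- exact: core_move_i cX cs eS.
- exact: core_move_ii cX c2 cs s2 eS.
- case: aP => f [r [fi fr e]]; apply: (add_point_core fi fr e).
  by rewrite cP addn1 /= mul2n odd_double.
move=> cT cT'; apply: by_iso_sym; move: cT' cT.
have aP' := add_point_card aP; case: aP => f [r [fi fr e]]; apply: (add_point_core fi fr e).
by move: aP'; rewrite cP; lia.
Qed.

Lemma reduce_picture P : exists2 Q, (P = Q \/ move P Q) /\ #|pts P| = #|pts Q| &
  reduced_picture Q /\ is_core (tree_of_picture P) (closed_tree Q).
Proof.
case: (boolP [&& ~~ odd #|pts P|, 2 < #|pts P| & #|children (clusters P) setT| <= 2]); last first.
  move=> n; have red : reduced_picture P.
    by move=> ev X2; move: n; rewrite ev X2 /= -ltnNge.
  by exists P; [split; first left|split; last exact: reduced_core].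
case: P => X S PS /= /and3P[ev X2 c2].
have T1 : 1 < #|[set: X]| by rewrite cardsT ltnW.
have two : #|children S setT| = 2.
  by apply/eqP; rewrite eqn_leq c2 (children_gt1 PS (pic_setT PS) T1).
(* Two complementary children of a set with more than two points cannot both be singletons. *)
have [s cs s1] : exists2 s, child S s setT & 1 < #|s|.
  have /card_gt0P[s] : 0 < #|children S setT| by rewrite two.
  rewrite inE => cs; case: (ltnP 1 #|s|) => s1; first by exists s.
  exists (~: s); last first.
    by rewrite -(ltn_add2l #|s|) cardsC; apply: leq_ltn_trans X2; rewrite addn1 ltnS.
  have [sS _ _ _] := childP PS _ _ cs.
  have := set22 s (~: s); rewrite -(sibling_children PS X2 two cs) inE //.
have PQ := picture_remove PS (removed_neqT PS cs) s1.
exists (Picture PQ); first split=> //; first right.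
  apply: (Move_ii PS PQ _ two cs s1 erefl); apply: card_of_even => //; exact: ltnW (ltnW X2).
split; last exact: (degenerate_core PS PQ ev X2 two cs s1 erefl).
exact: (@removed_reduced _ _ _ PS PQ _ X2 two cs s1 erefl).
Qed.

Lemma core_exists P : exists T, is_core (tree_of_picture P) T.
Proof. by have [Q _ [_ c]] := reduce_picture P; exists (closed_tree Q). Qed.

Lemma core_moves P P' T T' : moves P P' ->
  is_core (tree_of_picture P) T -> is_core (tree_of_picture P') T' -> by_iso T T'.
Proof.
move=> m; elim: m T T' => {P P'} [P P' /core_move h T T'|P T T'|P Q R _ h1 _ h2 T T' cT cT'].
- exact: h.
- exact: core_unique.
have [TQ cQ] := core_exists Q; exact: by_iso_trans (h1 _ _ cT cQ) (h2 _ _ cQ cT').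
Qed.

(** The reducing move of [P] is transported to [P'], so that isomorphisms are compared only on
    reduced pictures, where the core is the closed tree. *)
Lemma core_pic_iso P P' T T' : pic_iso P P' ->
  is_core (tree_of_picture P) T -> is_core (tree_of_picture P') T' -> by_iso T T'.
Proof.
move=> iso cT cT'; have [Q [PQ _] [red cQ]] := reduce_picture P.
have [Q' [mQ' isoQ]] : exists Q', moves P' Q' /\ pic_iso Q Q'.
  case: PQ => [<-|mv]; first by exists P'; split; first exact: rt_refl.
  by have [Q' [mv' isoQ]] := move_transport mv iso; exists Q'; split; first exact: rt_step.
have cQ' := reduced_core (pic_iso_reduced isoQ red).
apply: by_iso_trans (core_unique cT cQ) (by_iso_trans (pic_iso_closed_tree isoQ) _).
by apply: by_iso_sym; apply: core_moves mQ' cT' cQ'.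
Qed.

Lemma core_equiv P P' T T' : pic_equiv P P' ->
  is_core (tree_of_picture P) T -> is_core (tree_of_picture P') T' -> by_iso T T'.
Proof.
have main Q Q' U U' : obtained_by_moves Q Q' -> is_core (tree_of_picture Q) U ->
    is_core (tree_of_picture Q') U' -> by_iso U U'.
  case=> R [m iso] cU cU'; have [V cV] := core_exists R.
  exact: by_iso_trans (core_moves m cU cV) (core_pic_iso iso cV cU').
case=> h cT cT'; first exact: main h cT cT'.
exact: by_iso_sym (main _ _ _ _ h cT' cT).
Qed.

Lemma core_by_tree P T : is_core (tree_of_picture P) T -> by_tree T /\ by_genus T = pic_genus P.
Proof.
move=> cT; have Tt : by_tree T by case: cT => A [[]].
split=> //; have [Q [_ cPQ] [red cQ]] := reduce_picture P.
rewrite (by_iso_genus Tt (closed_tree_by red) (core_unique cT cQ)) closed_tree_genus.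
by rewrite /pic_genus /card_genus cPQ.
Qed.
(** * Change of root *)

(** The i-th element of the fibre over [v] goes to the i-th element of the fibre over [phi v]. *)
Lemma fibre_bijection (X Y V W : finType) (p : X -> V) (q : Y -> W) (phi : V -> W) :
  bijective phi ->
  (forall v, #|[set x | p x == v]| = #|[set y | q y == phi v]|) ->
  exists2 f : X -> Y, bijective f & forall x, q (f x) = phi (p x).
Proof.
move=> phi_bij cE; pose A v := enum [set x | p x == v]; pose B v := enum [set y | q y == phi v].
have sE v : size (A v) = size (B v) by rewrite -!cardE.
have memA v x : (x \in A v) = (p x == v) by rewrite mem_enum inE.
have memB v y : (y \in B v) = (q y == phi v) by rewrite mem_enum inE.
have exB x : exists y, y == nth y (B (p x)) (index x (A (p x))).
  have : index x (A (p x)) < size (B (p x)) by rewrite -sE index_mem memA.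
  case E : (B (p x)) => [//|y b] lt; exists (nth y (y :: b) (index x (A (p x)))).
  by apply/eqP; apply: set_nth_default.
pose f x := xchoose (exB x).
have fE x y0 : f x = nth y0 (B (p x)) (index x (A (p x))).
  apply: (etrans (eqP (xchooseP (exB x)))); apply: set_nth_default.
  by rewrite -sE index_mem memA.
have fP x : q (f x) = phi (p x).
  apply/eqP; rewrite -memB (fE x (f x)) mem_nth //.
  by rewrite -sE index_mem memA.
exists f => //; apply: inj_surj_bij => [x x' e|y].
  have ep : p x = p x' by apply: (bij_inj phi_bij); rewrite -!fP e.
  have := e; rewrite (fE x (f x)) (fE x' (f x)) -ep => /eqP.
  rewrite nth_uniq ?enum_uniq -?sE ?index_mem ?memA ?ep // => /eqP ei.
  have xA : x \in A (p x') by rewrite memA ep.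
  have xA' : x' \in A (p x') by rewrite memA.
  by have := nth_index x xA; rewrite ei nth_index.
have [g _ gK] := phi_bij; pose v := g (q y).
have yB : y \in B v by rewrite memB gK.
have : index y (B v) < size (A v) by rewrite sE index_mem.
case E : (A v) => [//|x0 a]; rewrite -E => lt.
pose x := nth x0 (A v) (index y (B v)); exists x.
have /eqP px : p x == v by rewrite -memA mem_nth.
by rewrite (fE x y) px index_uniq ?enum_uniq // nth_index.
Qed.

Section Singletons.
Variable P : picture.
Local Notation X := (pts P).
Local Notation S := (clusters P).
Local Notation V := (ct_vert P).
Hypothesis X_gt1 : 1 < #|X|.

Lemma point_neqT (x : X) : [set x] != setT.
Proof. by apply/eqP => /(congr1 (fun u : {set X} => #|u|)); rewrite cards1 cardsT => e; have := X_gt1; rewrite -e. Qed.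

Lemma point_parent (x : X) : exists s : V, child S [set x] (val s).
Proof.
have [u cu] := parent_exists (picP P) (pic_set1 (picP P) x) (point_neqT x).
have [_ uS xu _] := childP (picP P) _ _ cu.
have u1 : 1 < #|u| by have := proper_card xu; rewrite cards1.
have pu : proper_cluster S u by rewrite /proper_cluster uS u1.
by exists (Sub u pu); rewrite SubK.
Qed.

(** The least cluster with at least two points containing [x]; the point hangs directly below its
    vertex. *)
Definition point_vert (x : X) : V := xchoose (point_parent x).

Lemma point_vertP x : child S [set x] (val (point_vert x)).
Proof. exact: xchooseP (point_parent x). Qed.

Lemma point_vert_eq x s : (point_vert x == s) = child S [set x] (val s).
Proof.
apply/eqP/idP => [<-|c]; first exact: point_vertP.
apply: val_inj; exact: (child_unique (picP P) (point_vertP x) c).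
Qed.

Lemma mem_vert x (s : V) : (x \in val s) = (val (point_vert x) \subset val s).
Proof.
have [_ _ xv mx] := childP (picP P) _ _ (point_vertP x).
apply/idP/idP => [xs|/subsetP->//]; last by have := proper_sub xv; rewrite sub1set.
apply: mx; first exact: ct_vert_cluster.
by rewrite properEcard sub1set xs cards1 (ct_vert_gt1 s X_gt1).
Qed.

Lemma card_odd_children_points (s : V) :
  #|odd_children S (val s)| = #|[set x | point_vert x == s]| + odd_below s.
Proof.
rewrite /odd_below -(proper_children_sum s (fun u => odd #|u|)) card_setIdE.
rewrite (bigID (fun u : {set X} => 1 < #|u|)) /= addnC; congr (_ + _).
rewrite -(card_imset _ (@set1_inj X)) -sum1_card big_mkcondr /=.
rewrite [LHS]big_mkcond [RHS]big_mkcond /=; apply: eq_bigr => u _.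
case: (boolP (u \in [set [set x] | x in [set x | point_vert x == s]])).
  case/imsetP => x; rewrite inE point_vert_eq => c ->.
  by rewrite inE c cards1.
move=> nu; rewrite inE; case: (boolP (child S u (val s))) => // c; case: (ltnP 1 #|u|) => //= u1.
have [uS _ _ _] := childP (picP P) _ _ c.
have : #|u| == 1 by rewrite eqn_leq u1 (card_cluster_gt0 (picP P) uS).
case/cards1P=> x ex; case/imsetP: nu; exists x => //.
by rewrite inE point_vert_eq -ex.
Qed.

End Singletons.

(** * A reduced picture of even size is determined by its rooted tree *)

Section RootedIso.
Variables (P Q : picture) (phi : ct_vert P -> ct_vert Q).
Variable phiD : dart (closed_tree P) -> dart (closed_tree Q).
Hypotheses (P_even : ~~ odd #|pts P|) (Q_even : ~~ odd #|pts Q|)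
  (phi_bij : bijective phi) (phiD_bij : bijective phiD)
  (phi_iso : forall h, src (phiD h) = phi (src h) /\ opp (phiD h) = phiD (opp h))
  (phi_genus : forall v, ct_genus (phi v) = ct_genus v)
  (phi_blue : forall v, ct_vblue (phi v) = ct_vblue v)
  (phi_eblue : forall h, eblue (phiD h) = eblue h)
  (phi_top : phi (ct_root P) = ct_root Q).

Let P_gt1 : 1 < #|pts P|.
Proof. by have := pic_card_gt0 (picP P); move: P_even; case: #|pts P| => [|[]]. Qed.
Let Q_gt1 : 1 < #|pts Q|.
Proof. by have := pic_card_gt0 (picP Q); move: Q_even; case: #|pts Q| => [|[]]. Qed.

(** Induction from the root. If the upward dart of [t] went to the downward dart of [t'], the parent
    of [t] would go to the vertex of [t'], and the parent's own upward dart would have the same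
    image as the dart from the parent to [t]. *)
Lemma rooted_iso_up t : exists t', phiD (inl t) = inl t'.
Proof.
have [n] := ubnP (codepth (val t)); elim: n => // n IHn in t *; rewrite ltnS => ln.
case E : (phiD (inl t)) => [t'|t']; first by exists t'.
have et : phi (ct_parent t) = val t'.
  by have := (phi_iso (inr t)).1; rewrite -[inr t](opp_closed_inl t) -(phi_iso _).2 E.
case: (eqVneq (ct_parent t) (ct_root P)) => [er|nr].
  by have := valP t'; rewrite -et er phi_top eqxx.
pose tp : ct_nonroot P := Sub (ct_parent t) nr.
have [|tp' etp] := IHn tp; first by apply: leq_trans (codepth_parent t) ln.
have e' : tp' = t'.
  have e1 : val tp' = phi (ct_parent t) by have := (phi_iso (inl tp)).1; rewrite etp.
  by apply: val_inj; rewrite e1 et.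
have : phiD (inr t) = phiD (inl tp).
  by rewrite etp e' -[inr t](opp_closed_inl t) -(phi_iso _).2 E.
by move/(bij_inj phiD_bij).
Qed.

Local Notation rootedN := (nonroot_map phi_bij phi_top).

Lemma rooted_iso_inl t : phiD (inl t) = inl (rootedN t).
Proof.
have [t' e] := rooted_iso_up t; rewrite e; congr inl; apply: val_inj.
by have := (phi_iso (inl t)).1; rewrite e SubK.
Qed.

Lemma rooted_iso_parent t : ct_parent (rootedN t) = phi (ct_parent t).
Proof.
have := (phi_iso (inr t)).1.
by rewrite -[inr t](opp_closed_inl t) -(phi_iso _).2 rooted_iso_inl.
Qed.

Lemma rooted_iso_odd (v : ct_vert P) : odd #|val (phi v)| = odd #|val v|.
Proof.
case: (eqVneq v (ct_root P)) => [->|nv].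
  by rewrite phi_top !ct_root_val !cardsT (negPf P_even) (negPf Q_even).
by have := phi_eblue (inl (Sub v nv)); rewrite rooted_iso_inl.
Qed.

Lemma ct_parent_sub (R : picture) (t : ct_nonroot R) (v : ct_vert R) : val t != v ->
  (val (val t) \subset val v) = (val (ct_parent t) \subset val v).
Proof.
move=> ne; apply/idP/idP => [tv|]; last exact: subset_trans (proper_sub (ct_parent_proper t)).
by apply: ct_parent_min; rewrite properEneq (inj_eq val_inj) ne tv.
Qed.

Lemma rooted_iso_sub (u v : ct_vert P) : (val (phi u) \subset val (phi v)) = (val u \subset val v).
Proof.
have [n] := ubnP (codepth u); elim: n => // n IHn in u *; rewrite ltnS => ln.
case: (eqVneq u v) => [->|ne]; first by rewrite !subxx.
case: (eqVneq u (ct_root P)) => [eu|nu].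
  rewrite eu phi_top !subTset -[setT in LHS]/(val (ct_root Q)) -[setT in RHS]/(val (ct_root P)).
  by rewrite !(inj_eq val_inj) -phi_top (bij_eq phi_bij).
pose t : ct_nonroot P := Sub u nu; have et : val t = u by rewrite SubK.
have etN : val (rootedN t) = phi u by rewrite SubK et.
rewrite -etN ct_parent_sub ?etN ?(bij_eq phi_bij) // rooted_iso_parent.
rewrite -et ct_parent_sub ?et // IHn //.
by apply: leq_trans (codepth_parent t) _; rewrite et.
Qed.

(** Colour tells whether the number is zero, genus leaves the choice between 2g+1 and 2g+2, and the
    parity of the cluster decides. That parity is the colour of the upward edge, or at the root the
    assumed evenness. *)
Lemma rooted_iso_odd_children (v : ct_vert P) :
  #|odd_children (clusters Q) (val (phi v))| = #|odd_children (clusters P) (val v)|.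
Proof.
have := phi_genus v; have := phi_blue v; have := rooted_iso_odd v.
rewrite (odd_card_odd_children v P_gt1) (odd_card_odd_children (phi v) Q_gt1).
rewrite /ct_vblue /ct_genus /cluster_genus (ubereven_ct v P_gt1) (ubereven_ct (phi v) Q_gt1).
move: #|odd_children _ (val v)| #|odd_children _ (val (phi v))| => m n o.
by case: (eqVneq m 0) => [->|m0]; case: (eqVneq n 0) => [->|n0] //= _; lia.
Qed.

Lemma rooted_iso_points v :
  #|[set x | point_vert P_gt1 x == v]| = #|[set y | point_vert Q_gt1 y == phi v]|.
Proof.
have := rooted_iso_odd_children v.
rewrite (card_odd_children_points P_gt1) (card_odd_children_points Q_gt1).
have -> : odd_below (phi v) = odd_below v.
  rewrite /odd_below (reindex rootedN); last exact: onW_bij (nonroot_map_bij phi_bij phi_top).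
  apply: eq_big => [t|t _]; first by rewrite rooted_iso_parent (bij_eq phi_bij).
  by rewrite SubK rooted_iso_odd.
by move/addIn.
Qed.

(** Corresponding vertices carry equally many points, so the points can be matched over [phi]. A
    proper cluster consists of the points hanging at the vertices below it, and [phi] respects this
    order. *)
Lemma rooted_iso_picture : pic_iso P Q.
Proof.
have [f f_bij fP] := fibre_bijection phi_bij rooted_iso_points.
have f_inj := bij_inj f_bij; exists f; split=> //.
have fE (v : ct_vert P) : f @: val v = val (phi v).
  apply/setP => y; have [g _ gK] := f_bij; rewrite -(gK y) mem_imset //.
  by rewrite (mem_vert P_gt1) (mem_vert Q_gt1) fP rooted_iso_sub.
have small (R : picture) (w : {set pts R}) : w \in clusters R -> 1 < #|w| \/ exists x, w = [set x].
  move=> wS; have := card_cluster_gt0 (picP R) wS; rewrite leq_eqVlt eq_sym.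
  by case/orP=> [/cards1P|]; [right|left].
apply/setP => w; apply/idP/imsetP => [wS|[u uS ->]].
  case: (small _ _ wS) => [w1|[y ->]]; last first.
    have [g _ gK] := f_bij; exists [set g y]; first exact: pic_set1 (picP P) _.
    by rewrite imset_set1 gK.
  have pw : proper_cluster (clusters Q) w by rewrite /proper_cluster wS w1.
  have [g _ gK] := phi_bij; exists (val (g (Sub w pw))); first exact: ct_vert_cluster.
  by rewrite fE gK SubK.
case: (small _ _ uS) => [u1|[y ->]]; last by rewrite imset_set1 (pic_set1 (picP Q)).
have pu : proper_cluster (clusters P) u by rewrite /proper_cluster uS u1.
by rewrite -[u]/(val (Sub u pu : ct_vert P)) fE ct_vert_cluster.
Qed.

End RootedIso.

(** * Moving the root within the core *)

Section Reroot.

Lemma picture_add_sibling (X : finType) (S : {set {set X}}) (s : {set X}) :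
  is_picture S -> child S s setT -> is_picture ((~: s) |: S).
Proof.
move=> PS cs; have [sS TS sT sm] := childP PS _ _ cs.
have comp u : u \in S -> [|| [disjoint ~: s & u], ~: s \subset u | u \subset ~: s].
  move=> uS; case/or3P: (pic_nested PS sS uS) => [dj|su|us].
  - have -> : u \subset ~: s by rewrite -disjoints_subset disjoint_sym.
    by rewrite !orbT.
  - case: (eqVneq s u) => [<-|ne].
      by rewrite -setI_eq0 setIC setICr eqxx.
    have : setT \subset u by apply: sm => //; rewrite properEneq ne su.
    by rewrite subTset => /eqP->; rewrite subsetT orbT.
  - by rewrite disjoint_sym disjoints_subset setCK us.
case/and4P: (PS) => n0 nT /forallP n1 /forall_inP nn; apply/and4P; split.
- rewrite in_setU1 (negPf n0) orbF eq_sym; apply/eqP => c0.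
  by have := sT; rewrite -(setCK s) c0 setC0 properxx.
- by rewrite in_setU1 nT orbT.
- by apply/forallP => x; rewrite in_setU1 n1 orbT.
apply/forall_inP => u; rewrite in_setU1 => /predU1P[->|uS];
apply/forall_inP => v; rewrite in_setU1 => /predU1P[->|vS].
- by rewrite subxx !orbT.
- exact: comp.
- by rewrite disjoint_sym [X in _ || X]orbC; exact: comp.
- by have /forall_inP := nn u uS; apply.
Qed.

(** Adding the complement of [s] and then deleting the complement or [s] gives [Q] or [Q1]; both
    closed trees realise one part of the intermediate open tree. In it, the vertex of [s] represents
    [val t] for [Q] and the root for [Q1], so the comparison isomorphism sends one to the other. *)
Lemma reroot_step (Q : picture) (t : ct_nonroot Q) :
  reduced_picture Q -> ~~ odd #|pts Q| -> ct_parent t = ct_root Q ->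
  exists (Q1 : picture) (f : vert (closed_tree Q) -> vert (closed_tree Q1)),
    [/\ moves Q Q1, reduced_picture Q1, ~~ odd #|pts Q1|, iso_map f &
        f (val t) = ct_root Q1].
Proof.
case: Q t => X S PS t red ev /eqP; rewrite ct_parentP ct_root_val.
set s := val (val t) => /= cs; have s1 : 1 < #|s| := ct_nonroot_gt1 t.
have X2 := move_ii_gt2 PS cs s1; have X0 : 0 < #|X| by exact: ltnW (ltnW X2).
have nS : ~: s \notin S.
  apply/negP => cS; have := red ev X2; rewrite ltnNge => /negP[].
  rewrite (leq_trans _ (_ : #|[set s; ~: s]| <= 2)) //; last by rewrite cards2; case: (_ != _).
  apply/subset_leq_card/subsetP => u; rewrite inE in_set2 => cu.
  case: (eqVneq u s) => //= ne.
  have T1 : 1 < #|[set: X]| by rewrite cardsT ltnW.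
  have /and3P[_ /trivIsetP tri _] := children_partition PS (pic_setT PS) T1.
  have uc : u \subset ~: s by rewrite -disjoints_subset tri ?inE.
  have [uS _ uT um] := childP PS _ _ cu.
  rewrite eqEsubset uc /=; apply: contraT => cu'.
  have := um _ cS; rewrite properE uc cu' => /(_ isT); rewrite subTset => /eqP c.
  have := card_cluster_gt0 PS (_ : s \in S); have [sS _ _ _] := childP PS _ _ cs.
  by move=> /(_ sS); rewrite -(setCK s) c setCT cards0.
have PS1 := picture_add_sibling PS cs; set S1 := (~: s) |: S in PS1 *.
have [_ two cc c1 eS] := added_sibling PS PS1 cs erefl nS.
have cs1 : child S1 s setT.
  by have := sibling_child PS1 X2 two cc; rewrite setCK.
have PS2 := picture_remove PS1 (removed_neqT PS cs) s1.
pose Q0 := Picture PS; pose Q1 := Picture PS2.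
have red1 : reduced_picture Q1 := @removed_reduced _ _ _ PS1 PS2 _ X2 two cs1 s1 erefl.
have cX := card_of_even X0 ev.
have m : moves Q0 Q1.
  apply: (@rt_trans _ _ _ (Picture PS1)); apply: rt_step.
    exact: Move_i cX cs erefl.
  exact: Move_ii cX two cs1 s1 erefl.
have r0 := @degenerate_realisation _ _ _ PS1 PS _ ev X2 two cc c1 eS (closed_tree_by red).
have r1 := @degenerate_realisation _ _ _ PS1 PS2 _ ev X2 two cs1 s1 erefl (closed_tree_by red1).
(* The part sees the two siblings only through the test that the remaining one is proper, and here
   both are. *)
have eA : degenerate_part PS1 (~: s) = degenerate_part PS1 s.
  by rewrite /degenerate_part setCK c1 s1.
rewrite eA in r0.
have [fV iso fE] := realisation_unique (@degenerate_part_closed _ _ PS1 s) r0 r1.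
exists Q1, fV; split=> //.
have sT := removed_neqT PS cs.
have := congr1 val (fE (val t)); rewrite !val_removedV -/s (negPf sT).
case: eqP => [e _|_ e]; first exact: val_inj.
have : val (fV (val t) : ct_vert Q1) \in S1 :\ s := ct_vert_cluster _.
by rewrite in_setD1 e eqxx.
Qed.

(** Induction on the depth of [v]: once the parent of [v] has been made the root, the image of [v]
    is one of its children and a single step suffices. *)
Lemma reroot (Q : picture) (v : ct_vert Q) : reduced_picture Q -> ~~ odd #|pts Q| ->
  exists (Q1 : picture) (f : vert (closed_tree Q) -> vert (closed_tree Q1)),
    [/\ moves Q Q1, reduced_picture Q1, ~~ odd #|pts Q1|, iso_map f &
        f v = ct_root Q1].
Proof.
move=> red ev; have [n] := ubnP (codepth v); elim: n => // n IHn in v *; rewrite ltnS => ln.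
case: (eqVneq v (ct_root Q)) => [->|nv].
  by exists Q, id; split=> //; [exact: rt_refl|exact: iso_map_id].
pose t : ct_nonroot Q := Sub v nv.
have [|Q1 [f [m red1 ev1 [fD [[bV bD] fP fg fb fe]] fp]]] := IHn (ct_parent t).
  by apply: leq_trans (codepth_parent t) ln.
(* The dart from the parent to [v] now starts at the root of [Q1], and a dart of a closed tree
   starting there points downwards. *)
have [t1 e1 p1] : exists2 t1 : ct_nonroot Q1, val t1 = f v & ct_parent t1 = ct_root Q1.
  have sr : src (fD (inr t)) = ct_root Q1 by rewrite (fP _).1.
  have so : src (opp (fD (inr t))) = f v by rewrite (fP _).2 (fP _).1.
  case: (fD (inr t)) sr so => t1 sr so; last by exists t1.
  by have := valP t1; rewrite [val t1]sr eqxx.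
have [Q2 [g [m2 red2 ev2 ig gt]]] := reroot_step red1 ev1 p1.
exists Q2, (g \o f); split=> //; first exact: rt_trans m m2.
  by apply: iso_map_comp ig; exists fD.
by rewrite /= -e1.
Qed.

End Reroot.

Lemma moves_transport P P' Q : moves P P' -> pic_iso P Q ->
  exists Q', moves Q Q' /\ pic_iso P' Q'.
Proof.
move=> m; elim: m Q => {P P'} [P P' mv Q iso|P Q iso|P P1 P2 _ h1 _ h2 Q iso].
- by have [Q' [mv' iso']] := move_transport mv iso; exists Q'; split; first exact: rt_step.
- by exists Q; split; first exact: rt_refl.
- have [Q1 [m1 iso1]] := h1 _ iso; have [Q2 [m2 iso2]] := h2 _ iso1.
  by exists Q2; split; first exact: rt_trans m1 m2.
Qed.

Section EvenPicture.
Variable P : picture.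
Local Notation X := (pts P).

Definition pointed_clusters : {set {set option X}} :=
  [set Some @: (s : {set X}) | s in clusters P] :|: [set setT; [set None]].

Lemma pointed_picture : is_picture pointed_clusters.
Proof.
have Si : injective (@Some X) by move=> x y [].
have noN (u : {set X}) : None \notin Some @: u by apply/imsetP => -[].
have memS (u : {set X}) : (Some @: u \in pointed_clusters) = (u \in clusters P).
  rewrite in_setU in_set2 (mem_imset _ _ (imset_inj Si)).
  suff [-> ->] : (Some @: u == setT) = false /\ (Some @: u == [set None]) = false by rewrite !orbF.
  by split; apply/negbTE; apply: contra (noN u) => /eqP->; rewrite inE.
have cases w : w \in pointed_clusters ->
    (exists2 u, u \in clusters P & w = Some @: u) \/ w = setT \/ w = [set None].
  rewrite in_setU in_set2 => /orP[/imsetP[u uS ->]|/orP[]/eqP->].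
  - by left; exists u.
  - by right; left.
  - by right; right.
apply/and4P; split.
- apply/negP => /cases[[u uS /esym/eqP]|[]/setP/(_ None)]; rewrite ?inE //.
  by rewrite imset_eq0 => /eqP e; have := pic_set0 (picP P); rewrite -e uS.
- by rewrite in_setU !inE eqxx orbT.
- apply/forallP => -[x|]; last by rewrite in_setU !inE eqxx !orbT.
  by rewrite -imset_set1 memS pic_set1 ?(picP P).
apply/forall_inP => w /cases[[u uS ->]|[->|->]]; apply/forall_inP => w' /cases[[u' uS' ->]|[->|->]];
  rewrite ?subsetT ?subxx ?orbT //.
- rewrite !imset_sub // imset_disjoint //; exact: pic_nested (picP P) _ _ uS uS'.
- by rewrite disjoint_sym disjoints1 noN.
- by rewrite disjoints1 noN.
Qed.

(** Pictures of odd size first receive a point by move (iii), since the comparison of rooted trees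
    works with even sizes. *)
Lemma even_reduced_picture : exists Q, [/\ moves P Q, reduced_picture Q & ~~ odd #|pts Q|].
Proof.
have red R : ~~ odd #|pts R| -> exists Q, [/\ moves R Q, reduced_picture Q & ~~ odd #|pts Q|].
  move=> ev; have [Q [h c] [redQ _]] := reduce_picture R; exists Q; split=> //; last by rewrite -c.
  by case: h => [->|m]; [exact: rt_refl|exact: rt_step].
case: (boolP (odd #|X|)) => [od|]; last exact: red.
pose P1 := Picture pointed_picture.
have aP : add_point P P1.
  exists Some, None; split=> //; first by move=> x y [].
  by case=> [y|]; rewrite ?codom_f //; apply/negbTE/codomP => -[].
have [|Q [m rQ eQ]] := red P1; first by rewrite (add_point_card aP) /= negbK.
exists Q; split=> //; apply: rt_trans m; apply: rt_step; apply: Move_iii aP.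
by have := pic_card_gt0 (picP P); rewrite /pic_genus /card_genus; move: od; lia.
Qed.

End EvenPicture.

(** After passing to even reduced pictures [Q] and [Q'], the first is re-rooted at the vertex
    matching the root of [Q'], which makes it isomorphic to [Q']. The moves leading back from [Q']
    to [P'] are transported through this isomorphism, so that it ends up last. *)
Lemma equiv_of_core P P' T T' : is_core (tree_of_picture P) T ->
  is_core (tree_of_picture P') T' -> by_iso T T' -> pic_equiv P P'.
Proof.
move=> cT cT' iso; have [Q [m red ev]] := even_reduced_picture P.
have [Q' [m' red' ev']] := even_reduced_picture P'.
have iQ := core_moves m cT (reduced_core red); have iQ' := core_moves m' cT' (reduced_core red').
have [f mf] : exists f, @iso_map (closed_tree Q) (closed_tree Q') f.
  exact: by_iso_trans (by_iso_sym iQ) (by_iso_trans iso iQ').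
have [g [mg fK gK]] := iso_map_inv mf.
have [Q1 [h [m1 red1 ev1 mh hr]]] := reroot (g (ct_root Q')) red ev.
have [k [mk hK kK]] := iso_map_inv mh.
have [fD [[bV bD] fP fg fb fe]] := iso_map_comp mk mf.
have iso1 : pic_iso Q1 Q'.
  apply: (rooted_iso_picture ev1 ev' bV bD fP fg fb fe).
  by rewrite /= -hr hK gK.
have [R [mR isoR]] := moves_transport (moves_sym m') (pic_iso_sym iso1).
left; exists R; split; last exact: pic_iso_sym.
exact: rt_trans m (rt_trans _ _ _ _ _ m1 mR).
Qed.
(** * The cluster picture of a rooted BY tree *)

Section PictureOfTree.
Variables (T : by_graph) (r : vert T) (d : vert T -> nat).
Hypotheses (T_by : by_tree T) (rd : rooting r d).
Implicit Types (v w : vert T) (h : dart T).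

Definition below_root : finType := {v : vert T | v != r}.
Local Notation N := below_root.

Lemma up_dart_subproof (c : N) : exists h, (src h == val c) && (d (src (opp h)) < d (val c)).
Proof.
by have [_ dS _ _] := rd; have [h [sh uh]] := dS _ (valP c); exists h; rewrite sh eqxx.
Qed.

Definition up_dart (c : N) : dart T := xchoose (up_dart_subproof c).

Lemma src_up_dart c : src (up_dart c) = val c.
Proof. by case/andP: (xchooseP (up_dart_subproof c)) => /eqP. Qed.

(** The root is its own parent, so [par] can be iterated freely and [below] is reachability under
    it. *)
Definition par (v : vert T) : vert T :=
  if insub v is Some c then src (opp (up_dart c)) else r.

Lemma parN (c : N) : par (val c) = src (opp (up_dart c)).
Proof. by rewrite /par valK. Qed.

Lemma par_root : par r = r.
Proof. by rewrite /par insubN // negbK. Qed.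

Lemma par_depth (c : N) : d (par (val c)) < d (val c).
Proof. by rewrite parN; case/andP: (xchooseP (up_dart_subproof c)). Qed.

Definition dart_of (x : N + N) : dart T :=
  match x with inl c => up_dart c | inr c => opp (up_dart c) end.

Lemma dart_of_bij : bijective dart_of.
Proof.
have [_ _ dne du] := rd.
have up c : d (src (opp (up_dart c))) < d (src (up_dart c)).
  by rewrite src_up_dart -parN par_depth.
have upi c c' : up_dart c = up_dart c' -> c = c'.
  by move=> e; apply: val_inj; rewrite -!src_up_dart e.
have nupo c c' : up_dart c <> opp (up_dart c').
  move=> e; have := up c; rewrite e oppK ltnNge => /negP[]; exact: ltnW (up c').
apply: inj_surj_bij => [|h].
  case=> c [] c' /=; first by move/upi->.
  - by move/nupo.
  - by move/esym/nupo.
  - by move/(inv_inj (@oppK T))/upi->.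
have isup k : d (src (opp k)) < d (src k) -> exists c, up_dart c = k.
  move=> uk; have [d0 _ _ _] := rd.
  have nr : src k != r by apply: contraTneq uk => ->; rewrite d0.
  by exists (Sub (src k) nr); apply: du (up _) uk; rewrite src_up_dart SubK.
case: (boolP (d (src (opp h)) < d (src h))) => [/isup[c <-]|]; first by exists (inl c).
rewrite (rooting_up_opp _ rd) negbK => uh; have [|c ec] := isup (opp h); first by rewrite oppK.
by exists (inr c); rewrite /= ec oppK.
Qed.

Lemma tree_darts w (R : pred (dart T)) : (forall h, R (opp h) = R h) ->
  #|[set h | (src h == w) && R h]| =
  \sum_(c : N | val c == w) R (up_dart c) + \sum_(c : N | par (val c) == w) R (up_dart c).
Proof.
move=> RC; have [g gK Kg] := dart_of_bij.
rewrite -(card_imset _ (can_inj Kg)).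
have -> : [set g h | h in [set h | (src h == w) && R h]] =
    [set x | (src (dart_of x) == w) && R (dart_of x)].
  apply/setP => x; rewrite inE; apply/imsetP/idP => [[h]|hx].
    by rewrite inE => hh ->; rewrite Kg.
  by exists (dart_of x); rewrite ?inE ?gK.
rewrite card_dart_sum /=; congr (_ + _); rewrite [RHS]big_mkcond; apply: eq_bigr => c _.
  by rewrite src_up_dart; case: eqP.
by rewrite -parN RC; case: eqP.
Qed.

Lemma sum_up_root (F : N -> nat) : \sum_(c : N | val c == r) F c = 0.
Proof. by rewrite big_pred0 // => c; apply: negbTE; exact: valP c. Qed.

Lemma sum_up_val (F : N -> nat) c0 : \sum_(c : N | val c == val c0) F c = F c0.
Proof. by rewrite (big_pred1 c0) // => c; rewrite (inj_eq val_inj). Qed.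

Definition below : rel (vert T) := fconnect par.

Lemma below_refl v : below v v. Proof. exact: connect0. Qed.

Lemma below_trans : transitive below. Proof. exact: connect_trans. Qed.

Lemma below_par v : below v (par v). Proof. exact: fconnect1. Qed.

Lemma below_iter v w : below v w -> exists i, w = iter i par v.
Proof. by move/iter_findex => <-; eexists. Qed.

Lemma below_step v w : below v w -> v = w \/ below (par v) w.
Proof.
case/below_iter => -[|i] ->; first by left.
by right; rewrite iterSr; exact: fconnect_iter.
Qed.

Lemma below_from_root w : below r w -> w = r.
Proof. by case/below_iter => i ->; elim: i => //= i ->; rewrite par_root. Qed.

Lemma nonroot_val v : v != r -> exists c : N, v = val c.
Proof. by move=> nv; exists (Sub v nv); rewrite SubK. Qed.

Lemma below_depth v w : below v w -> d w <= d v.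
Proof.
case/below_iter => i ->; elim: i => //= i; apply: leq_trans.
case: (eqVneq (iter i par v) r) => [->|/nonroot_val[c ->]]; first by rewrite par_root.
exact: ltnW (par_depth c).
Qed.

Lemma below_depth_lt v w : below v w -> v != w -> d w < d v.
Proof.
move=> vw ne; case: (below_step vw) => [e|pw]; first by rewrite e eqxx in ne.
case: (eqVneq v r) => [ev|/nonroot_val[c ec]].
  by move: vw ne; rewrite ev => /below_from_root->; rewrite eqxx.
by apply: leq_ltn_trans (below_depth pw) _; rewrite ec par_depth.
Qed.

Lemma below_top v : below v r.
Proof.
have [n] := ubnP (d v); elim: n => // n IHn in v *; rewrite ltnS => ln.
case: (eqVneq v r) => [->|/nonroot_val[c ec]]; first exact: below_refl.
apply: below_trans (below_par v) (IHn _ _).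
by apply: leq_trans ln; rewrite ec par_depth.
Qed.

Lemma below_comparable v w w' : below v w -> below v w' -> below w w' || below w' w.
Proof.
case/below_iter => i -> /below_iter[j ->].
case: (leqP i j) => [le|/ltnW le]; rewrite -(subnK le) iterD; apply/orP; [left|right];
  exact: fconnect_iter.
Qed.

Lemma below_child v w : below v w -> v != w -> exists2 c : N, par (val c) = w & below v (val c).
Proof.
have [n] := ubnP (d v); elim: n => // n IHn in v *; rewrite ltnS => ln vw ne.
case: (eqVneq v r) => [ev|/nonroot_val[c ec]].
  by move: vw ne; rewrite ev => /below_from_root->; rewrite eqxx.
case: (below_step vw) => [e|pw]; first by rewrite e eqxx in ne.
case: (eqVneq (par v) w) => [pe|pn]; first by exists c; rewrite -ec // below_refl.
have [|c' pc' bc'] := IHn (par v) _ pw pn; first by apply: leq_trans ln; rewrite ec par_depth.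
by exists c' => //; apply: below_trans (below_par v) bc'.
Qed.

Lemma below_child_unique v w (c c' : N) : par (val c) = w -> par (val c') = w ->
  below v (val c) -> below v (val c') -> c = c'.
Proof.
move=> pc pc' bc bc'; have same (x y : N) : par (val x) = w -> par (val y) = w ->
    below (val x) (val y) -> x = y.
  move=> px py /below_step[/val_inj//|]; rewrite px -py => /below_depth le.
  by have := par_depth y; rewrite ltnNge le.
by case/orP: (below_comparable bc bc') => [/same->//|/same/esym]; apply.
Qed.

Lemma sum_below (F : vert T -> nat) w :
  \sum_(v | below v w) F v = F w + \sum_(c : N | par (val c) == w) \sum_(v | below v (val c)) F v.
Proof.
rewrite (bigD1 w) ?below_refl //=; congr (_ + _).
rewrite (exchange_big_dep (fun v => below v w && (v != w))) /=; last first.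
  move=> c v /eqP pc bc; rewrite -{1}pc (below_trans bc (below_par _)) /=.
  apply/eqP => e; have := below_depth bc; have := par_depth c; by rewrite pc -e ltnNge => /negP.
apply: eq_bigr => v /andP[vw ne]; have [c pc bc] := below_child vw ne.
rewrite (big_pred1 c) // => c'; apply/andP/eqP => [[/eqP pc' bc']|->]; last by rewrite pc.
exact: below_child_unique pc' pc bc' bc.
Qed.

Definition blue_degree w : nat := #|[set h | (src h == w) && eblue h]|.

(* Completing the blue degree of a blue vertex to [2 g + 2] by points makes the
   genus of the corresponding cluster equal to [g]. *)
Definition npoints w : nat := if vblue w then 2 * genus w + 2 - blue_degree w else 0.

Definition point_type : finType := {v : vert T & 'I_(npoints v)}.

Definition cluster_below w : {set point_type} := [set x | below (tag x) w].

Lemma card_cluster_below w : #|cluster_below w| = \sum_(v | below v w) npoints v.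
Proof.
rewrite -sum1_card.
rewrite (eq_bigl (fun x : point_type => below (tag x) w && true)); last first.
  by move=> x; rewrite inE andbT.
rewrite -(@sig_big_dep _ _ _ _ (fun v => 'I_(npoints v) : finType) (fun v => below v w)
  (fun v j => true) (fun v j => 1)).
by apply: eq_bigr => v _; rewrite sum1_card card_ord.
Qed.

Lemma card_cluster_split_below w : #|cluster_below w| =
  npoints w + \sum_(c : N | par (val c) == w) #|cluster_below (val c)|.
Proof.
rewrite card_cluster_below sum_below; congr (_ + _); apply: eq_bigr => c _.
by rewrite card_cluster_below.
Qed.

Lemma blue_degreeE w : blue_degree w =
  \sum_(c : N | val c == w) eblue (up_dart c) + \sum_(c : N | par (val c) == w) eblue (up_dart c).
Proof. exact: tree_darts (@eblue_opp T). Qed.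

Lemma degreeE w : degree w =
  \sum_(c : N | val c == w) 1 + \sum_(c : N | par (val c) == w) 1.
Proof.
rewrite -(@tree_darts w predT) //; apply: eq_card => h; by rewrite !inE andbT.
Qed.

Lemma yellow_below w : ~~ vblue w -> forall c : N, (val c == w) || (par (val c) == w) ->
  ~~ eblue (up_dart c).
Proof.
move=> yw c h; have [_ c1 _ _] := T_by; have [_ _ yel] := c1 w yw.
case/orP: h => /eqP e; first by apply: yel; rewrite src_up_dart.
by rewrite -eblue_opp; apply: yel; rewrite -parN.
Qed.

Lemma up_le1 w (F : N -> bool) : \sum_(c : N | val c == w) F c <= 1.
Proof.
case: (eqVneq w r) => [->|/nonroot_val[c ->]]; first by rewrite sum_up_root.
by rewrite sum_up_val; case: (F c).
Qed.

(** Induction from the leaves. At a blue vertex [npoints] has the parity of the blue degree,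
    condition (3) keeping the subtraction exact; the blue edges to children cancel against the odd
    clusters below them, so only the upward edge remains. At the root that sum is empty and the size
    is even. *)
Lemma odd_cluster_below w :
  odd #|cluster_below w| = odd (\sum_(c : N | val c == w) eblue (up_dart c)).
Proof.
have [n] := ubnP (\max_v d v - d w); elim: n => // n IHn in w *; rewrite ltnS => ln.
rewrite card_cluster_split_below oddD.
have -> : odd (\sum_(c : N | par (val c) == w) #|cluster_below (val c)|) =
    odd (\sum_(c : N | par (val c) == w) eblue (up_dart c)).
  rewrite !(big_morph odd oddD (erefl (odd 0))); apply: eq_bigr => c /eqP pc.
  rewrite IHn ?sum_up_val //; apply: leq_trans ln.
  have := par_depth c; rewrite pc => lt; apply: ltn_sub2l => //.
  by apply: leq_trans lt _; exact: leq_bigmax.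
have [_ _ _ c3] := T_by; rewrite /npoints; case: (boolP (vblue w)) => [bw|yw].
  have := c3 w; rewrite -/(blue_degree w) blue_degreeE.
  by move: (\sum_(_ | _) _) (\sum_(_ | _) _) (genus w) => a b g; lia.
rewrite [X in _ = odd X]big1 => [|c e]; last by rewrite (negPf (yellow_below yw _)) ?e.
rewrite big1 // => c e; by rewrite (negPf (yellow_below yw _)) // e orbT.
Qed.

(** At a blue vertex the total is 2g+2, minus one if the upward edge is blue, plus the number of
    yellow edges to children. For g = 0 a yellow edge exists: either it is the upward one and
    nothing is subtracted, or it leads to a child and compensates. A yellow vertex has at least two
    children, and the exceptional point carries two points. *)
Lemma npoints_children_ge2 w : 1 < npoints w + \sum_(c : N | par (val c) == w) 1.
Proof.
have [_ c1 c2 c3] := T_by; rewrite /npoints; case: (boolP (vblue w)) => [bw|yw]; last first.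
  have [_ + _] := c1 w yw; rewrite degreeE.
  have := up_le1 w xpredT => /=; move: (\sum_(c : N | val c == w) 1) => a; lia.
have := c3 w; rewrite -/(blue_degree w) blue_degreeE.
have := up_le1 w (fun c => eblue (up_dart c)).
have : \sum_(c : N | par (val c) == w) eblue (up_dart c) +
    \sum_(c : N | par (val c) == w) ~~ eblue (up_dart c) = \sum_(c : N | par (val c) == w) 1.
  by rewrite -big_split /=; apply: eq_bigr => c _; case: eblue.
have : \sum_(c : N | val c == w) eblue (up_dart c) +
    \sum_(c : N | val c == w) ~~ eblue (up_dart c) <= 1.
  rewrite -big_split /= (eq_bigr (fun=> true : nat)) ?(up_le1 w xpredT) // => c _.
  by case: eblue.
have : genus w = 0 -> by_condition2 T ->
    0 < \sum_(c : N | val c == w) ~~ eblue (up_dart c) +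
        \sum_(c : N | par (val c) == w) ~~ eblue (up_dart c).
  move=> g0 c2'; rewrite -(@tree_darts w (fun h => ~~ eblue h)) => [|h]; last by rewrite eblue_opp.
  by have [h [sh yh]] := c2' w bw g0; apply/card_gt0P; exists h; rewrite inE sh eqxx.
case: c2 => [c2|[_ D0 _]].
  move=> /(_ _ c2); move: (\sum_(_ | _) _) (\sum_(_ | _) _) (\sum_(_ | _) _) (\sum_(_ | _) _) (\sum_(_ | _) _).
  by move: (genus w) => g x1 x2 x3 x4 x5; case: g => [|g]; [move=> /(_ erefl)|move=> _]; lia.
have none (Q : pred N) (F : N -> nat) : \sum_(c | Q c) F c = 0.
  by rewrite big1 // => c; have := D0; rewrite (cardD1 (up_dart c)) inE.
by rewrite !none; lia.
Qed.

Lemma card_cluster_below_ge w :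
  npoints w + \sum_(c : N | par (val c) == w) 1 <= #|cluster_below w|.
Proof.
have [n] := ubnP (\max_v d v - d w); elim: n => // n IHn in w *; rewrite ltnS => ln.
rewrite card_cluster_split_below leq_add2l; apply: leq_sum => c /eqP pc.
apply: leq_trans (ltnW (npoints_children_ge2 (val c))) (IHn _ _); apply: leq_trans ln.
have := par_depth c; rewrite pc => lt; apply: ltn_sub2l => //.
by apply: leq_trans lt _; exact: leq_bigmax.
Qed.

Lemma card_cluster_below_gt1 w : 1 < #|cluster_below w|.
Proof. exact: leq_trans (npoints_children_ge2 w) (card_cluster_below_ge w). Qed.

Lemma card_child_below (c : N) : #|cluster_below (val c)| < #|cluster_below (par (val c))|.
Proof.
have split_c (F : N -> nat) : \sum_(i : N | par (val i) == par (val c)) F i =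
    F c + \sum_(i : N | (par (val i) == par (val c)) && (i != c)) F i by rewrite (bigD1 c).
have := npoints_children_ge2 (par (val c)).
rewrite (card_cluster_split_below (par (val c))) !split_c.
have : \sum_(i : N | (par (val i) == par (val c)) && (i != c)) 1 <=
    \sum_(i : N | (par (val i) == par (val c)) && (i != c)) #|cluster_below (val i)|.
  by apply: leq_sum => i _; exact: ltnW (card_cluster_below_gt1 _).
by lia.
Qed.

(** Clusters are non-empty, so an inclusion yields a common point and makes the vertices comparable.
    If [w] were strictly below [v], its cluster would fit into that of a child of [v], which is
    strictly smaller than that of [v]. *)
Lemma cluster_below_sub v w : (cluster_below v \subset cluster_below w) = below v w.
Proof.
apply/idP/idP => [sub|vw]; last first.
  by apply/subsetP => x; rewrite !inE => xv; exact: below_trans xv vw.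
have [x xv] : exists x, x \in cluster_below v.
  by apply/card_gt0P; exact: ltnW (card_cluster_below_gt1 v).
have := subsetP sub x xv; rewrite !inE in xv * => xw.
case/orP: (below_comparable xv xw) => // wv; case: (eqVneq w v) => [->|ne]; first exact: below_refl.
have [c pc bc] := below_child wv ne.
have := subset_leq_card sub; rewrite leqNgt => /negP[]; rewrite -pc.
apply: leq_ltn_trans (card_child_below c); apply/subset_leq_card/subsetP => y.
by rewrite !inE => yw; exact: below_trans yw bc.
Qed.

Lemma cluster_below_inj : injective cluster_below.
Proof.
move=> v w e; have vw : below v w by rewrite -cluster_below_sub e.
have wv : below w v by rewrite -cluster_below_sub e.
apply/eqP; apply: contraT => ne; have := below_depth_lt vw ne.
by rewrite ltnNge (below_depth wv).
Qed.

Lemma cluster_below_top : cluster_below r = setT.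
Proof. by apply/setP => x; rewrite !inE below_top. Qed.

Definition tree_clusters : {set {set point_type}} :=
  [set cluster_below w | w : vert T] :|: [set [set x] | x : point_type].

Lemma tree_clustersP u : u \in tree_clusters ->
  (exists w, u = cluster_below w) \/ exists x, u = [set x].
Proof.
by rewrite in_setU => /orP[]/imsetP[x _ ->]; [left|right]; exists x.
Qed.

Lemma cluster_below_in w : cluster_below w \in tree_clusters.
Proof. by rewrite in_setU imset_f. Qed.

Lemma tree_picture : is_picture tree_clusters.
Proof.
apply/and4P; split.
- apply/negP => /tree_clustersP[[w e]|[x /esym/eqP]]; last by rewrite -cards_eq0 cards1.
  by have := card_cluster_below_gt1 w; rewrite -e cards0.
- by rewrite -cluster_below_top cluster_below_in.
- by apply/forallP => x; rewrite in_setU [X in _ || X]imset_f ?orbT.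
apply/forall_inP => u /tree_clustersP[[w ->]|[x ->]]; last first.
  apply/forall_inP => v _; rewrite disjoints1 sub1set.
  by case: (x \in v); rewrite ?orbT.
apply/forall_inP => v /tree_clustersP[[w' ->]|[x ->]]; last first.
  by rewrite disjoint_sym disjoints1 sub1set; case: (x \in _); rewrite ?orbT.
rewrite !cluster_below_sub; case: (boolP [disjoint _ & _]) => //= /pred0Pn[x /andP[]].
by rewrite !inE; exact: below_comparable.
Qed.

Local Notation P := (Picture tree_picture).

Lemma point_type_gt1 : 1 < #|pts P|.
Proof. by rewrite -cardsT -cluster_below_top card_cluster_below_gt1. Qed.

Lemma below_proper_cluster w : proper_cluster tree_clusters (cluster_below w).
Proof. by rewrite /proper_cluster cluster_below_in card_cluster_below_gt1. Qed.

Definition below_vert w : ct_vert P := Sub (cluster_below w) (below_proper_cluster w).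

Lemma val_below_vert w : val (below_vert w) = cluster_below w.
Proof. by rewrite SubK. Qed.

Lemma below_vert_bij : bijective below_vert.
Proof.
apply: inj_surj_bij => [v w /(congr1 val)|s].
  by rewrite !val_below_vert => /cluster_below_inj.
have := ct_vert_gt1 s point_type_gt1; have := ct_vert_cluster s.
case/tree_clustersP => [[w e]|[x ->]]; last by rewrite cards1.
by exists w; apply: val_inj; rewrite val_below_vert e.
Qed.

Lemma below_vert_root : below_vert r = ct_root P.
Proof. by apply: val_inj; rewrite val_below_vert cluster_below_top. Qed.

Lemma below_vert_nonroot (c : N) : below_vert (val c) != ct_root P.
Proof. by rewrite -below_vert_root (bij_eq below_vert_bij); exact: valP c. Qed.

Definition below_nonroot (c : N) : ct_nonroot P := Sub (below_vert (val c)) (below_vert_nonroot c).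

Lemma val_below_nonroot c : val (below_nonroot c) = below_vert (val c).
Proof. by rewrite SubK. Qed.

Lemma below_nonroot_bij : bijective below_nonroot.
Proof.
apply: inj_surj_bij => [c c' /(congr1 val)|t].
  by rewrite !val_below_nonroot => /(bij_inj below_vert_bij)/val_inj.
have [g _ gK] := below_vert_bij.
have nr : g (val t) != r.
  by rewrite -(bij_eq below_vert_bij) gK below_vert_root; exact: valP t.
by exists (Sub (g (val t)) nr); apply: val_inj; rewrite val_below_nonroot !SubK gK.
Qed.

Lemma below_parent c : ct_parent (below_nonroot c) = below_vert (par (val c)).
Proof.
apply/eqP; rewrite ct_parentP val_below_nonroot !val_below_vert.
apply/(childP tree_picture); split; try exact: cluster_below_in.
  rewrite properE !cluster_below_sub below_par /=.
  by apply/negP => /below_depth; rewrite leqNgt par_depth.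
move=> u /tree_clustersP[[w ->]|[x ->]]; last first.
  by move/proper_card; rewrite cards1 ltnNge ltnW ?card_cluster_below_gt1.
rewrite properE !cluster_below_sub => /andP[cw nwc].
case: (below_step cw) => // e; by rewrite -e below_refl in nwc.
Qed.

Lemma sum_parent (F : ct_nonroot P -> nat) w :
  \sum_(t | ct_parent t == below_vert w) F t = \sum_(c : N | par (val c) == w) F (below_nonroot c).
Proof.
rewrite (reindex below_nonroot); last exact: onW_bij below_nonroot_bij.
by apply: eq_bigl => c; rewrite below_parent (bij_eq below_vert_bij).
Qed.

Lemma odd_below_nonroot c : odd #|val (val (below_nonroot c))| = eblue (up_dart c).
Proof.
by rewrite val_below_nonroot val_below_vert odd_cluster_below sum_up_val; case: eblue.
Qed.

(** [eK] expresses the size through the sum [K] of [half_size_split]. At a blue vertex points and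
    lower blue edges add up to 2g+2, less one for a blue upward edge, so the half size is g + K. At
    a yellow vertex the size is 2K and the half size K - 1, which forces [ubereven]. *)
Lemma below_vert_genus w :
  ct_genus (below_vert w) = genus w /\ ct_vblue (below_vert w) = vblue w.
Proof.
have := half_size_split (below_vert w); rewrite sum_parent val_below_vert.
rewrite -/(ct_genus (below_vert w)) /ct_vblue val_below_vert.
set K := \sum_(c : N | _) _.
have eK : #|cluster_below w| = npoints w + \sum_(c : N | par (val c) == w) eblue (up_dart c) + 2 * K.
  rewrite card_cluster_split_below -addnA; congr (_ + _); rewrite /K big_distrr -big_split /=.
  apply: eq_bigr => c _; rewrite -odd_below_nonroot val_below_nonroot val_below_vert /half_size.
  by have := card_cluster_below_gt1 (val c); move: #|_| => m; lia.
have [_ c1 _ c3] := T_by; move: eK; rewrite /half_size /npoints.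
have gt1 := card_cluster_below_gt1 w.
have gu : ubereven tree_clusters (cluster_below w) -> ct_genus (below_vert w) = 0.
  by move=> ub; rewrite /ct_genus /cluster_genus val_below_vert ub.
case: (boolP (vblue w)) => [bw|yw].
  have := c3 w; rewrite -/(blue_degree w) blue_degreeE.
  have := up_le1 w (fun c => eblue (up_dart c)).
  move: (\sum_(c : N | val c == w) _) (\sum_(c : N | par (val c) == w) _) => a b.
  move: gu; case: ubereven => [/(_ isT)->|_] /=; move: gt1; move: #|cluster_below w| => m; lia.
rewrite [\sum_(c : N | _) eblue _]big1 => [|c e]; last first.
  by rewrite (negPf (yellow_below yw _)) // e orbT.
have [-> _ _] := c1 w yw.
move: gu; case: ubereven => [/(_ isT)->|_] /=; move: gt1; move: #|cluster_below w| => m; lia.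
Qed.

Lemma below_closed_tree : by_iso (closed_tree P) T.
Proof.
apply: by_iso_sym; have [dd ddK Kdd] := dart_of_bij.
pose fx (x : N + N) : dart (closed_tree P) :=
  match x with inl c => inl (below_nonroot c) | inr c => inr (below_nonroot c) end.
have fE x : (fx \o dd) (dart_of x) = fx x by rewrite /= ddK.
exists below_vert, (fx \o dd); split.
- split; first exact: below_vert_bij.
  apply: bij_comp; last by exists dart_of.
  have [g gK Kg] := below_nonroot_bij.
  by exists (fun x => match x with inl c => inl (g c) | inr c => inr (g c) end) => -[] c /=;
    rewrite ?gK ?Kg.
- move=> h; rewrite -(Kdd h); case: (dd h) => c; rewrite fE.
    rewrite -[opp (dart_of (inl c))]/(dart_of (inr c)) fE; split=> //.
    by rewrite [LHS]val_below_nonroot [src _]src_up_dart.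
  rewrite [opp (dart_of _)](oppK (up_dart c)) -[up_dart c]/(dart_of (inl c)) fE; split=> //.
  by rewrite [LHS]below_parent parN.
- by move=> w; case: (below_vert_genus w).
- by move=> w; case: (below_vert_genus w).
- move=> h; rewrite -(Kdd h); case: (dd h) => c; rewrite fE.
    by rewrite [LHS]odd_below_nonroot.
  by rewrite [LHS]odd_below_nonroot [RHS]eblue_opp.
Qed.

(** A yellow root has three yellow edges and hence three even children. A blue root of positive
    genus has at least three odd children; one of genus 0 has two, and its yellow edge gives an even
    child besides. The exceptional point yields only two points. *)
Lemma tree_picture_reduced : reduced_picture P.
Proof.
move=> ev X2; rewrite -[setT]/(val (ct_root P)) -below_vert_root card_children_split.
have [g0 b0] := below_vert_genus r; have X1 := point_type_gt1.
have on : ~~ odd #|odd_children (clusters P) (val (below_vert r))|.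
  by rewrite -odd_card_odd_children // below_vert_root ct_root_val cardsT.
have [_ c1 c2 _] := T_by.
have eE : even_below (below_vert r) = #|[set h | (src h == r) && ~~ eblue h]|.
  rewrite (@tree_darts r (fun h => ~~ eblue h)) => [|h]; last by rewrite eblue_opp.
  rewrite sum_up_root /even_below sum_parent; apply: eq_bigr => c _.
  by rewrite odd_below_nonroot.
move: g0 b0 on; rewrite /ct_genus /ct_vblue /cluster_genus (ubereven_ct (below_vert r) X1).
case: eqP => [->|n0] g0 b0 on.
  have [_ dg yel] := c1 r (negbT (esym b0)); rewrite add0n eE; apply: leq_trans dg _.
  by apply/subset_leq_card/subsetP => h; rewrite !inE => /eqP sh; rewrite sh eqxx yel.
case: (posnP (genus r)) => [gr|gr]; last by move: on n0 g0; move: #|_| => n; lia.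
case: c2 => [/(_ r (esym b0) gr)[h [sh yh]]|[V1 D0 _]].
  have : 0 < even_below (below_vert r).
    by rewrite eE; apply/card_gt0P; exists h; rewrite inE sh eqxx.
  by move: on n0; move: #|_| => n; lia.
move: X2; rewrite -cardsT -cluster_below_top card_cluster_split_below big1 => [|c]; last first.
  by have := D0; rewrite (cardD1 (up_dart c)) inE.
by rewrite /npoints -b0 gr addn0 => /leq_trans/(_ (leq_subr _ _)).
Qed.

End PictureOfTree.

Lemma picture_of_tree_exists T : by_tree T ->
  exists (P : picture) (T' : by_graph), is_core (tree_of_picture P) T' /\ by_iso T' T.
Proof.
move=> Tt; have [[Tcl Ti] _ _ _] := Tt; have [[[r] _] _] := Ti.
have [d rd] := rooting_exists r Tcl Ti.
exists (Picture (tree_picture Tt rd)), (closed_tree (Picture (tree_picture Tt rd))).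
by split; [exact/reduced_core/tree_picture_reduced|exact: below_closed_tree].
Qed.
Theorem theorem1p1 :
  ((forall G : igraph, hyperelliptic G ->
      [/\ by_tree (tree_of_graph G),
          by_genus (tree_of_graph G) = hyp_genus G
        & hyp_iso (graph_of_tree (tree_of_graph G)) G]) /\
   (forall T : by_graph, by_tree T ->
      [/\ hyperelliptic (graph_of_tree T),
          hyp_genus (graph_of_tree T) = by_genus T
        & by_iso (tree_of_graph (graph_of_tree T)) T]) /\
   (forall G G' : igraph, hyperelliptic G -> hyperelliptic G' ->
      (hyp_iso G G' <-> by_iso (tree_of_graph G) (tree_of_graph G'))) /\
   (forall T T' : by_graph, by_tree T -> by_tree T' ->
      (by_iso T T' <-> hyp_iso (graph_of_tree T) (graph_of_tree T')))) /\
  ((forall P : picture,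
      open_by_tree (tree_of_picture P) /\
      exists T : by_graph, is_core (tree_of_picture P) T) /\
   (forall (P : picture) (T : by_graph), is_core (tree_of_picture P) T ->
      by_tree T /\ by_genus T = pic_genus P) /\
   (forall (P P' : picture) (T T' : by_graph),
      is_core (tree_of_picture P) T -> is_core (tree_of_picture P') T' ->
      (pic_equiv P P' <-> by_iso T T')) /\
   (forall T : by_graph, by_tree T ->
      exists (P : picture) (T' : by_graph),
        is_core (tree_of_picture P) T' /\ by_iso T' T)).
Proof.
split.
  split=> [G Gh|].
    by split; [exact: tree_of_graph_by|exact: tree_of_graph_genus|exact: graph_of_tree_of_graph].
  split=> [T Tt|].
    by split; [exact: graph_of_tree_hyp|exact: graph_of_tree_genus|exact: tree_of_graph_of_tree].
  split=> [G G' Gh Gh'|T T' Tt Tt']; split.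
  - exact: tree_of_graph_iso.
  - move/graph_of_tree_iso => iso.
    apply: hyp_iso_trans (hyp_iso_sym (graph_of_tree_of_graph Gh)) _.
    exact: hyp_iso_trans iso (graph_of_tree_of_graph Gh').
  - exact: graph_of_tree_iso.
  - move/tree_of_graph_iso => iso.
    apply: by_iso_trans (by_iso_sym (tree_of_graph_of_tree Tt)) _.
    exact: by_iso_trans iso (tree_of_graph_of_tree Tt').
split=> [P|]; first by split; [exact: tree_of_picture_open_by|exact: core_exists].
split=> [P T|]; first exact: core_by_tree.
split=> [P P' T T' cT cT'|]; last exact: picture_of_tree_exists.
by split=> [e|]; [exact: core_equiv e cT cT'|exact: equiv_of_core cT cT'].
Qed.
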